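(* Let $k\geq 1$ and $n$ be integers with $k+2\leq n$. Then the canonical morphism $$\Gamma_k(IA_n)/\Gamma_{k+1}(IA_n)\longrightarrow \mathcal A_k(F_n)/\mathcal A_{k+1}(F_n)$$ induced by the inclusions $\Gamma_j(IA_n)\subseteq \mathcal A_j(F_n)$ is surjective, and the Johnson morphism $\tau$ induces an isomorphism $$\mathcal A_k(F_n)/\mathcal A_{k+1}(F_n)\;\cong\; \mathfrak I_k .$$
   Context: $F_n$ is the free group on $n$ generators; $\Gamma_*(G)$ denotes the lower central series of a group $G$: $\Gamma_1(G)=G$, $\Gamma_{k+1}(G)=[G,\Gamma_k(G)]$, with $[x,y]=xyx^{-1}y^{-1}$. $IA_n\subseteq \mathrm{Aut}(F_n)$ is the group of automorphisms acting trivially on $F_n^{ab}\cong\mathbb Z^n$. The Andreadakis filtration is $\mathcal A_j(F_n)=\{\sigma\in\mathrm{Aut}(F_n) : \sigma \text{ acts trivially on } F_n/\Gamma_{j+1}(F_n)\}$ for $j\ge 1$; it satisfies $\mathcal A_1(F_n)=IA_n$, $[\mathcal A_i,\mathcal A_j]\subseteq\mathcal A_{i+j}$, and $\Gamma_j(IA_n)\subseteq\mathcal A_j(F_n)$. Let $V=F_n^{ab}$ and let $\mathfrak LV=\bigoplus_{j\geq1}\mathfrak L_jV$ be the free Lie ring on $V$, canonically identified with $\bigoplus_j \Gamma_j(F_n)/\Gamma_{j+1}(F_n)$ (bracket induced by commutators). $\mathrm{Der}(\mathfrak LV)$ is the graded Lie ring of derivations of $\mathfrak LV$, a derivation having degree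 $k$ when it raises degrees by $k$. The Johnson morphism is the graded Lie ring morphism $\tau:\bigoplus_{j\ge1}\mathcal A_j(F_n)/\mathcal A_{j+1}(F_n)\to\mathrm{Der}(\mathfrak LV)$ sending the class of $\sigma\in\mathcal A_j(F_n)$ to the degree-$j$ derivation induced by $x\mapsto \sigma(x)x^{-1}$. Finally $\mathfrak I=\bigoplus_{k\geq 1}\mathfrak I_k$ is the Lie subring of $\mathrm{Der}(\mathfrak LV)$ generated by the derivations of degree $1$. *)

(* Defs.v *)
From HB Require Import structures.
From mathcomp Require Import all_boot all_order all_algebra.
From mathcomp Require Import generic_quotient.
From mathcomp Require Import boolp classical_sets functions.

Set Implicit Arguments.
Unset Strict Implicit.
Unset Printing Implicit Defensive.

Import GRing.Theory.

Local Open Scope classical_set_scope.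
Local Open Scope group_scope.

(* Subgroups of a possibly infinite group are represented by classical sets. *)
Section Subgroups.
Variable G : groupType.
Implicit Types (A B H N C D : set G) (x y : G) (k : nat).

Definition is_subgroup H := H 1 /\ forall x y, H x -> H y -> H (x * y^-1).

Definition subgroup_gen A : set G := smallest is_subgroup A.

(* MathComp's [~ x, y] is x^-1 * y^-1 * x * y; this is the other convention. *)
Definition comm x y : G := x * y * x^-1 * y^-1.

Definition comm_subgroup A B : set G :=
  subgroup_gen [set comm x y | x in A & y in B].

(* lcs H k is Gamma_k(H), for k >= 1; as for MathComp's 'L_n(_), the index 0
   also gives H. *)
Definition lcs H k : set G := iter k.-1 (comm_subgroup H) H.

Definition set_mulg C D : set G := [set x * y | x in C & y in D].

Definition left_coset x N : set G := [set x * y | y in N].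

(* The underlying set of the quotient group H / N, whose product is set_mulg. *)
Definition cosets H N : set (set G) := [set left_coset x N | x in H].

(* The map H / N -> H' / N' induced by inclusions H <= H' and N <= N'. *)
Definition coset_incl N' C : set G := set_mulg C N'.

Lemma coset_inclE N N' x : is_subgroup N -> is_subgroup N' -> N `<=` N' ->
  coset_incl N' (left_coset x N) = left_coset x N'.
Proof.
move=> [N1 _] [N'1 NB'] sNN'; have NV' y : N' y -> N' y^-1.
  by move=> Ny; rewrite -[y^-1]mul1g; apply: NB'.
apply/seteqP; split=> z /=.
  case=> _ [y Ny <-] [y' Ny' <-]; exists (y * y'); last by rewrite mulgA.
  by rewrite -[y']invgK; apply: NB'; [apply: sNN' | apply: NV'].
by case=> y Ny <-; exists x; [exists 1; rewrite ?mulg1 | exists y].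
Qed.

Lemma subgroup_gen_subgroup A : is_subgroup (subgroup_gen A).
Proof.
split=> [B [] [] // | x y Ax Ay B sB].
by case: (sB) => -[_ BB] _; apply: BB; [apply: Ax | apply: Ay].
Qed.

Lemma mem_comm A B x y : A x -> B y -> comm_subgroup A B (comm x y).
Proof. by move=> Ax By; apply: sub_gen_smallest; exists x => //; exists y. Qed.

End Subgroups.

Section Abelianization.
Variable G : groupType.

Definition derived_subgroup : set G := comm_subgroup setT setT.

Lemma derivedM (x y : G) :
  derived_subgroup x -> derived_subgroup y -> derived_subgroup (x * y).
Proof.
have [D1 DB] := subgroup_gen_subgroup [set comm x y | x in setT & y in [set: G]].
move=> Dx Dy; rewrite -[y]invgK; apply: (DB) => //.
by rewrite -[y^-1]mul1g; apply: DB.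
Qed.

Lemma derivedV (x : G) : derived_subgroup x -> derived_subgroup x^-1.
Proof.
have [D1 DB] := subgroup_gen_subgroup [set comm x y | x in setT & y in [set: G]].
by move=> Dx; rewrite -[x^-1]mul1g; apply: DB.
Qed.

Lemma derivedJ (x y : G) : derived_subgroup y -> derived_subgroup (x * y * x^-1).
Proof.
move=> Dy; rewrite -[X in derived_subgroup X](mulgVK y); apply: derivedM => //.
exact: mem_comm.
Qed.

Definition ab_rel (x y : G) : bool := `[< derived_subgroup (x * y^-1) >].

Lemma ab_refl : reflexive ab_rel.
Proof.
move=> x; apply/asboolP; rewrite mulgV.
by case: (subgroup_gen_subgroup [set comm x y | x in setT & y in [set: G]]).
Qed.

Lemma ab_sym : symmetric ab_rel.
Proof.
by move=> x y; apply/asboolP/asboolP => /derivedV; rewrite invgM invgK.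
Qed.

Lemma ab_trans : transitive ab_rel.
Proof.
move=> y x z /asboolP xy /asboolP yz; apply/asboolP.
by have := derivedM xy yz; rewrite mulgA mulgVK.
Qed.

Canonical ab_equiv := EquivRel ab_rel ab_refl ab_sym ab_trans.

Definition abelianization := {eq_quot ab_equiv}%qT.

HB.instance Definition _ := Choice.on abelianization.

Definition ab (x : G) : abelianization := (\pi_abelianization x)%qT.

Lemma abP x y : ab x = ab y <-> derived_subgroup (x * y^-1).
Proof.
split=> [/eqP|Dxy]; first by rewrite /ab piE => /asboolP.
by apply/eqP; rewrite /ab piE; apply/asboolP.
Qed.

Lemma ab_surj (a : abelianization) : exists x, a = ab x.
Proof. by exists (repr a); rewrite /ab reprK. Qed.

Definition ab_add (a b : abelianization) := ab (repr a * repr b).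
Definition ab_opp (a : abelianization) := ab (repr a)^-1.

Lemma ab_repr x : derived_subgroup (repr (ab x) * x^-1).
Proof. by apply/abP; rewrite {1}/ab reprK. Qed.

Lemma ab_addE x y : ab_add (ab x) (ab y) = ab (x * y).
Proof.
apply/abP; set a := repr _; set b := repr _.
have -> : a * b * (x * y)^-1 = (a * (b * y^-1) * a^-1) * (a * x^-1).
  by rewrite invgM !mulgA mulgVK.
exact: derivedM (derivedJ a (ab_repr y)) (ab_repr x).
Qed.

Lemma ab_oppE x : ab_opp (ab x) = ab x^-1.
Proof.
apply/abP; rewrite invgK.
have := derivedJ x^-1 (derivedV (ab_repr x)).
by rewrite invgM !invgK mulgA mulVg mul1g.
Qed.

Lemma ab_addA : associative ab_add.
Proof.
move=> a b c; have [x ->] := ab_surj a; have [y ->] := ab_surj b.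
by have [z ->] := ab_surj c; rewrite !ab_addE mulgA.
Qed.

Lemma ab_addC : commutative ab_add.
Proof.
move=> a b; have [x ->] := ab_surj a; have [y ->] := ab_surj b.
by rewrite !ab_addE; apply/abP; rewrite invgM mulgA; apply: mem_comm.
Qed.

Lemma ab_add0 : left_id (ab 1) ab_add.
Proof. by move=> a; have [x ->] := ab_surj a; rewrite ab_addE mul1g. Qed.

Lemma ab_addN : left_inverse (ab 1) ab_opp ab_add.
Proof.
by move=> a; have [x ->] := ab_surj a; rewrite ab_oppE ab_addE mulVg.
Qed.

HB.instance Definition _ :=
  GRing.isZmodule.Build abelianization ab_addA ab_addC ab_add0 ab_addN.

Lemma abM x y : ab (x * y) = (ab x + ab y)%R.
Proof. by rewrite -ab_addE. Qed.

End Abelianization.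

Section GroupAutomorphisms.
Variable G : groupType.

Record autom := Autom {
  autom_fun :> G -> G;
  automM : {morph autom_fun : x y / x * y};
  autom_bij : bijective autom_fun }.

HB.instance Definition _ := gen_eqMixin autom.
HB.instance Definition _ := gen_choiceMixin autom.

Lemma autom_ext (s t : autom) : s =1 t -> s = t.
Proof.
case: s t => [f fM fB] [g gM gB] /= /funext fg; subst g.
by rewrite (Prop_irrelevance fM gM) (Prop_irrelevance fB gB).
Qed.

Definition autom_one : autom :=
  @Autom id (fun _ _ => erefl) (Bijective (fun _ => erefl) (fun _ => erefl)).

Lemma autom_mul_morph (s t : autom) : {morph s \o t : x y / x * y}.
Proof. by move=> x y /=; rewrite !automM. Qed.

Definition autom_mul (s t : autom) : autom :=
  Autom (autom_mul_morph s t) (bij_comp (autom_bij s) (autom_bij t)).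

Lemma autom_inv_ex (s : autom) : {g : G -> G | cancel s g /\ cancel g s}.
Proof. by apply: cid; case: (autom_bij s) => g sK gK; exists g. Qed.

Lemma autom_inv_morph (s : autom) : {morph projT1 (autom_inv_ex s) : x y / x * y}.
Proof.
case: (autom_inv_ex s) => g [sK gK] /= x y.
by rewrite -{1}[x]gK -{1}[y]gK -automM sK.
Qed.

Lemma autom_inv_bij (s : autom) : bijective (projT1 (autom_inv_ex s)).
Proof. by case: (autom_inv_ex s) => g [sK gK] /=; exists s. Qed.

Definition autom_inv (s : autom) : autom := Autom (autom_inv_morph s) (autom_inv_bij s).

Lemma autom_mulA : associative autom_mul.
Proof. by move=> s t u; apply: autom_ext. Qed.

Lemma autom_mul1 : left_id autom_one autom_mul.
Proof. by move=> s; apply: autom_ext. Qed.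

Lemma autom_1mul : right_id autom_one autom_mul.
Proof. by move=> s; apply: autom_ext. Qed.

Lemma autom_mulV : left_inverse autom_one autom_inv autom_mul.
Proof.
by move=> s; apply: autom_ext => x /=; case: (autom_inv_ex s) => g [sK gK] /=.
Qed.

Lemma autom_Vmul : right_inverse autom_one autom_inv autom_mul.
Proof.
by move=> s; apply: autom_ext => x /=; case: (autom_inv_ex s) => g [sK gK] /=.
Qed.

HB.instance Definition _ := isGroup.Build autom
  autom_mulA autom_mul1 autom_1mul autom_mulV autom_Vmul.

End GroupAutomorphisms.

(* The free group: reduced words in the letters (i, b), where (i, false) stands
   for the generator x_i and (i, true) for its inverse. *)
Section FreeGroup.
Variable n : nat.

Definition letter := ('I_n * bool)%type.
Implicit Types (a b : letter) (u v w : seq letter).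

Definition letter_inv a : letter := (a.1, ~~ a.2).

Definition reduced w : bool := sorted (fun a b => b != letter_inv a) w.

Record freeGroup := FreeGroup { word :> seq letter; _ : reduced word }.

HB.instance Definition _ := [isSub for word].
HB.instance Definition _ := [Choice of freeGroup by <:].

Definition letter_mul a w : seq letter :=
  if w is b :: w' then if b == letter_inv a then w' else a :: w else [:: a].

Definition word_mul u v : seq letter := foldr letter_mul v u.

Definition word_inv u : seq letter := rev (map letter_inv u).

Lemma letter_invK : involutive letter_inv.
Proof. by case=> i b; rewrite /letter_inv /= negbK. Qed.

Lemma reduced_behead a w : reduced (a :: w) -> reduced w.
Proof. exact: path_sorted. Qed.

Lemma reduced_letter_mul a w : reduced w -> reduced (letter_mul a w).
Proof.
case: w => //= b w; case: eqP => [_ /path_sorted //| /eqP nb rw] /=.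
by rewrite nb.
Qed.

Lemma reduced_mul u v : reduced v -> reduced (word_mul u v).
Proof. by move=> rv; elim: u => //= a u; apply: reduced_letter_mul. Qed.

Lemma reduced_inv u : reduced u -> reduced (word_inv u).
Proof.
rewrite /reduced /word_inv rev_sorted sorted_map; apply: sub_sorted => a b /=.
by apply: contraNneq => ->; rewrite letter_invK.
Qed.

Lemma letter_mulK a w : reduced w -> letter_mul a (letter_mul (letter_inv a) w) = w.
Proof.
case: w => [|b w] /=; first by rewrite eqxx.
rewrite letter_invK; case: eqP => [-> |_ _] /=; last by rewrite eqxx.
by case: w => //= c w /andP[/negbTE ->].
Qed.

Lemma letter_mulM a u v : reduced u -> reduced v ->
  word_mul (letter_mul a u) v = letter_mul a (word_mul u v).
Proof.
case: u => //= b u ru rv; case: eqP => //= ->.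
by rewrite letter_mulK //; apply: reduced_mul.
Qed.

Lemma word_mulA u v w : reduced u -> reduced v -> reduced w ->
  word_mul u (word_mul v w) = word_mul (word_mul u v) w.
Proof.
move=> + rv rw; elim: u => //= a u IHu ru.
rewrite letter_mulM ?IHu //; first exact: reduced_behead ru.
exact: reduced_mul.
Qed.

Lemma word_mul1 u : reduced u -> word_mul u [::] = u.
Proof.
elim: u => //= a u IHu ru; rewrite IHu; last exact: path_sorted ru.
by case: u ru {IHu} => //= b u /andP[/negbTE ->].
Qed.

Lemma word_mulV u : reduced u -> word_mul (word_inv u) u = [::].
Proof.
elim: u => //= a u IHu ru; rewrite /word_inv /= rev_cons -cats1 /word_mul.
rewrite foldr_cat /= letter_invK eqxx; apply: IHu; exact: path_sorted ru.
Qed.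

Lemma word_invK : involutive word_inv.
Proof. by move=> u; rewrite /word_inv map_rev revK (mapK letter_invK). Qed.

Lemma word_reduced (x : freeGroup) : reduced x. Proof. by case: x. Qed.

Definition free_one : freeGroup := @FreeGroup [::] isT.
Definition free_mul (x y : freeGroup) : freeGroup :=
  FreeGroup (reduced_mul x (word_reduced y)).
Definition free_inv (x : freeGroup) : freeGroup :=
  FreeGroup (reduced_inv (word_reduced x)).

Lemma free_mulA : associative free_mul.
Proof. by move=> x y z; apply: val_inj; apply: word_mulA; apply: word_reduced. Qed.

Lemma free_1mul : left_id free_one free_mul.
Proof. by move=> x; apply: val_inj. Qed.

Lemma free_mul1 : right_id free_one free_mul.
Proof. by move=> x; apply: val_inj; apply: word_mul1; apply: word_reduced. Qed.

Lemma free_mulV : left_inverse free_one free_inv free_mul.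
Proof. by move=> x; apply: val_inj; apply: word_mulV; apply: word_reduced. Qed.

Lemma free_Vmul : right_inverse free_one free_inv free_mul.
Proof.
move=> x; apply: val_inj; rewrite /= -{1}[word x]word_invK.
by apply: word_mulV; apply/reduced_inv/word_reduced.
Qed.

HB.instance Definition _ := isGroup.Build freeGroup
  free_mulA free_1mul free_mul1 free_mulV free_Vmul.

End FreeGroup.

Local Open Scope ring_scope.

HB.mixin Record Zmodule_isLieRing L of GRing.Zmodule L := {
  lie : L -> L -> L;
  lieDl : forall x y z, lie (x + y) z = lie x z + lie y z;
  lieDr : forall x y z, lie x (y + z) = lie x y + lie x z;
  liexx : forall x, lie x x = 0;
  lie_jacobi : forall x y z,
    lie x (lie y z) + lie y (lie z x) + lie z (lie x y) = 0 }.

#[short(type="lieRingType")]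
HB.structure Definition LieRing := {L of Zmodule_isLieRing L & GRing.Zmodule L}.

Section LieRingTheory.
Variable L : lieRingType.
Implicit Types x y z : L.

Definition is_lie_subring (A : set L) :=
  [/\ A 0, forall x y, A x -> A y -> A (x - y)
    & forall x y, A x -> A y -> A (lie x y)].

Definition lie_subring_gen (A : set L) : set L := smallest is_lie_subring A.

Lemma lie0r x : lie x 0 = 0.
Proof. by apply: (addrI (lie x 0)); rewrite -lieDr !addr0. Qed.

Lemma lie0l x : lie 0 x = 0.
Proof. by apply: (addrI (lie 0 x)); rewrite -lieDl !addr0. Qed.

Lemma lieNr x y : lie x (- y) = - lie x y.
Proof. by apply: (addrI (lie x y)); rewrite -lieDr !subrr lie0r. Qed.

Lemma lieNl x y : lie (- x) y = - lie x y.
Proof. by apply: (addrI (lie x y)); rewrite -lieDl !subrr lie0l. Qed.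

End LieRingTheory.

Section Derivations.
Variable L : lieRingType.

Record derivation := Derivation {
  der_fun :> L -> L;
  derD : {morph der_fun : x y / x + y};
  der_lie : forall x y, der_fun (lie x y) = lie (der_fun x) y + lie x (der_fun y) }.

HB.instance Definition _ := gen_eqMixin derivation.
HB.instance Definition _ := gen_choiceMixin derivation.

Implicit Types d e : derivation.

Lemma der_ext d e : d =1 e -> d = e.
Proof.
case: d e => [f fD fL] [g gD gL] /= /funext fg; subst g.
by rewrite (Prop_irrelevance fD gD) (Prop_irrelevance fL gL).
Qed.

Lemma der0 d : d 0 = 0.
Proof. by apply: (addrI (d 0)); rewrite -derD !addr0. Qed.

Lemma derN d x : d (- x) = - d x.
Proof. by apply: (addrI (d x)); rewrite -derD !subrr der0. Qed.

Lemma der_zero_lie (x y : L) : 0 = lie 0 y + lie x 0.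
Proof. by rewrite lie0l lie0r addr0. Qed.

Definition der_zero : derivation :=
  @Derivation (fun=> 0) (fun _ _ => esym (addr0 0)) der_zero_lie.

Lemma der_oppD d : {morph (fun x => - d x) : x y / x + y}.
Proof. by move=> x y; rewrite derD opprD. Qed.

Lemma der_opp_lie d x y : - d (lie x y) = lie (- d x) y + lie x (- d y).
Proof. by rewrite der_lie opprD lieNl lieNr. Qed.

Definition der_opp d : derivation := Derivation (der_oppD d) (der_opp_lie d).

Lemma der_addD d e : {morph (fun x => d x + e x) : x y / x + y}.
Proof. by move=> x y; rewrite !derD addrACA. Qed.

Lemma der_add_lie d e x y :
  d (lie x y) + e (lie x y) = lie (d x + e x) y + lie x (d y + e y).
Proof. by rewrite !der_lie lieDl lieDr addrACA. Qed.

Definition der_add d e : derivation :=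
  Derivation (der_addD d e) (der_add_lie d e).

Lemma der_commD d e : {morph (fun x => d (e x) - e (d x)) : x y / x + y}.
Proof. by move=> x y; rewrite !derD opprD addrACA. Qed.

Lemma der_comm_lie d e x y : d (e (lie x y)) - e (d (lie x y)) =
  lie (d (e x) - e (d x)) y + lie x (d (e y) - e (d y)).
Proof.
have regroup (p a b q r t : L) :
    p + a + (b + q) - (r + b + (a + t)) = p - r + (q - t).
  rewrite [b + q]addrC [p + a + _]addrACA [a + t]addrC [r + b + _]addrACA.
  by rewrite [b + a]addrC [r + t + _]addrC addrKA opprD addrACA.
by rewrite !(der_lie, derD) lieDl lieDr lieNl lieNr regroup.
Qed.

Definition der_comm d e : derivation :=
  Derivation (der_commD d e) (der_comm_lie d e).

Lemma der_addA : associative der_add.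
Proof. by move=> d e f; apply: der_ext => x; apply: addrA. Qed.

Lemma der_addC : commutative der_add.
Proof. by move=> d e; apply: der_ext => x; apply: addrC. Qed.

Lemma der_add0 : left_id der_zero der_add.
Proof. by move=> d; apply: der_ext => x; apply: add0r. Qed.

Lemma der_addN : left_inverse der_zero der_opp der_add.
Proof. by move=> d; apply: der_ext => x; apply: addNr. Qed.

HB.instance Definition _ :=
  GRing.isZmodule.Build derivation der_addA der_addC der_add0 der_addN.

Lemma der_commDl d e f : der_comm (d + e) f = der_comm d f + der_comm e f.
Proof. by apply: der_ext => x /=; rewrite derD opprD addrACA. Qed.

Lemma der_commDr d e f : der_comm d (e + f) = der_comm d e + der_comm d f.
Proof. by apply: der_ext => x /=; rewrite derD opprD addrACA. Qed.

Lemma der_commxx d : der_comm d d = 0.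
Proof. by apply: der_ext => x /=; rewrite subrr. Qed.

Lemma der_jacobi d e f :
  der_comm d (der_comm e f) + der_comm e (der_comm f d)
    + der_comm f (der_comm d e) = 0.
Proof.
have swap (a b c g : L) : a - b - (c - g) = (a + g) - (b + c).
  by rewrite opprB addrACA opprD.
have cycle (a b c g h k : L) :
    (a - b - (c - g)) + (c - h - (k - b)) + (k - g - (a - h)) = 0.
  rewrite !swap [c + b]addrC [k + h]addrC [g + a]addrC.
  by rewrite subrKA subrKA subrr.
apply: der_ext => x; rewrite -[LHS]/(der_comm d (der_comm e f) x +
  der_comm e (der_comm f d) x + der_comm f (der_comm d e) x) /=.
by rewrite !derD !derN cycle.
Qed.

HB.instance Definition _ := Zmodule_isLieRing.Build derivation
  der_commDl der_commDr der_commxx der_jacobi.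

End Derivations.

(* The free Lie ring on an abelian group V: formal Lie expressions in elements
   of V modulo the congruence generated by the axioms of Lie rings and the
   additivity of the generators. *)
Section FreeLieRing.
Variable V : zmodType.

Inductive lie_term :=
| LGen of V
| LZero
| LOpp of lie_term
| LAdd of lie_term & lie_term
| LBracket of lie_term & lie_term.

HB.instance Definition _ := gen_eqMixin lie_term.
HB.instance Definition _ := gen_choiceMixin lie_term.

Inductive lie_cong : lie_term -> lie_term -> Prop :=
| LC_refl s : lie_cong s s
| LC_sym s t : lie_cong s t -> lie_cong t s
| LC_trans s t u : lie_cong s t -> lie_cong t u -> lie_cong s u
| LC_opp s s' : lie_cong s s' -> lie_cong (LOpp s) (LOpp s')
| LC_add s s' t t' :
    lie_cong s s' -> lie_cong t t' -> lie_cong (LAdd s t) (LAdd s' t')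
| LC_bracket s s' t t' :
    lie_cong s s' -> lie_cong t t' -> lie_cong (LBracket s t) (LBracket s' t')
| LC_gen v w : lie_cong (LGen (v + w)) (LAdd (LGen v) (LGen w))
| LC_addA s t u : lie_cong (LAdd s (LAdd t u)) (LAdd (LAdd s t) u)
| LC_addC s t : lie_cong (LAdd s t) (LAdd t s)
| LC_add0 s : lie_cong (LAdd LZero s) s
| LC_addN s : lie_cong (LAdd (LOpp s) s) LZero
| LC_lieDl s t u :
    lie_cong (LBracket (LAdd s t) u) (LAdd (LBracket s u) (LBracket t u))
| LC_lieDr s t u :
    lie_cong (LBracket s (LAdd t u)) (LAdd (LBracket s t) (LBracket s u))
| LC_liexx s : lie_cong (LBracket s s) LZero
| LC_jacobi s t u : lie_cong
    (LAdd (LAdd (LBracket s (LBracket t u)) (LBracket t (LBracket u s)))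
          (LBracket u (LBracket s t))) LZero.

Definition lie_rel (s t : lie_term) : bool := `[< lie_cong s t >].

Lemma lie_rel_refl : reflexive lie_rel.
Proof. by move=> s; apply/asboolP/LC_refl. Qed.

Lemma lie_rel_sym : symmetric lie_rel.
Proof. by move=> s t; apply/asboolP/asboolP; apply: LC_sym. Qed.

Lemma lie_rel_trans : transitive lie_rel.
Proof.
by move=> t s u /asboolP st /asboolP tu; apply/asboolP; apply: LC_trans st tu.
Qed.

Canonical lie_equiv := EquivRel lie_rel lie_rel_refl lie_rel_sym lie_rel_trans.

Definition freeLie := {eq_quot lie_equiv}%qT.

HB.instance Definition _ := Choice.on freeLie.

Definition lie_class (s : lie_term) : freeLie := (\pi_freeLie s)%qT.

Lemma lie_classP s t : lie_class s = lie_class t <-> lie_cong s t.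
Proof.
split=> [/eqP|st]; first by rewrite /lie_class piE => /asboolP.
by apply/eqP; rewrite /lie_class piE; apply/asboolP.
Qed.

Lemma lie_class_surj (a : freeLie) : exists s, a = lie_class s.
Proof. by exists (repr a); rewrite /lie_class reprK. Qed.

Lemma repr_lie_class s : lie_cong (repr (lie_class s)) s.
Proof. by apply/lie_classP; rewrite {1}/lie_class reprK. Qed.

Definition freeLie_opp (a : freeLie) := lie_class (LOpp (repr a)).
Definition freeLie_add (a b : freeLie) := lie_class (LAdd (repr a) (repr b)).
Definition freeLie_lie (a b : freeLie) :=
  lie_class (LBracket (repr a) (repr b)).

Lemma freeLie_oppE s : freeLie_opp (lie_class s) = lie_class (LOpp s).
Proof. exact/lie_classP/LC_opp/repr_lie_class. Qed.

Lemma freeLie_addE s t :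
  freeLie_add (lie_class s) (lie_class t) = lie_class (LAdd s t).
Proof. by apply/lie_classP/LC_add; apply: repr_lie_class. Qed.

Lemma freeLie_lieE s t :
  freeLie_lie (lie_class s) (lie_class t) = lie_class (LBracket s t).
Proof. by apply/lie_classP/LC_bracket; apply: repr_lie_class. Qed.

Lemma freeLie_addA : associative freeLie_add.
Proof.
move=> a b c; have [s ->] := lie_class_surj a; have [t ->] := lie_class_surj b.
by have [u ->] := lie_class_surj c; rewrite !freeLie_addE; apply/lie_classP/LC_addA.
Qed.

Lemma freeLie_addC : commutative freeLie_add.
Proof.
move=> a b; have [s ->] := lie_class_surj a; have [t ->] := lie_class_surj b.
by rewrite !freeLie_addE; apply/lie_classP/LC_addC.
Qed.

Lemma freeLie_add0 : left_id (lie_class LZero) freeLie_add.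
Proof.
by move=> a; have [s ->] := lie_class_surj a; rewrite freeLie_addE;
  apply/lie_classP/LC_add0.
Qed.

Lemma freeLie_addN : left_inverse (lie_class LZero) freeLie_opp freeLie_add.
Proof.
by move=> a; have [s ->] := lie_class_surj a; rewrite freeLie_oppE freeLie_addE;
  apply/lie_classP/LC_addN.
Qed.

HB.instance Definition _ := GRing.isZmodule.Build freeLie
  freeLie_addA freeLie_addC freeLie_add0 freeLie_addN.

Lemma lie_classD s t : lie_class (LAdd s t) = lie_class s + lie_class t.
Proof. by rewrite -freeLie_addE. Qed.

Lemma freeLie_lieDl a b c :
  freeLie_lie (a + b) c = freeLie_lie a c + freeLie_lie b c.
Proof.
have [s ->] := lie_class_surj a; have [t ->] := lie_class_surj b.
have [u ->] := lie_class_surj c; rewrite -lie_classD !freeLie_lieE -lie_classD.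
exact/lie_classP/LC_lieDl.
Qed.

Lemma freeLie_lieDr a b c :
  freeLie_lie a (b + c) = freeLie_lie a b + freeLie_lie a c.
Proof.
have [s ->] := lie_class_surj a; have [t ->] := lie_class_surj b.
have [u ->] := lie_class_surj c; rewrite -lie_classD !freeLie_lieE -lie_classD.
exact/lie_classP/LC_lieDr.
Qed.

Lemma freeLie_liexx a : freeLie_lie a a = 0.
Proof.
have [s ->] := lie_class_surj a; rewrite freeLie_lieE.
exact/lie_classP/LC_liexx.
Qed.

Lemma freeLie_jacobi a b c :
  freeLie_lie a (freeLie_lie b c) + freeLie_lie b (freeLie_lie c a)
    + freeLie_lie c (freeLie_lie a b) = 0.
Proof.
have [s ->] := lie_class_surj a; have [t ->] := lie_class_surj b.
have [u ->] := lie_class_surj c; rewrite !freeLie_lieE -!lie_classD.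
exact/lie_classP/LC_jacobi.
Qed.

HB.instance Definition _ := Zmodule_isLieRing.Build freeLie
  freeLie_lieDl freeLie_lieDr freeLie_liexx freeLie_jacobi.

Definition lie_gen (v : V) : freeLie := lie_class (LGen v).

Lemma lie_genD v w : lie_gen (v + w) = lie_gen v + lie_gen w.
Proof. by rewrite -lie_classD; apply/lie_classP/LC_gen. Qed.

(* lie_deg j is the homogeneous component of degree j, which is 0 for j = 0. *)
Inductive lie_deg : nat -> freeLie -> Prop :=
| lie_deg_gen v : lie_deg 1 (lie_gen v)
| lie_deg0 j : lie_deg j 0
| lie_degB j a b : lie_deg j a -> lie_deg j b -> lie_deg j (a - b)
| lie_deg_lie i j a b :
    lie_deg i a -> lie_deg j b -> lie_deg (i + j) (lie a b).

Definition der_deg (k : nat) : set (derivation freeLie) :=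
  [set d | forall j a, lie_deg j a -> lie_deg (j + k) (d a)].

(* The degree k part of the Lie subring of Der(freeLie) generated by the
   derivations of degree 1. *)
Definition der_gen1 (k : nat) : set (derivation freeLie) :=
  lie_subring_gen (der_deg 1) `&` der_deg k.

End FreeLieRing.

Section Johnson.
Variable n : nat.

Local Notation F := (freeGroup n).
Local Notation AutF := (autom F).
Local Notation LV := (freeLie (abelianization F)).

Definition IA : set AutF := [set s | forall x : F, ab (s x) = ab x].

Definition andreadakis (j : nat) : set AutF :=
  [set s | forall x : F, left_coset (s x) (lcs setT j.+1) =
                         left_coset x (lcs setT j.+1)].

(* The graph of the canonical identification of the degree j part of LV with
   Gamma_j(F) / Gamma_(j+1)(F): gr_class j a x means that a has degree j, that
   x is in Gamma_j(F) and that a corresponds to the class of x. *)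
Inductive gr_class : nat -> LV -> F -> Prop :=
| gr_class_gen x : gr_class 1 (lie_gen (ab x)) x
| gr_class0 j x : lcs setT j.+1 x -> gr_class j 0 x
| gr_classB j a b x y :
    gr_class j a x -> gr_class j b y -> gr_class j (a - b) (x * y^-1)%g
| gr_class_lie i j a b x y : gr_class i a x -> gr_class j b y ->
    gr_class (i + j) (lie a b) (comm x y).

(* d is the degree k derivation of LV induced by x |-> s x * x^-1, that is by
   the maps from Gamma_j / Gamma_(j+1) to Gamma_(j+k) / Gamma_(j+k+1). *)
Definition johnson_der (k : nat) (s : AutF) (d : derivation LV) : Prop :=
  der_deg k d /\
  forall j a x, gr_class j a x -> gr_class (j + k) (d a) (s x * x^-1)%g.

End Johnson.

Arguments lie_deg {V} j%_N a.
Arguments der_deg {V} k%_N d.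
Arguments der_gen1 V k%_N d : clear implicits.
Arguments IA n s : clear implicits.
Arguments andreadakis n j%_N s : clear implicits.
Arguments johnson_der {n} k%_N s d.

(* Main.v *)
Require Import Defs.
From HB Require Import structures.
From mathcomp Require Import all_boot all_order all_algebra.
From mathcomp Require Import boolp classical_sets functions.
From mathcomp Require Import zify ring.

(* Write mu for the Magnus embedding of F_n in the ring of integral power series in
   noncommuting variables. Hall trees span both the free Lie ring and the graded
   quotients of F_n, and the smallest monomial of a Hall tree is its Lyndon word; so
   these two graded groups are identified, by leading terms of mu, and the Johnson
   morphism is well defined and injective.

   The upper bound on its image comes from the Morita-Satoh trace. Let J be the Fox
   Jacobian of s. For every derivation D, tr(J^-1 D(J)) modulo commutators is a
   combination of the x_i^-1 D(x_i): J satisfies a chain rule, so this may be checked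
   on Nielsen generators, whose Jacobians are elementary, diagonal or permutation
   matrices. If s lies in A_k with k > 1 then J = 1 + M + (terms of degree > k) with
   M of degree k, and for the Euler derivation D the degree 1 part of this identity
   shows that the combination vanishes, while its degree k part says that k tr(M)
   vanishes in the group of cyclic words; this group is torsion-free, so the trace
   tr(M) of the image of s vanishes.

   Conversely, if k + 2 <= n, a word u of length k misses two letters i and m, which
   leaves room to see, modulo the subring generated in degree 1, that every derivation
   of degree k is a combination of derivations X_i |-> ad(u) X_i with i not in u, which
   only depend on the cyclic word u. The trace of such a derivation is u, so the
   derivations of trace zero are generated in degree 1. Those are realized by
   Gamma_k(IA_n), because IA_n realizes all derivations of degree 1. *)

Set Implicit Arguments.
Unset Strict Implicit.
Unset Printing Implicit Defensive.

Import GRing.Theory.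

Local Open Scope classical_set_scope.
Local Open Scope group_scope.

(** * Linear identities in abelian groups *)

(** Commutator calculus in F_n holds only modulo deeper terms of the series. Rather than a Lie ring
    on the graded quotients with a map to it, the relations [gr_class] and [hall_span] carry a Lie
    element and a group element through the same combination of brackets; leading terms then
    separate both at once.

    That the subring generated in degree 1 has trace zero is not computed with brackets of
    derivations. Its elements are Johnson images of elements of Gamma_k(IA_n), so the trace theorem
    for automorphisms covers both this subring and the whole image of A_k. The price is that the
    trace theorem must hold for every automorphism in A_k, for which no generators are at hand:
    hence a statement about all of Aut(F_n), and Nielsen's generation theorem.

    The chain rule for Jacobians twists the representation of F_n by the automorphism. The trace
    identity is therefore stated for all representations at once, and derivations are replaced by
    morphisms to dual numbers so that they fit this form. Degree 1 is separate: every derivation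
    there is a generator, and the trace argument needs 1 < k to tell degree 1 from degree k. *)

Section ZmodReflection.
Variable M : zmodType.
Local Open Scope ring_scope.

Inductive zexpr := ZVar of nat | ZZero | ZOpp of zexpr | ZAdd of zexpr & zexpr.

Fixpoint zeval (env : seq M) e : M :=
  match e with
  | ZVar i => env`_i
  | ZZero => 0
  | ZOpp e => - zeval env e
  | ZAdd e f => zeval env e + zeval env f
  end.

Fixpoint zcoef (i : nat) e : int :=
  match e with
  | ZVar j => (i == j)%:Z
  | ZZero => 0
  | ZOpp e => - zcoef i e
  | ZAdd e f => zcoef i e + zcoef i f
  end.

Lemma zeval_sum env e : zeval env e = \sum_(i < size env) env`_i *~ zcoef i e.
Proof.
elim: e => /= [j||e ->|e -> f ->].
- have [js|js] := ltnP j (size env).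
    rewrite (bigD1 (Ordinal js)) //= eqxx big1 ?addr0 // => i.
    by rewrite -val_eqE /= => /negbTE ->.
  rewrite nth_default // big1 // => i _; have [ij|//] := eqVneq (i : nat) j.
  by have := ltn_ord i; rewrite ij ltnNge js.
- by rewrite big1.
- by rewrite -sumrN; apply: eq_bigr => i _; rewrite mulrNz.
- by rewrite -big_split; apply: eq_bigr => i _; rewrite mulrzDr.
Qed.

Lemma zeval_eq env e f :
  all (fun i => zcoef i e == zcoef i f) (iota 0 (size env)) ->
  zeval env e = zeval env f.
Proof.
move=> /allP ef; rewrite !zeval_sum; apply: eq_bigr => i _.
by rewrite (eqP (ef _ _)) // mem_iota ltn_ord.
Qed.

End ZmodReflection.

(* Atoms are compared up to conversion, since the same operation may be reached
   through different paths of the algebraic hierarchy. *)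
Ltac zmod_same x y :=
  match constr:(Set) with _ => let _ := match constr:(Set)
    with _ => constr_eq x y | _ => unify x y end in constr:(tt) end.
Ltac zmod_index x l :=
  match l with
  | ?y :: _ => let _ := zmod_same x y in constr:(0%N)
  | _ :: ?l' => let k := zmod_index x l' in constr:(k.+1)
  end.
Ltac zmod_atoms e l :=
  lazymatch e with
  | GRing.add ?a ?b => let l' := zmod_atoms a l in zmod_atoms b l'
  | GRing.opp ?a => zmod_atoms a l
  | GRing.zero => l
  | _ => match constr:(Set) with
         | _ => let _ := zmod_index e l in l
         | _ => constr:(e :: l) end
  end.
Ltac zmod_reify e l :=
  lazymatch e with
  | GRing.add ?a ?b =>
    let s := zmod_reify a l in let t := zmod_reify b l in constr:(ZAdd s t)
  | GRing.opp ?a => let s := zmod_reify a l in constr:(ZOpp s)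
  | GRing.zero => constr:(ZZero)
  | _ => let k := zmod_index e l in constr:(ZVar k)
  end.
Ltac zmod :=
  lazymatch goal with
  | |- @eq ?T ?a ?b =>
    let l0 := constr:(@nil T) in
    let l1 := zmod_atoms a l0 in
    let l := zmod_atoms b l1 in
    let s := zmod_reify a l in
    let t := zmod_reify b l in
    exact: (@zeval_eq _ l s t isT)
  end.

(** Levi's lemma; it splits the later arguments on suffixes of a concatenation. *)
Lemma cat_eq_cases (T : Type) (u v p s : seq T) : u ++ v = p ++ s ->
  (exists2 s', u = p ++ s' & s = s' ++ v) \/ (exists2 p', p = u ++ p' & v = p' ++ s).
Proof.
elim: u p => [|a u IHu] [|b p] /=.
- by right; exists [::].
- by move=> E; right; exists (b :: p).
- by move=> <-; left; exists (a :: u).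
- by move=> [-> /IHu[[s' -> ->]|[p' -> ->]]]; [left; exists s' | right; exists p'].
Qed.

Ltac grp := rewrite /comm !(invgM, invgK, mulgA, mulgK, mulgVK, mulgV, mulVg,
  mul1g, mulg1, invg1).

Section Subgroup.
Variables (G : groupType) (H : set G).
Hypothesis sH : is_subgroup H.

Lemma subgroup1 : H 1. Proof. by case: sH. Qed.

Lemma subgroupV x : H x -> H x^-1.
Proof. by move=> Hx; case: sH => H1 HB; rewrite -[x^-1]mul1g; apply: HB. Qed.

Lemma subgroupM x y : H x -> H y -> H (x * y).
Proof.
by move=> Hx Hy; case: sH => H1 HB; rewrite -[y]invgK; apply/HB/subgroupV.
Qed.

End Subgroup.

(** * The lower central series *)

Section LowerCentralSeries.
Variable G : groupType.
Implicit Types (x y z g h : G) (i j k N : nat).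

Lemma subgroup_gen_min (A B : set G) :
  is_subgroup B -> A `<=` B -> subgroup_gen A `<=` B.
Proof. by move=> sB AB x; apply. Qed.

Lemma lcsS (H : set G) k : lcs H k.+2 = comm_subgroup H (lcs H k.+1).
Proof. by []. Qed.

Lemma lcs_subgroup (H : set G) k : is_subgroup H -> is_subgroup (lcs H k).
Proof. by case: k => [|[|k]] // sH; apply: subgroup_gen_subgroup. Qed.

Local Notation "'G_ k" := (lcs [set: G] k) (at level 8, k at level 2, format "''G_' k").

Lemma lcsT_subgroup k : is_subgroup 'G_k.
Proof. exact: lcs_subgroup. Qed.
#[local] Hint Resolve lcsT_subgroup : core.

Lemma lcs1 k : 'G_k 1. Proof. exact: subgroup1. Qed.

Lemma lcsM k x y : 'G_k x -> 'G_k y -> 'G_k (x * y).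
Proof. exact: subgroupM. Qed.

Lemma lcsV k x : 'G_k x -> 'G_k x^-1.
Proof. exact: subgroupV. Qed.

Lemma lcs_sub1 k : 'G_k.+1 `<=` 'G_k.
Proof.
elim: k => [|k IHk] //; case: k IHk => [|k] IHk // x; rewrite !lcsS.
apply: subgroup_gen_min; first exact: subgroup_gen_subgroup.
by move=> _ [g _ [h Hh <-]]; apply: mem_comm => //; apply: IHk.
Qed.

Lemma lcs_anti i j : (i <= j)%N -> 'G_j `<=` 'G_i.
Proof.
move=> /subnK <-; elim: (j - i)%N => [|m IHm] // x /lcs_sub1; exact: IHm.
Qed.

Lemma lcs_comm1 k g x : 'G_k x -> 'G_k.+1 (comm g x).
Proof. by case: k => [|k] // Hx; apply: mem_comm. Qed.

Lemma lcsJ k g x : 'G_k x -> 'G_k (g * x * g^-1).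
Proof.
move=> Hx; rewrite -[_ * _](mulgVK x); apply: lcsM => //.
exact/lcs_sub1/lcs_comm1.
Qed.

Lemma lcsJV k g x : 'G_k x -> 'G_k (g^-1 * x * g).
Proof. by move=> /(lcsJ g^-1); rewrite invgK. Qed.

Lemma comm_inv x y : (comm x y)^-1 = comm y x.
Proof. by grp. Qed.

Lemma commMl x y z : comm (x * y) z = x * comm y z * x^-1 * comm x z.
Proof. by grp. Qed.

Lemma commVl x y : comm x^-1 y = x^-1 * (comm x y)^-1 * x.
Proof. by grp. Qed.

Lemma hall_witt x y z :
  comm (comm x y) (y * z * y^-1) * comm (comm y z) (z * x * z^-1)
    * comm (comm z x) (x * y * x^-1) = 1.
Proof. by grp. Qed.

Lemma commutator_centralizing j k :
  is_subgroup [set x | forall z, 'G_j z -> 'G_k (comm x z)].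
Proof.
split=> [z _ /=|x x' Hx Hx' z Hz]; first by grp; apply: lcs1.
rewrite commMl; apply: lcsM; last exact: Hx.
by rewrite commVl; apply/lcsJ/lcsJV/lcsV/Hx'.
Qed.

(** Three subgroups argument, by induction on i for all j: on a generator [comm g h] the Hall-Witt
    identity trades [comm (comm g h) z] for [comm (comm h z) g] and [comm (comm z g) h], up to
    conjugation, and there the induction hypothesis applies to h. *)
Lemma lcs_commS i j x y : 'G_i.+1 x -> 'G_j.+1 y -> 'G_(i + j).+2 (comm x y).
Proof.
elim: i j x y => [|i IHi] j x y; first by move=> _; apply: lcs_comm1.
rewrite lcsS => Hx; move: y.
suff: [set x | forall z, 'G_j.+1 z -> 'G_(i.+1 + j).+2 (comm x z)] x by [].
move: x Hx; apply: subgroup_gen_min => [|_ [g _ [h Hh <-]] z Hz].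
  exact: commutator_centralizing.
(* Hall-Witt involves the conjugate of z by h, so z is renamed to a conjugate, which stays in the
   same normal term of the series. *)
have -> : z = h * (h^-1 * z * h) * h^-1 by grp.
move: (lcsJV h Hz); move: (_ * h) => {z Hz}z Hz.
have := hall_witt g h z => /(congr1 (fun t => t * (comm (comm z g) (g * h * g^-1))^-1 *
   (comm (comm h z) (z * g * z^-1))^-1)).
rewrite mulgK mulgK mul1g => ->; apply: lcsM; apply: lcsV.
  rewrite -comm_inv addSnnS; apply: lcsV; apply: IHi; first exact: lcsJ.
  by rewrite -comm_inv; apply/lcsV/lcs_comm1.
rewrite -comm_inv; apply/lcsV/lcs_comm1; exact: IHi.
Qed.

Lemma lcs_comm i j x y : 'G_i x -> 'G_j y -> 'G_(i + j) (comm x y).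
Proof.
case: i j => [|i] [|j] // Hx Hy; rewrite ?addn0 ?add0n.
- exact/lcs_sub1/lcs_comm1.
- by rewrite -comm_inv; apply/lcsV/lcs_sub1/lcs_comm1.
- by rewrite addSn addnS; apply: lcs_commS.
Qed.

Definition lcs_eq N x y := 'G_N (x * y^-1).

Local Notation "x =[ N ]= y" := (lcs_eq N x y) (at level 70, format "x  =[ N ]=  y").

Lemma lcs_eqxx N x : x =[N]= x.
Proof. by rewrite /lcs_eq mulgV; apply: lcs1. Qed.

Lemma lcs_eq_sym N x y : x =[N]= y -> y =[N]= x.
Proof. by move/lcsV; rewrite invgM invgK. Qed.

Lemma lcs_eq_trans N y x z : x =[N]= y -> y =[N]= z -> x =[N]= z.
Proof. by move=> xy yz; have := lcsM xy yz; rewrite mulgA mulgVK. Qed.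

Lemma lcs_eqM N x x' y y' : x =[N]= x' -> y =[N]= y' -> x * y =[N]= x' * y'.
Proof.
move=> xx yy; rewrite /lcs_eq.
have -> : x * y * (x' * y')^-1 = x * (y * y'^-1) * x^-1 * (x * x'^-1) by grp.
by apply: lcsM => //; apply: lcsJ.
Qed.

Lemma lcs_eqV N x x' : x =[N]= x' -> x^-1 =[N]= x'^-1.
Proof. by move=> /lcs_eq_sym /(lcsJV x'); rewrite /lcs_eq;
  grp => /(lcsJ x') /(lcsJV x); grp. Qed.

Lemma lcs_eq_sub N M x y : (N <= M)%N -> x =[M]= y -> x =[N]= y.
Proof. by move=> NM; apply: lcs_anti. Qed.

Lemma lcs_eq1 N x : 'G_N x -> x =[N]= 1.
Proof. by rewrite /lcs_eq invg1 mulg1. Qed.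

Lemma lcs_eqC i j x y : 'G_i x -> 'G_j y -> x * y =[i + j]= y * x.
Proof. by move=> Hx Hy; rewrite /lcs_eq invgM mulgA; apply: lcs_comm. Qed.

Lemma lcs_eqJ i g x : 'G_i x -> g * x * g^-1 =[i.+1]= x.
Proof. by move=> Hx; apply: lcs_comm1. Qed.

Lemma lcs_eq_mem N x y : x =[N]= y -> 'G_N x -> 'G_N y.
Proof.
move=> xy Hx; have := lcsM (lcsV xy) Hx.
by rewrite invgM invgK mulgVK.
Qed.

Lemma lcs_eq_comml i N x x' z :
  x =[N]= x' -> 'G_i z -> comm x z =[N + i]= comm x' z.
Proof.
move=> xx Hz; rewrite -[x](mulgVK x') commMl; move: xx; rewrite /(_ =[_]= _).
move: (x * _) => u Hu; rewrite -[X in _ =[_]= X]mulg1; apply: lcs_eqM.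
  apply: lcs_comm => //; exact/lcs_sub1/lcs_comm1.
exact/lcs_eq1/lcs_comm.
Qed.

Lemma lcs_eq_commr i N x x' z :
  x =[N]= x' -> 'G_i z -> comm z x =[N + i]= comm z x'.
Proof. by move=> xx /(lcs_eq_comml xx) /lcs_eqV; rewrite !comm_inv. Qed.

Lemma lcs_eq_commMl i i' j x y z : 'G_i x -> 'G_i' y -> 'G_j z ->
  comm (x * y) z =[i + i' + j]= comm x z * comm y z.
Proof.
move=> Hx Hy Hz; rewrite commMl.
apply: (@lcs_eq_trans _ (comm y z * comm x z)).
  by apply: lcs_eqM (lcs_eqxx _ _); rewrite -addnA; apply: lcs_comm (lcs_comm _ _).
apply: lcs_eq_sub (lcs_eqC (lcs_comm Hy Hz) (lcs_comm Hx Hz)).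
by rewrite addnCA addnA leq_add2r leq_add2l leq_addr.
Qed.

Lemma lcs_eq_commVl i j x z : 'G_i x -> 'G_j z ->
  comm x^-1 z =[i + i + j]= (comm x z)^-1.
Proof.
move=> Hx Hz; have /lcs_eq_sym := lcs_eq_commMl (lcsV Hx) Hx Hz.
rewrite mulVg /comm mul1g invg1 mulg1 mulgV => h.
have := lcs_eqM h (lcs_eqxx (i + i + j) (comm x z)^-1).
by rewrite mul1g mulgK.
Qed.

Lemma lcs_eq_commBl i i' j x y z : 'G_i x -> 'G_i' y -> 'G_j z ->
  comm (x * y^-1) z =[minn i i' + i' + j]= comm x z * (comm y z)^-1.
Proof.
move=> Hx Hy Hz; apply: lcs_eq_trans.
  apply: lcs_eq_sub (lcs_eq_commMl Hx (lcsV Hy) Hz).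
  by rewrite !leq_add2r geq_minl.
apply: lcs_eqM; first exact: lcs_eqxx.
by apply: lcs_eq_sub (lcs_eq_commVl Hy Hz); rewrite !leq_add2r geq_minr.
Qed.

(** The Hall-Witt identity with its conjugations removed: inside a commutator of total weight i + j
    + k, replacing [b * c * b^-1] by c only matters one step deeper ([HJ]). *)
Lemma lcs_eq_jacobi i j k x y z :
  (0 < i)%N -> (0 < j)%N -> (0 < k)%N -> 'G_i x -> 'G_j y -> 'G_k z ->
  comm (comm x y) z =[(i + j + k).+1]= comm (comm x z) y * comm x (comm y z).
Proof.
move=> i0 j0 k0 Hx Hy Hz; set N := _.+1.
have HJ a b c m1 m2 m3 : 'G_m1 a -> 'G_m2 b -> 'G_m3 c -> (m1 + m2 + m3)%N = (i +
  j + k)%N ->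
    comm (comm a b) (b * c * b^-1) =[N]= comm (comm a b) c.
  move=> Ha Hb Hc Em; apply: (@lcs_eq_sub _ (m3.+1 + (m1 + m2))).
    by rewrite addSn addnC Em.
  by apply: lcs_eq_commr (lcs_comm Ha Hb); apply: lcs_eqJ.
have HW := lcs_eqxx N (1 : G); rewrite -{1}(hall_witt x y z) in HW.
have e1 : (j + k + i = i + j + k)%N by rewrite addnC addnA.
have e2 : (k + i + j = i + j + k)%N by rewrite -addnA addnC.
have := lcs_eq_trans (lcs_eq_sym (lcs_eqM (lcs_eqM (HJ _ _ _ _ _ _ Hx Hy Hz erefl)
  (HJ _ _ _ _ _ _ Hy Hz Hx e1))
   (HJ _ _ _ _ _ _ Hz Hx Hy e2))) HW.
rewrite -[comm (comm y z) x]comm_inv -[comm z x]comm_inv => h.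
have hC : comm (comm x z)^-1 y =[N]= (comm (comm x z) y)^-1.
  apply: lcs_eq_sub (lcs_eq_commVl (lcs_comm Hx Hz) Hy).
  by rewrite /N; lia.
have := lcs_eqM (lcs_eq_trans (lcs_eqM (lcs_eqxx N _) (lcs_eq_sym hC)) h)
  (lcs_eqxx N (comm (comm x z) y * comm x (comm y z))).
by rewrite mul1g mulgA !mulgVK.
Qed.

End LowerCentralSeries.

Local Notation "'G_ k" := (lcs setT k) (at level 8, k at level 2, format "''G_' k").
Local Notation "x =[ N ]= y" := (lcs_eq N x y) (at level 70, format "x  =[ N ]=  y").

(** * Morphisms and crossed morphisms of free groups *)

Section GroupMorphisms.
Variables (G K : groupType) (f : G -> K).
Hypothesis fM : {morph f : x y / x * y}.

Lemma gmorph1 : f 1 = 1.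
Proof. by apply: (mulgI (f 1)); rewrite -fM !mulg1. Qed.

Lemma gmorphV x : f x^-1 = (f x)^-1.
Proof. by apply: (mulgI (f x)); rewrite -fM !mulgV gmorph1. Qed.

Lemma gmorph_comm x y : f (comm x y) = comm (f x) (f y).
Proof. by rewrite /comm !fM !gmorphV. Qed.

End GroupMorphisms.

Section FreeGroupTheory.
Variable n : nat.
Local Notation F := (freeGroup n).
Implicit Types (a : letter n) (x y : F) (i j : 'I_n).

Definition free_letter a : F := @FreeGroup n [:: a] isT.
Definition free_gen i : F := free_letter (i, false).

Lemma free_letterE a :
  free_letter a = if a.2 then (free_gen a.1)^-1 else free_gen a.1.
Proof. by case: a => i [] //=; apply: val_inj. Qed.

Lemma free_letter_inv a : free_letter (letter_inv a) = (free_letter a)^-1.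
Proof. by apply: val_inj. Qed.

Lemma free_cons a w (rw : reduced (a :: w)) :
  FreeGroup rw = free_letter a * FreeGroup (reduced_behead rw).
Proof.
apply: val_inj => /=; case: w rw => //= b w /andP[/negbTE nb _].
by rewrite /letter_mul /= nb.
Qed.

Lemma free_ind (P : F -> Prop) :
  P 1 -> (forall a x, P x -> P (free_letter a * x)) -> forall x, P x.
Proof.
move=> P1 PM [w rw]; elim: w rw => [|a w IHw] rw.
  by have -> : FreeGroup rw = 1 by apply: val_inj.
by rewrite free_cons; apply: PM.
Qed.

Lemma free_gen_ind (P : F -> Prop) :
    P 1 -> (forall i, P (free_gen i)) -> (forall x y, P x -> P y -> P (x * y)) ->
  (forall x, P x -> P x^-1) -> forall x, P x.
Proof.
move=> P1 PX PM PV; elim/free_ind => // a x Px; apply: PM => //.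
by rewrite free_letterE; case: a.2; [apply: PV|].
Qed.

Section Extension.
Variables (G : groupType) (f : 'I_n -> G).

Definition letter_ext a : G := if a.2 then (f a.1)^-1 else f a.1.
Definition free_ext x : G := foldr (fun a g => letter_ext a * g) 1 (word x).

Arguments free_ext : simpl never.

Lemma letter_ext_inv a : letter_ext (letter_inv a) = (letter_ext a)^-1.
Proof. by case: a => i []; rewrite /letter_ext /= ?invgK. Qed.

Lemma free_extM : {morph free_ext : x y / x * y}.
Proof.
move=> [u ru] [v rv]; rewrite /free_ext /= => {ru rv}.
elim: u => [|a u IHu] /=; first by rewrite mul1g.
rewrite -mulgA -{}IHu; case: (word_mul u v) => //= b w.
by case: eqP => //= ->; rewrite letter_ext_inv mulVKg.
Qed.

Lemma free_ext_letter a : free_ext (free_letter a) = letter_ext a.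
Proof. exact: mulg1. Qed.

Lemma free_ext_gen i : free_ext (free_gen i) = f i.
Proof. exact: mulg1. Qed.

End Extension.

Lemma free_morph_eq (G : groupType) (f g : F -> G) :
    {morph f : x y / x * y} -> {morph g : x y / x * y} ->
  (forall i, f (free_gen i) = g (free_gen i)) -> f =1 g.
Proof.
move=> fM gM fg; elim/free_gen_ind => // [|x y fx fy|x fx].
- by rewrite (gmorph1 fM) (gmorph1 gM).
- by rewrite fM gM fx fy.
- by rewrite (gmorphV fM) (gmorphV gM) fx.
Qed.

Section Automorphisms.
Variables f g : 'I_n -> F.
Hypotheses (fgK : forall i, free_ext g (f i) = free_gen i)
           (gfK : forall i, free_ext f (g i) = free_gen i).

Lemma free_ext_bij : bijective (free_ext f).
Proof.
exists (free_ext g) => x.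
  apply: (@free_morph_eq _ (free_ext g \o free_ext f) id) => // [y z|i] /=.
    by rewrite !free_extM.
  by rewrite free_ext_gen fgK.
apply: (@free_morph_eq _ (free_ext f \o free_ext g) id) => // [y z|i] /=.
  by rewrite !free_extM.
by rewrite free_ext_gen gfK.
Qed.

Definition free_aut : autom F := Autom (free_extM f) free_ext_bij.

Lemma free_autE i : free_aut (free_gen i) = f i.
Proof. exact: free_ext_gen. Qed.

End Automorphisms.

Lemma free_aut_eq (s t : autom F) :
  (forall i, s (free_gen i) = t (free_gen i)) -> s = t.
Proof. by move=> st; apply/autom_ext/free_morph_eq => //; apply: automM. Qed.

Lemma free_aut_ex (f g : 'I_n -> F) :
  (forall i, free_ext g (f i) = free_gen i) ->
  (forall i, free_ext f (g i) = free_gen i) ->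
  exists s : autom F, forall i, s (free_gen i) = f i.
Proof.
by move=> fgK gfK; exists (free_aut fgK gfK) => i; apply: free_autE.
Qed.

End FreeGroupTheory.

(** * Units of a ring, crossed morphisms *)

Section Units.
Variable B : pzRingType.
Local Open Scope ring_scope.

Record unit_pair := UnitPair {
  uval : B; uinv : B; uvalK : uval * uinv = 1; uinvK : uinv * uval = 1 }.

HB.instance Definition _ := gen_eqMixin unit_pair.
HB.instance Definition _ := gen_choiceMixin unit_pair.

Lemma unit_pair_inj (u v : unit_pair) : uval u = uval v -> u = v.
Proof.
case: u v => [a a' aK aV] [b b' bK bV] /= ab; subst b.
have E : a' = b' by rewrite -[b']mul1r -aV -mulrA bK mulr1.
by subst b'; rewrite (Prop_irrelevance aK bK) (Prop_irrelevance aV bV).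
Qed.

Lemma unit_mulK (u v : unit_pair) : uval u * uval v * (uinv v * uinv u) = 1.
Proof. by rewrite mulrA -[_ * _ * uinv v]mulrA uvalK mulr1 uvalK. Qed.

Lemma unit_mulVK (u v : unit_pair) : uinv v * uinv u * (uval u * uval v) = 1.
Proof. by rewrite mulrA -[_ * _ * uval u]mulrA uinvK mulr1 uinvK. Qed.

Definition unit_one := UnitPair (mulr1 (1 : B)) (mulr1 (1 : B)).
Definition unit_mul u v := UnitPair (unit_mulK u v) (unit_mulVK u v).
Definition unit_inv (u : unit_pair) := UnitPair (uinvK u) (uvalK u).

Lemma unit_mulA : associative unit_mul.
Proof. by move=> u v w; apply: unit_pair_inj; rewrite /= mulrA. Qed.
Lemma unit_mul1 : left_id unit_one unit_mul.
Proof. by move=> u; apply: unit_pair_inj; rewrite /= mul1r. Qed.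
Lemma unit_1mul : right_id unit_one unit_mul.
Proof. by move=> u; apply: unit_pair_inj; rewrite /= mulr1. Qed.
Lemma unit_mulV : left_inverse unit_one unit_inv unit_mul.
Proof. by move=> u; apply: unit_pair_inj; rewrite /= uinvK. Qed.
Lemma unit_Vmul : right_inverse unit_one unit_inv unit_mul.
Proof. by move=> u; apply: unit_pair_inj; rewrite /= uvalK. Qed.

HB.instance Definition _ := isGroup.Build unit_pair
  unit_mulA unit_mul1 unit_1mul unit_mulV unit_Vmul.

Lemma uvalM (u v : unit_pair) : uval (u * v)%g = uval u * uval v.
Proof. by []. Qed.

Lemma uvalV (u : unit_pair) : uval (u^-1)%g = uinv u.
Proof. by []. Qed.

End Units.

Section UnitMorphism.
Variables (A B : pzRingType) (f : {rmorphism A -> B}).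
Local Open Scope ring_scope.

Lemma unit_mapK (u : unit_pair A) : f (uval u) * f (uinv u) = 1.
Proof. by rewrite -rmorphM uvalK rmorph1. Qed.
Lemma unit_mapVK (u : unit_pair A) : f (uinv u) * f (uval u) = 1.
Proof. by rewrite -rmorphM uinvK rmorph1. Qed.

Definition unit_map u := UnitPair (unit_mapK u) (unit_mapVK u).

Lemma unit_mapM : {morph unit_map : u v / (u * v)%g}.
Proof. by move=> u v; apply: unit_pair_inj; rewrite /= rmorphM. Qed.

End UnitMorphism.

Section CrossedMorphisms.
Variables (n : nat) (B : pzRingType).
Local Notation F := (freeGroup n).
Local Open Scope ring_scope.

(** The 1-cocycle condition for F acting on B through r by left multiplication; Fox derivatives and
    [mu x - 1] are the instances used. *)
Definition crossed (r : F -> unit_pair B) (c : F -> B) :=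
  forall x y, c (x * y)%g = c x + uval (r x) * c y.

Section Def.
Variables (r : F -> unit_pair B) (c0 : 'I_n -> B).
Hypothesis rM : {morph r : x y / (x * y)%g}.

(** The value on an inverse letter is forced by the cocycle condition on [x^-1 * x]; it makes the
    extension compatible with cancellation of letters. *)
Definition cross_letter (a : letter n) : B :=
  if a.2 then - (uinv (r (free_gen a.1)) * c0 a.1) else c0 a.1.
Definition cross_ext (x : F) : B :=
  foldr (fun a z => cross_letter a + uval (r (free_letter a)) * z) 0 (word x).

Lemma cross_letter_inv a :
  cross_letter a + uval (r (free_letter a)) * cross_letter (letter_inv a) = 0.
Proof.
rewrite /cross_letter free_letterE; case: a => i [] /=.
  by rewrite (gmorphV rM) addNr.
by rewrite mulrN mulrA uvalK mul1r subrr.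
Qed.

Lemma cross_extM : crossed r cross_ext.
Proof.
move=> [u ru] [v rv]; rewrite /cross_ext /= => {rv}.
elim: u ru => [|a u IHu] ru /=.
  have -> : FreeGroup ru = 1%g by apply: val_inj.
  by rewrite (gmorph1 rM) add0r mul1r.
rewrite free_cons rM uvalM -mulrA -addrA -mulrDr -IHu.
case: (word_mul u v) => //= b w; case: eqP => //= ->.
rewrite mulrDr addrA cross_letter_inv add0r mulrA -uvalM -rM.
by rewrite free_letter_inv mulgV (gmorph1 rM) mul1r.
Qed.

Lemma cross_ext_gen i : cross_ext (free_gen i) = c0 i.
Proof. by rewrite /cross_ext /= mulr0 addr0. Qed.

End Def.

Section Theory.
Variables (r : F -> unit_pair B) (c : F -> B).
Hypotheses (rM : {morph r : x y / (x * y)%g}) (cM : crossed r c).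

Lemma crossed1 : c 1%g = 0.
Proof.
have := cM 1%g 1%g; rewrite mulg1 (gmorph1 rM) mul1r => E.
by apply: (addrI (c 1%g)); rewrite -E addr0.
Qed.

Lemma crossedV x : c x^-1%g = - (uinv (r x) * c x).
Proof.
have := cM x^-1%g x; rewrite mulVg crossed1 (gmorphV rM) uvalV => /esym/eqP.
by rewrite addr_eq0 => /eqP.
Qed.

End Theory.

Lemma crossed_eq (r : F -> unit_pair B) (c d : F -> B) : {morph r : x y / (x * y)%g} ->
    crossed r c -> crossed r d ->
  (forall i, c (free_gen i) = d (free_gen i)) -> c =1 d.
Proof.
move=> rM cM dM cd; elim/free_gen_ind => // [|x y cx cy|x cx].
- by rewrite (crossed1 rM cM) (crossed1 rM dM).
- by rewrite cM dM cx cy.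
- by rewrite (crossedV rM cM) (crossedV rM dM) cx.
Qed.

End CrossedMorphisms.

(** * Noncommutative power series *)

Section Series.
Variable n : nat.
Local Open Scope ring_scope.
Local Notation word := (seq 'I_n).
Implicit Types (u v w : word) (a b i j : 'I_n).

Record series := Series { coef :> word -> int }.

HB.instance Definition _ := gen_eqMixin series.
HB.instance Definition _ := gen_choiceMixin series.

Implicit Types f g h : series.

Lemma seriesP f g : f =1 g -> f = g.
Proof. by case: f g => f [g] /= /funext ->. Qed.

Definition ser_zero := Series (fun=> 0).
Definition ser_one := Series (fun w => (w == [::])%:Z).
Definition ser_opp f := Series (fun w => - f w).
Definition ser_add f g := Series (fun w => f w + g w).

(** Recursion on the first letter instead of a sum over cuts: removing the first letter of a product
    is linear in the left factor ([conv_lin]), so associativity becomes a short induction. *)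
Fixpoint conv (f g : word -> int) w : int :=
  f [::] * g w + (if w is a :: w' then conv (fun v => f (a :: v)) g w' else 0).

Definition ser_mul f g := Series (conv f g).

Lemma ser_addA : associative ser_add.
Proof. by move=> f g h; apply: seriesP => w /=; rewrite addrA. Qed.
Lemma ser_addC : commutative ser_add.
Proof. by move=> f g; apply: seriesP => w /=; rewrite addrC. Qed.
Lemma ser_add0 : left_id ser_zero ser_add.
Proof. by move=> f; apply: seriesP => w /=; rewrite add0r. Qed.
Lemma ser_addN : left_inverse ser_zero ser_opp ser_add.
Proof. by move=> f; apply: seriesP => w /=; rewrite addNr. Qed.

HB.instance Definition _ := GRing.isZmodule.Build series
  ser_addA ser_addC ser_add0 ser_addN.

Lemma coefD f g w : (f + g) w = f w + g w. Proof. by []. Qed.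
Lemma coefN f w : (- f) w = - f w. Proof. by []. Qed.
Lemma coefB f g w : (f - g) w = f w - g w. Proof. by []. Qed.

Lemma conv_sum (f g : word -> int) w :
  conv f g w = \sum_(i < (size w).+1) f (take i w) * g (drop i w).
Proof.
elim: w f => [|a w IHw] f; first by rewrite big_ord_recl big_ord0.
by rewrite big_ord_recl /= IHw.
Qed.

Lemma conv_lin (c : int) (p q g : word -> int) w :
  conv (fun v => c * p v + q v) g w = c * conv p g w + conv q g w.
Proof.
rewrite !conv_sum mulr_sumr -big_split; apply: eq_bigr => i _ /=.
by rewrite mulrDl mulrA.
Qed.

Lemma ser_mulA : associative ser_mul.
Proof.
move=> [f] [g] [h]; apply: seriesP => w /=; elim: w f g => [|a w IHw] f g /=.
  by rewrite !addr0 mulrA.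
by rewrite addr0 conv_lin IHw mulrDr !mulrA addrA.
Qed.

Lemma ser_mul1 : left_id ser_one ser_mul.
Proof.
move=> f; apply: seriesP => w; rewrite /= conv_sum big_ord_recl big1 => [|i _].
  by rewrite take0 drop0 mul1r addr0.
by rewrite /= /bump /=; case: w i => [[[]]|a w] //= i; rewrite mul0r.
Qed.

Lemma ser_1mul : right_id ser_one ser_mul.
Proof.
move=> f; apply: seriesP => w; rewrite /= conv_sum big_ord_recr big1 => [|i _] /=.
  by rewrite take_size drop_size mulr1 add0r.
by rewrite -size_eq0 size_drop subn_eq0 leqNgt ltn_ord mulr0.
Qed.

Lemma ser_mulDl : left_distributive ser_mul ser_add.
Proof.
move=> f g h; apply: seriesP => w; rewrite /= !conv_sum -big_split.
by apply: eq_bigr => i _; rewrite mulrDl.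
Qed.

Lemma ser_mulDr : right_distributive ser_mul ser_add.
Proof.
move=> f g h; apply: seriesP => w; rewrite /= !conv_sum -big_split.
by apply: eq_bigr => i _; rewrite mulrDr.
Qed.

Lemma ser_one_neq0 : ser_one != 0.
Proof. by apply/eqP => /(congr1 (fun f : series => f [::])). Qed.

HB.instance Definition _ := GRing.Zmodule_isNzRing.Build series
  ser_mulA ser_mul1 ser_1mul ser_mulDl ser_mulDr ser_one_neq0.

Lemma coef1 w : (1 : series) w = (w == [::])%:Z. Proof. by []. Qed.

Lemma coefM f g w :
  (f * g) w = \sum_(i < (size w).+1) f (take i w) * g (drop i w).
Proof. exact: conv_sum. Qed.

Lemma coefM_nil f g : (f * g) [::] = f [::] * g [::].
Proof. exact: addr0. Qed.

Lemma coef_sum (I : Type) (s : seq I) (P : pred I) (E : I -> series) w :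
  (\sum_(i <- s | P i) E i) w = \sum_(i <- s | P i) E i w.
Proof. by apply: (big_morph (fun f : series => f w)). Qed.

Lemma coef_mulrz f (c : int) w : (f *~ c) w = f w *~ c.
Proof.
have nat_case (m : nat) : (f *+ m) w = f w *+ m.
  by elim: m => // m IHm; rewrite !mulrS coefD IHm.
by case: c => m; rewrite /intmul ?coefN nat_case.
Qed.

Definition ser_var i := Series (fun w => (w == [:: i])%:Z).

Lemma coef_varM i f w :
  (ser_var i * f) w = if w is a :: w' then (a == i)%:Z * f w' else 0.
Proof.
rewrite coefM; case: w => [|a w]; first by rewrite big_ord1 mul0r.
rewrite big_ord_recl mul0r add0r big_ord_recl big1 => [|j _] /=.
  by rewrite take0 drop0 addr0 eqseq_cons andbT.
by rewrite /bump /= add1n; case: w j => [[[]]|b w] //= j;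
  rewrite eqseq_cons andbF mul0r.
Qed.

Lemma coefM_var i f w a : (f * ser_var i) (rcons w a) = f w * (a == i)%:Z.
Proof.
rewrite -cats1 coefM size_cat addn1 big_ord_recr big_ord_recr big1 /= => [|j _].
  rewrite take_size_cat // drop_size_cat // eqseq_cons andbT.
  by rewrite [drop _ _]drop_oversize ?size_cat ?addn1 // mulr0 addr0 add0r.
rewrite [_ == _](_ : _ = false) ?mulr0 //; apply/eqP => /(congr1 size).
by rewrite size_drop size_cat /=; have := ltn_ord j; lia.
Qed.

Lemma coefM_var_nil i f : (f * ser_var i) [::] = 0.
Proof. by rewrite coefM_nil mulr0. Qed.

Definition ser_ord k f := forall w, (size w < k)%N -> f w = 0.

Lemma ser_ordD k f g : ser_ord k f -> ser_ord k g -> ser_ord k (f + g).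
Proof. by move=> Of Og w wk; rewrite coefD Of ?Og. Qed.

Lemma ser_ordB k f g : ser_ord k f -> ser_ord k g -> ser_ord k (f - g).
Proof. by move=> Of Og w wk; rewrite coefB Of ?Og. Qed.

Lemma ser_ordM k m f g : ser_ord k f -> ser_ord m g -> ser_ord (k + m) (f * g).
Proof.
move=> Of Og w wk; rewrite coefM big1 // => i _.
have [ik|ik] := ltnP i k.
  rewrite Of ?mul0r // size_take_min; lia.
rewrite Og ?mulr0 // size_drop; have := ltn_ord i; lia.
Qed.

Lemma coefM_lead k m f g w : ser_ord k f -> ser_ord m g -> size w = (k + m)%N ->
  (f * g) w = f (take k w) * g (drop k w).
Proof.
move=> Of Og wk; have kw : (k < (size w).+1)%N by lia.
rewrite coefM (bigD1 (Ordinal kw)) //= big1 ?addr0 // => i.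
rewrite -val_eqE /= neq_ltn => /orP[] ik.
  rewrite Of ?mul0r // size_take_min; lia.
rewrite Og ?mulr0 // size_drop; have := ltn_ord i; lia.
Qed.

Definition euler f := Series (fun w => (size w)%:Z * f w).

Lemma eulerM f g : euler (f * g) = f * euler g + euler f * g.
Proof.
apply: seriesP => w; rewrite -[LHS]/((size w)%:Z * (f * g) w).
rewrite coefD !coefM mulr_sumr -big_split; apply: eq_bigr => i _ /=.
rewrite -[X in (size X)%:Z * _](cat_take_drop i w) size_cat PoszD.
by ring.
Qed.

Lemma euler1 : euler 1 = 0.
Proof. by apply: seriesP => -[|a w]; rewrite /= ?mul0r ?mulr0. Qed.

(* A trace, since it only depends on the image of f in cyclic words. *)
Definition ser_trace u f : int := \sum_(r < size u) f (rot r u).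

(** A rotation of u cut into p and q becomes, after a further rotation, one cut into q and p; so
    both double sums over rotations and cuts have the same terms. *)
Lemma ser_traceM u f g : ser_trace u (f * g) = ser_trace u (g * f).
Proof.
rewrite /ser_trace; case: u => [|c u0]; first by rewrite !big_ord0.
set u := c :: u0; have sz r : size (rot r u) = (size u0).+1 by rewrite size_rot.
transitivity (\sum_(r < size u) \sum_(i < (size u).+1)
    f (take i (rot r u)) * g (drop i (rot r u))).
  by apply: eq_bigr => r _; rewrite coefM sz.
transitivity (\sum_(r < size u) \sum_(i < (size u).+1)
    g (take i (rot r u)) * f (drop i (rot r u))); last first.
  by apply: eq_bigr => r _; rewrite coefM sz.
(* On the left the cut i becomes [size u - i]; on the right the rotation is then shifted by this
   amount modulo [size u]. *)
rewrite exchange_big [RHS]exchange_big (reindex_inj rev_ord_inj) /=.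
apply: eq_bigr => i _.
rewrite [RHS](reindex_inj (addIr (inZp (size u - i)))) /=; apply: eq_bigr => r _.
have -> : rot ((r + (size u - i) %% size u) %% size u)%N u =
          rot (size u - i) (rot r u).
  have := leq_subr i (size u); move: (size u - i)%N => m mu.
  have ru := ltn_ord r; rewrite rot_add_mod ?(ltnW ru) // modnDmr.
  case: ltngtP => h.
  - by rewrite addnC modn_small.
  - have -> : (r + m = (m + r - size u) + size u)%N by lia.
    by rewrite modnDr modn_small //; have Eu : size u = (size u0).+1 by []; lia.
  - by rewrite addnC h modnn rot0 rot_size.
rewrite mulrC subSS; move: (rot r u) (sz r) => R sR; rewrite /rot.
have szd : size (drop (size u - i) R) = i by rewrite size_drop sR subKn // -ltnS.
by rewrite take_size_cat // drop_size_cat.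
Qed.

End Series.

(** * The Magnus embedding *)

Section Magnus.
Variable n : nat.
Local Notation F := (freeGroup n).
Local Notation A := (series n).
Local Open Scope ring_scope.
Implicit Types (x y : F) (i j : 'I_n).

Definition ser_geom i : A := Series (fun w => if all (pred1 i) w then (-1)
  ^+ size w else 0).

Lemma ser_geomK i : (1 + ser_var i) * ser_geom i = 1.
Proof.
apply: seriesP => -[|a w]; rewrite mulrDl mul1r coefD coef_varM //=.
by case: eqP => //= _; rewrite ?mul0r //= mul1r; case: ifP => _;
  rewrite // exprS mulN1r addNr.
Qed.

Lemma ser_geomVK i : ser_geom i * (1 + ser_var i) = 1.
Proof.
apply: seriesP => w; case: (lastP w) => {w} [|w a].
  by rewrite mulrDr mulr1 coefD coefM_var_nil.
rewrite mulrDr mulr1 coefD coefM_var coef1 /= all_rcons size_rcons -size_eq0 size_rcons /=.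
by case: eqP => //= _; rewrite ?mulr0 //= mulr1; case: ifP => _;
  rewrite // exprS mulN1r addNr.
Qed.

Definition magnus_gen i := UnitPair (ser_geomK i) (ser_geomVK i).

Definition magnus : F -> unit_pair A := free_ext magnus_gen.
Definition mu x : A := uval (magnus x).

Lemma magnusM : {morph magnus : x y / (x * y)%g}.
Proof. exact: free_extM. Qed.

Lemma muM x y : mu (x * y)%g = mu x * mu y.
Proof. by rewrite /mu magnusM. Qed.

Lemma mu1 : mu 1%g = 1.
Proof. by rewrite /mu (gmorph1 magnusM). Qed.

Lemma muV x : mu x^-1%g = uinv (magnus x).
Proof. by rewrite /mu (gmorphV magnusM). Qed.

Lemma muK x : mu x * mu x^-1%g = 1.
Proof. by rewrite -muM mulgV mu1. Qed.

Lemma mu_gen i : mu (free_gen i) = 1 + ser_var i.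
Proof. by rewrite /mu /magnus free_ext_gen. Qed.

Lemma mu_ordM k x y : ser_ord k (mu x - 1) -> ser_ord k (mu y - 1) ->
  ser_ord k (mu (x * y)%g - 1).
Proof.
move=> Ox Oy; have -> : mu (x * y)%g - 1 = (mu x - 1) * mu y + (mu y - 1).
  by rewrite mulrBl mul1r muM addrA subrK.
by apply: ser_ordD => //; rewrite -[k]addn0; apply: ser_ordM.
Qed.

Lemma mu_ordV k x : ser_ord k (mu x - 1) -> ser_ord k (mu x^-1%g - 1).
Proof.
move=> Ox; have -> : mu x^-1%g - 1 = - ((mu x - 1) * mu x^-1%g).
  by rewrite mulrBl mul1r muK opprB.
move=> w wk; rewrite coefN (ser_ordM (m := 0) Ox) ?oppr0 ?addn0 //.
Qed.

Lemma mu_ord1 x : ser_ord 1 (mu x - 1).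
Proof.
elim/free_gen_ind: x => [|i|x y|x]; last exact: mu_ordV.
- by rewrite mu1 subrr.
- by rewrite mu_gen addrAC subrr add0r => -[|[]].
- exact: mu_ordM.
Qed.

Lemma mu_nil x : mu x [::] = 1.
Proof.
have /(_ [::] isT) := @mu_ord1 x.
by rewrite coefB => /eqP; rewrite subr_eq0 => /eqP.
Qed.

(** As [mu] of any element begins with 1, this makes a commutator begin with the Lie bracket of the
    leading terms. *)
Lemma mu_comm x y : mu (comm x y) - 1 =
  ((mu x - 1) * (mu y - 1) - (mu y - 1) * (mu x - 1)) * mu (y * x)^-1%g.
Proof.
have E (a b o : A) : o * a = a -> o * b = b -> a * o = a -> b * o = b ->
    (a - o) * (b - o) - (b - o) * (a - o) = a * b - b * a.
  by move=> oa ob ao bo; rewrite !mulrBl !mulrBr oa ob ao bo; zmod.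
rewrite E ?mul1r ?mulr1 // -!muM.
rewrite mulrBl -!muM mulgV mu1; congr (mu _ - 1); by grp.
Qed.

(* The exponent sum of the i-th generator is the coefficient of X_i. *)
Definition expsum i x : int := mu x [:: i].

Lemma expsumM i x y : expsum i (x * y)%g = expsum i x + expsum i y.
Proof.
rewrite /expsum muM coefM big_ord_recl big_ord1 /= !mu_nil mul1r mulr1; exact: addrC.
Qed.

Lemma expsum_gen i j : expsum i (free_gen j) = (i == j)%:Z.
Proof. by rewrite /expsum mu_gen coefD coef1 add0r /= eqseq_cons andbT. Qed.

Lemma expsum1 i : expsum i 1%g = 0.
Proof. by rewrite /expsum mu1. Qed.

Lemma expsumV i x : expsum i x^-1%g = - expsum i x.
Proof.
by apply/eqP; rewrite -addr_eq0 -expsumM mulVg expsum1.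
Qed.

Lemma expsum_derived i x : derived_subgroup x -> expsum i x = 0.
Proof.
pose K : set F := [set y | expsum i y = 0].
have sK : is_subgroup K.
  by split=> [|y z]; rewrite /K /= ?expsum1 // expsumM expsumV => -> ->; rewrite subr0.
move: x; apply: (subgroup_gen_min sK) => _ [y _ [z _ <-]].
rewrite /K /= /comm !expsumM !expsumV; ring.
Qed.

End Magnus.

(** * Freeness of the abelianization of F_n *)

Section FreeAbelianization.
Variable n : nat.
Local Notation F := (freeGroup n).
Local Notation V := (abelianization F).
Local Open Scope ring_scope.

Definition ab_coord (i : 'I_n) (v : V) : int := expsum i (repr v).

Lemma ab_coordE i (x : F) : ab_coord i (ab x) = expsum i x.
Proof.
apply/eqP; rewrite -subr_eq0 -expsumV -expsumM; apply/eqP/expsum_derived.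
exact: ab_repr.
Qed.

Lemma ab_coordD i v w : ab_coord i (v + w) = ab_coord i v + ab_coord i w.
Proof.
have [x ->] := ab_surj v; have [y ->] := ab_surj w.
by rewrite -abM !ab_coordE expsumM.
Qed.

Lemma ab1 (G : groupType) : ab (1%g : G) = 0. Proof. by []. Qed.

Lemma abV (G : groupType) (x : G) : ab x^-1%g = - ab x.
Proof. by apply/eqP; rewrite -addr_eq0 -abM mulVg ab1. Qed.

Section Extension.
Variables (M : zmodType) (f : 'I_n -> M).

Definition ab_ext (v : V) : M := \sum_i f i *~ ab_coord i v.

Lemma ab_extD v w : ab_ext (v + w) = ab_ext v + ab_ext w.
Proof. by rewrite -big_split; apply: eq_bigr => i _; rewrite ab_coordD mulrzDr. Qed.

Lemma ab_ext_gen i : ab_ext (ab (free_gen i)) = f i.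
Proof.
rewrite /ab_ext (bigD1 i) //= ab_coordE expsum_gen eqxx big1 ?addr0 // => j ji.
by rewrite ab_coordE expsum_gen (negbTE ji).
Qed.

End Extension.

Lemma ab_hom_eq (M : zmodType) (f g : V -> M) :
    {morph f : v w / v + w} -> {morph g : v w / v + w} ->
  (forall i, f (ab (free_gen i)) = g (ab (free_gen i))) -> f =1 g.
Proof.
move=> fD gD fg v; have [x ->] := ab_surj v.
have f0 (h : V -> M) : {morph h : v w / v + w} -> h 0 = 0.
  by move=> hD; apply: (addrI (h 0)); rewrite -hD !addr0.
have fN (h : V -> M) w : {morph h : v w / v + w} -> h (- w) = - h w.
  by move=> hD; apply/eqP; rewrite -addr_eq0 -hD addNr f0.
elim/free_gen_ind: x => [|//|x y Ex Ey|x Ex].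
- by rewrite ab1 !f0.
- by rewrite abM fD gD Ex Ey.
- by rewrite abV !fN // Ex.
Qed.

End FreeAbelianization.

Lemma lie_anti (L : lieRingType) (a b : L) : (lie a b = - lie b a)%R.
Proof.
apply/eqP; rewrite -addr_eq0; apply/eqP.
by have := liexx (a + b)%R; rewrite lieDl !lieDr !liexx add0r addr0.
Qed.

Lemma lie_jacobil (L : lieRingType) (a b c : L) :
  (lie (lie a b) c = lie (lie a c) b + lie a (lie b c))%R.
Proof.
rewrite [lie (lie a b) c]lie_anti [lie (lie a c) b]lie_anti [lie a c]lie_anti.
rewrite lieNr opprK; apply/eqP; rewrite eq_sym -addr_eq0.
by rewrite [(lie b _ + _)%R]addrC lie_jacobi.
Qed.

(** * Universal properties of the free Lie ring *)

Section FreeLieExtension.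
Variable V : zmodType.
Local Notation L := (freeLie V).
Local Open Scope ring_scope.

Section Associative.
Variables (B : pzRingType) (f : V -> B).
Hypothesis fD : {morph f : v w / v + w}.

Fixpoint term_eval (s : lie_term V) : B :=
  match s with
  | LGen v => f v
  | LZero => 0
  | LOpp s => - term_eval s
  | LAdd s t => term_eval s + term_eval t
  | LBracket s t => term_eval s * term_eval t - term_eval t * term_eval s
  end.

Lemma term_eval_cong s t : lie_cong s t -> term_eval s = term_eval t.
Proof.
elim=> {s t} //= [s t u _ -> _ -> //|s s' _ ->|s s' t t' _ -> _ ->|s s' t t' _ -> _ ->|
  s t u|s t|s|s|s t u|s t u|s|s t u] //.
- exact: addrA.
- exact: addrC.
- exact: add0r.
- exact: addNr.
- by rewrite mulrDl mulrDr opprD addrACA.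
- by rewrite mulrDl mulrDr opprD addrACA.
- exact: subrr.
- rewrite !mulrBl !mulrBr !mulrA; zmod.
Qed.

Definition freeLie_eval (a : L) : B := term_eval (repr a).

Lemma freeLie_evalE s : freeLie_eval (lie_class s) = term_eval s.
Proof. exact/term_eval_cong/repr_lie_class. Qed.

Lemma freeLie_evalD : {morph freeLie_eval : a b / a + b}.
Proof.
move=> a b; have [s ->] := lie_class_surj a; have [t ->] := lie_class_surj b.
by rewrite -lie_classD !freeLie_evalE.
Qed.

Lemma freeLie_eval_lie a b : freeLie_eval (lie a b) =
  freeLie_eval a * freeLie_eval b - freeLie_eval b * freeLie_eval a.
Proof.
have [s ->] := lie_class_surj a; have [t ->] := lie_class_surj b.
by rewrite [lie _ _]freeLie_lieE !freeLie_evalE.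
Qed.

Lemma freeLie_eval_gen v : freeLie_eval (lie_gen v) = f v.
Proof. exact: freeLie_evalE. Qed.

End Associative.

Section DerivationExtension.
Variable f : V -> L.
Hypothesis fD : {morph f : v w / v + w}.

Fixpoint term_der (s : lie_term V) : L :=
  match s with
  | LGen v => f v
  | LZero => 0
  | LOpp s => - term_der s
  | LAdd s t => term_der s + term_der t
  | LBracket s t => lie (term_der s) (lie_class t) + lie (lie_class s) (term_der t)
  end.

Lemma lie_classB (s t : lie_term V) : lie_class (LBracket s t) = lie (lie_class s)
  (lie_class t).
Proof. by rewrite [lie _ _]freeLie_lieE. Qed.

Lemma term_der_cong s t : lie_cong s t -> term_der s = term_der t.
Proof.
elim=> {s t} //= [s t u _ -> _ -> //|s s' _ ->|s s' t t' _ -> _ ->|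
  s s' t t' /lie_classP -> -> /lie_classP -> ->|
  s t u|s t|s|s|s t u|s t u|s|s t u] //.
- exact: addrA.
- exact: addrC.
- exact: add0r.
- exact: addNr.
- by rewrite lie_classD !lieDl addrACA.
- by rewrite lie_classD !lieDr addrACA.
- by rewrite lie_anti addNr.
- rewrite !lie_classB !lieDr.
  move: (term_der s) (term_der t) (term_der u) (lie_class s) (lie_class t)
    (lie_class u) => s' t' u' a b c.
  (* The derivative of the Jacobi identity regroups into three Jacobi identities, one for each
     differentiated argument. *)
  transitivity ((lie s' (lie b c) + lie b (lie c s') + lie c (lie s' b)) +
    (lie a (lie t' c) + lie t' (lie c a) + lie c (lie a t')) +
    (lie a (lie b u') + lie b (lie u' a) + lie u' (lie a b))); first by zmod.
  by rewrite !lie_jacobi !addr0.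
Qed.

Lemma freeLie_ind (P : L -> Prop) :
  (forall v, P (lie_gen v)) -> P 0 -> (forall a b, P a -> P b -> P (a - b)) ->
  (forall a b, P a -> P b -> P (lie a b)) -> forall a, P a.
Proof.
move=> PX P0 PB PL a; have [s ->] := lie_class_surj a.
have PN b : P b -> P (- b) by rewrite -[- b]add0r; apply: PB.
elim: s => [v||s Ps|s Ps t Pt|s Ps t Pt]; first exact: PX.
- exact: P0.
- rewrite -freeLie_oppE. exact: PN.
- by rewrite lie_classD -[lie_class t]opprK; apply/PB/PN.
- by rewrite lie_classB; apply: PL.
Qed.

Definition term_der_fun (a : L) : L := term_der (repr a).

Lemma term_der_funE s : term_der_fun (lie_class s) = term_der s.
Proof. exact/term_der_cong/repr_lie_class. Qed.

Lemma term_der_funD : {morph term_der_fun : a b / a + b}.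
Proof.
move=> a b; have [s ->] := lie_class_surj a; have [t ->] := lie_class_surj b.
by rewrite -lie_classD !term_der_funE.
Qed.

Lemma term_der_fun_lie a b : term_der_fun (lie a b) =
  lie (term_der_fun a) b + lie a (term_der_fun b).
Proof.
have [s ->] := lie_class_surj a; have [t ->] := lie_class_surj b.
by rewrite -lie_classB !term_der_funE.
Qed.

Lemma freeLie_der_ex : {d : derivation L | forall v, d (lie_gen v) = f v}.
Proof.
exists (Derivation term_der_funD term_der_fun_lie) => v; exact: term_der_funE.
Qed.

Definition freeLie_der : derivation L := sval freeLie_der_ex.

Lemma freeLie_der_gen v : freeLie_der (lie_gen v) = f v.
Proof. exact: svalP freeLie_der_ex v. Qed.

End DerivationExtension.

Lemma der_gen_eq (d e : derivation L) :
  (forall v, d (lie_gen v) = e (lie_gen v)) -> d = e.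
Proof.
move=> de; apply: der_ext => a; elim/freeLie_ind: a => // [|a b da db|a b da db].
- by rewrite !der0.
- by rewrite !(derD, derN) da db.
- by rewrite !der_lie da db.
Qed.
End FreeLieExtension.

(** * Lyndon words and Hall trees *)

Section WordOrder.
Variable n : nat.
Local Notation word := (seq 'I_n).
Implicit Types u v w p s : word.

Fixpoint ltw u v : bool :=
  match u, v with
  | _, [::] => false
  | [::], _ => true
  | a :: u, b :: v => (a < b)%N || (a == b) && ltw u v
  end.

Lemma ltw_irr u : ltw u u = false.
Proof. by elim: u => //= a u ->; rewrite ltnn eqxx. Qed.

Lemma ltw_trans v u w : ltw u v -> ltw v w -> ltw u w.
Proof.
elim: u v w => [|a u IHu] [|b v] [|c w] //=.
case/orP=> [ab|/andP[/eqP-> uv]] /orP[bc|/andP[/eqP <- vw]].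
- by rewrite (ltn_trans ab bc).
- by rewrite ab.
- by rewrite bc.
- by rewrite eqxx (IHu _ _ uv vw) orbT.
Qed.

Lemma ltw_total u v : [\/ ltw u v, u = v | ltw v u].
Proof.
elim: u v => [|a u IHu] [|b v] /=; try by constructor.
case: (ltngtP a b) => [ab|ab|/val_inj ab]; [by constructor| by constructor 3|].
rewrite ab eqxx /=; case: (IHu v) => [->|->|->]; first by constructor.
  by constructor 2.
by constructor 3.
Qed.

Lemma ltw_asym u v : ltw u v -> ltw v u = false.
Proof. by move=> uv; apply/negP => /(ltw_trans uv); rewrite ltw_irr. Qed.

Lemma ltw_cat2l p u v : ltw (p ++ u) (p ++ v) = ltw u v.
Proof. by elim: p => //= a p IHp; rewrite ltnn eqxx. Qed.

Lemma ltw_prefix u v : v != [::] -> ltw u (u ++ v).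
Proof. by move=> v0; rewrite -{1}[u]cats0 ltw_cat2l; case: v v0. Qed.

Lemma ltw_cases u v : ltw u v ->
  (exists2 v', v' != [::] & v = u ++ v') \/ (forall s t, ltw (u ++ s) (v ++ t)).
Proof.
elim: u v => [|a u IHu] [|b v] //=; first by left; exists (b :: v).
case/orP=> [ab|/andP[/eqP-> /IHu[[v' v0 ->]|uv]]].
- by right=> s t; rewrite ab.
- by left; exists v'.
- by right=> s t; rewrite eqxx uv orbT.
Qed.

Lemma ltw_cat u v s (t : word) : (size v <= size u)%N -> ltw u v -> ltw (u ++ s)
  (v ++ t).
Proof.
move=> vu /ltw_cases[[v' v0 E]|] //.
by case: v' v0 E vu => // c v' _ ->; rewrite size_cat /= addnS ltnNge leq_addr.
Qed.

Lemma ltw_same_size u v s (t : word) : size u = size v -> u != v ->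
  ltw (u ++ s) (v ++ t) = ltw u v.
Proof.
move=> uv nuv; have [|E|] := ltw_total u v.
- by move=> h; rewrite h ltw_cat ?uv.
- by rewrite E eqxx in nuv.
- by move=> h; rewrite (ltw_asym h); apply/ltw_asym/ltw_cat; rewrite ?uv.
Qed.

(** Base [n + 1] numeral of the first N letters, with digits 1 to n and padding by 0. The
    lexicographic order is not well-founded on all words; on words of length at most N this rank
    serves as induction measure. *)
Fixpoint word_rank N w : nat :=
  if N is N'.+1 then
    if w is a :: w' then (a.+1 * n.+1 ^ N' + word_rank N' w')%N else 0 else 0.

Lemma word_rank_lt N w : (word_rank N w < n.+1 ^ N)%N.
Proof.
elim: N w => [|N IHN] [|a w] //=; rewrite expnS; first by rewrite muln_gt0 expn_gt0.
have := IHN w; have := ltn_ord a; nia.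
Qed.

Lemma ltw_rank N u v : (size v <= N)%N -> ltw u v -> (word_rank N u < word_rank N v)%N.
Proof.
elim: N u v => [|N IHN] [|a u] [|b v] //=; rewrite ltnS => vN.
  by move=> _; rewrite addn_gt0 muln_gt0 expn_gt0.
case/orP=> [ab|/andP[/eqP-> uv]]; last by rewrite ltn_add2l IHN.
have := word_rank_lt N u; nia.
Qed.

Definition lyndon w :=
  w != [::] /\ forall p s, w = p ++ s -> p != [::] -> s != [::] -> ltw w s.

Lemma lyndon_catr u v : lyndon u -> lyndon v -> ltw u v -> ltw (u ++ v) v.
Proof.
move=> [u0 _] [_ Lv] /ltw_cases[[v' v'0 E]|h]; last by rewrite -[X in ltw _ X]cats0.
by rewrite {2}E ltw_cat2l; apply: Lv E _ _.
Qed.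

(** A suffix inside v is at least v, and [u ++ v] is below v. For a suffix [s' ++ v] with s' a
    proper suffix of u, the inequality between u and s' survives appending letters because u is not
    shorter than s'. *)
Lemma lyndon_cat u v : lyndon u -> lyndon v -> ltw u v -> lyndon (u ++ v).
Proof.
move=> Lu Lv uv; have uvv := lyndon_catr Lu Lv uv.
split=> [|p s E p0 s0]; first by case: Lu => [+ _]; case: (u).
have [[s' Eu ->]|[p' Ep Ev]] := cat_eq_cases E.
  have [s'0|s'0] := eqVneq s' [::]; first by rewrite s'0.
  apply: ltw_cat; first by rewrite Eu size_cat leq_addl.
  by case: Lu => _; apply; first exact: Eu.
have [p'0|p'0] := eqVneq p' [::]; first by move: Ev; rewrite p'0 => /= <-.
by apply: ltw_trans uvv _; case: Lv => _; apply; first exact: Ev.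
Qed.

(* Binary trees stand for iterated brackets; a Hall tree is the standard
   bracketing of a Lyndon word. *)
Inductive tree := Leaf of 'I_n | Node of tree & tree.

Fixpoint tword t : word :=
  match t with Leaf i => [:: i] | Node t1 t2 => tword t1 ++ tword t2 end.

Fixpoint hall t : bool :=
  if t is Node t1 t2 then
    [&& hall t1, hall t2, ltw (tword t1) (tword t2) &
        if t1 is Node _ t12 then ~~ ltw (tword t12) (tword t2) else true]
  else true.

Definition hall_le t1 w := if t1 is Node _ t12 then ~~ ltw (tword t12) w else true.

Lemma hallP t1 t2 : reflect
  [/\ hall t1, hall t2, ltw (tword t1) (tword t2) & hall_le t1 (tword t2)]
  (hall (Node t1 t2)).
Proof. exact: and4P. Qed.

Lemma tword0 t : tword t != [::].
Proof. by elim: t => //= t1 + t2 _; case: (tword t1). Qed.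

Lemma hall_lyndon t : hall t -> lyndon (tword t).
Proof.
elim: t => [i _|t1 IH1 t2 IH2 /hallP[h1 h2 lt _]]; last first.
  by apply: lyndon_cat => //; [apply: IH1 | apply: IH2].
by split=> // -[|a [|b p]] [|c s].
Qed.

(** The condition [hall_le] makes the right subtree carry the least proper suffix. Hence the word
    determines the splitting at the root, which is how [tword_inj] recovers the tree. *)
Lemma hall_min_suffix t1 t2 p s : hall (Node t1 t2) ->
  tword t1 ++ tword t2 = p ++ s -> p != [::] -> s != [::] -> ~~ ltw s (tword t2).
Proof.
elim: t1 t2 p s => [i|t11 IH t12 _] t2 p s /hallP[h1 h2 lt12 lt].
  case: p => //= a p [_ E] _ s0; have [L2 L2'] := hall_lyndon h2.
  have [p0|p0] := eqVneq p [::]; first by rewrite E p0 /= ltw_irr.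
  by rewrite (ltw_asym (L2' _ _ E p0 s0)).
move=> E p0 s0; have [[s' Eu ->]|[p' Ep Ev]] := cat_eq_cases E.
  have [s'0|s'0] := eqVneq s' [::]; first by rewrite s'0 /= ltw_irr.
  apply/negP => sw2; have /negP[] := IH t12 p s' h1 Eu p0 s'0.
  have {sw2}sw2 := ltw_trans (ltw_prefix s' (tword0 t2)) sw2.
  case: (ltw_total (tword t2) (tword t12)) (lt : ~~ ltw _ _) => [h _|<- _|->] //.
  exact: ltw_trans sw2 h.
have [p'0|p'0] := eqVneq p' [::]; first by rewrite Ev p'0 /= ltw_irr.
have [L2 L2'] := hall_lyndon h2.
by rewrite (ltw_asym (L2' _ _ Ev p'0 s0)).
Qed.

Lemma tword_inj t t' : hall t -> hall t' -> tword t = tword t' -> t = t'.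
Proof.
elim: t t' => [i|t1 IH1 t2 IH2] [j|t1' t2'].
- by move=> _ _ [->].
- move=> _ _ /(congr1 size) /=; rewrite size_cat.
  by have := tword0 t1'; have := tword0 t2';
    case: (tword t1') (tword t2') => // ? ? [|? ?] //=; lia.
- move=> _ _ /(congr1 size) /=; rewrite size_cat.
  by have := tword0 t1; have := tword0 t2;
    case: (tword t1) (tword t2) => // ? ? [|? ?] //=; lia.
move=> h h' /= E.
have le := hall_min_suffix h E (tword0 _) (tword0 _).
have le' := hall_min_suffix h' (esym E) (tword0 _) (tword0 _).
have E2 : tword t2 = tword t2'.
  by case: (ltw_total (tword t2) (tword t2')) => // lt; rewrite lt in le le'.
have E1 : tword t1 = tword t1'.
  have /eqP := E; rewrite E2 eqseq_cat ?eqxx ?andbT => [/eqP //|].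
  by move/(congr1 size): E; rewrite !size_cat E2 => /addIn.
move: h h' => /hallP[h1 h2 _ _] /hallP[h1' h2' _ _].
by rewrite (IH1 t1') // (IH2 t2').
Qed.

End WordOrder.

(** * Graded quotients of the free group *)

Section Homogeneous.
Variable n : nat.
Local Open Scope ring_scope.
Implicit Types f g : series n.

Definition ser_homog k f := forall w, size w <> k -> f w = 0.

Lemma ser_homogB k f g : ser_homog k f -> ser_homog k g -> ser_homog k (f - g).
Proof. by move=> Hf Hg w wk; rewrite coefB Hf ?Hg. Qed.

Lemma ser_homog_ord k f : ser_homog k f -> ser_ord k f.
Proof. by move=> Hf w wk; apply: Hf => E; rewrite E ltnn in wk. Qed.

Lemma ser_homogM k m f g : ser_homog k f -> ser_homog m g -> ser_homog (k + m) (f * g).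
Proof.
move=> Hf Hg w wk; rewrite coefM big1 // => i _.
have [tk|/eqP tk] := eqVneq (size (take i w)) k; last by rewrite Hf ?mul0r.
rewrite Hg ?mulr0 // => dm; apply: wk.
by rewrite -tk -dm -size_cat cat_take_drop.
Qed.

End Homogeneous.

Section GradedClasses.
Variable n : nat.
Local Notation F := (freeGroup n).
Local Notation V := (abelianization F).
Local Notation L := (freeLie V).
Local Open Scope ring_scope.
Implicit Types (x y z : F) (a b c : L) (t : tree n).

Definition lie_var (i : 'I_n) : L := lie_gen (ab (free_gen i)).

Definition iota : L -> series n := freeLie_eval (ab_ext (@ser_var n)).

Lemma iotaD a b : iota (a + b) = iota a + iota b.
Proof. by apply: freeLie_evalD; apply: ab_extD. Qed.

Lemma iota_lie a b : iota (lie a b) = iota a * iota b - iota b * iota a.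
Proof. by apply: freeLie_eval_lie; apply: ab_extD. Qed.

Lemma iota_gen v : iota (lie_gen v) = ab_ext (@ser_var n) v.
Proof. by apply: freeLie_eval_gen; apply: ab_extD. Qed.

Lemma iota_var i : iota (lie_var i) = ser_var i.
Proof. by rewrite iota_gen ab_ext_gen. Qed.

Lemma iota0 : iota 0 = 0.
Proof. by apply: (addrI (iota 0)); rewrite -iotaD !addr0. Qed.

Lemma iotaN a : iota (- a) = - iota a.
Proof. by apply/eqP; rewrite -addr_eq0 -iotaD addNr iota0. Qed.

Lemma iotaB a b : iota (a - b) = iota a - iota b.
Proof. by rewrite iotaD iotaN. Qed.

HB.instance Definition _ := GRing.isZmodMorphism.Build L (series n) iota iotaB.

Lemma iota_homog j a : lie_deg j a -> ser_homog j (iota a).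
Proof.
elim=> {j a} [v|j|j a b _ Ha _ Hb|i j a b _ Ha _ Hb].
- move=> w wk; rewrite iota_gen coef_sum big1 // => i _.
  rewrite coef_mulrz /=; case: eqP => [E|_]; last exact: mul0rz.
  by rewrite E in wk.
- by rewrite iota0.
- by rewrite iotaB; apply: ser_homogB.
- by rewrite iota_lie; apply: ser_homogB; [|rewrite addnC]; apply: ser_homogM.
Qed.

Lemma iota_gen_coef v i : iota (lie_gen v) [:: i] = ab_coord i v.
Proof.
rewrite iota_gen coef_sum (bigD1 i) //= coef_mulrz big1 ?addr0 => [|j ji].
  by rewrite /= eqxx intz.
by rewrite coef_mulrz /= eqseq_cons eq_sym (negbTE ji) mul0rz.
Qed.

Lemma lcs_mu_ord j x : 'G_j x -> ser_ord j (mu x - 1).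
Proof.
case: j => [|j]; first by move=> _ w.
elim: j x => [|j IHj] x; first by move=> _; apply: mu_ord1.
pose K : set F := [set y | ser_ord j.+2 (mu y - 1)].
have sK : is_subgroup K.
  split=> [|y z]; first by rewrite /K /= mu1 subrr.
  by move=> Ky Kz; apply: mu_ordM => //; apply: mu_ordV.
rewrite lcsS; move: x; apply: (subgroup_gen_min sK) => _ [y _ [z Hz <-]].
rewrite /K /= mu_comm -[j.+2]addn0; apply: ser_ordM => //.
apply: ser_ordB; first by rewrite -add1n; apply: ser_ordM; [apply: mu_ord1|apply: IHj].
by rewrite -addn1; apply: ser_ordM; [apply: IHj|apply: mu_ord1].
Qed.

Lemma gr_class_lcs j a x : gr_class j a x -> 'G_j x.
Proof.
elim=> {j a x} [//|j x Hx|j a b x y _ Hx _ Hy|i j a b x y _ Hx _ Hy].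
- exact: lcs_sub1.
- by apply: lcsM => //; apply: lcsV.
- exact: lcs_comm.
Qed.

Lemma gr_class_deg j a x : gr_class j a x -> lie_deg j a.
Proof.
elim=> {j a x} [x|j x Hx|j a b x y _ Hx _ Hy|i j a b x y _ Hx _ Hy].
- exact: lie_deg_gen.
- exact: lie_deg0.
- exact: lie_degB.
- exact: lie_deg_lie.
Qed.

Lemma gr_class_eq j a x y : gr_class j a x -> x =[j.+1]= y -> gr_class j a y.
Proof.
move=> gx xy; have := gr_classB gx (gr_class0 (lcsV (lcsJV y (lcs_eq_sym xy)))).
by rewrite subr0; congr (gr_class _ _ _); grp.
Qed.

Lemma gr_classV j a x : gr_class j a x -> gr_class j (- a) x^-1%g.
Proof.
by move=> gx; have := gr_classB (gr_class0 (lcs1 _ j.+1)) gx; rewrite sub0r mul1g.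
Qed.

Lemma gr_classD j a b x y :
  gr_class j a x -> gr_class j b y -> gr_class j (a + b) (x * y)%g.
Proof.
by move=> gx /gr_classV gy; have := gr_classB gx gy; rewrite opprK invgK.
Qed.

Lemma lie_deg_class j a : lie_deg j a -> exists x, gr_class j a x.
Proof.
elim=> {j a} [v|j|j a b _ [x Hx] _ [y Hy]|i j a b _ [x Hx] _ [y Hy]].
- by have [x ->] := ab_surj v; exists x; apply: gr_class_gen.
- by exists 1%g; apply/gr_class0/lcs1.
- by exists (x * y^-1)%g; apply: gr_classB.
- by exists (comm x y); apply: gr_class_lie.
Qed.

Lemma lcs_class j x : (0 < j)%N -> 'G_j x -> exists a, gr_class j a x.
Proof.
case: j => // j _; elim: j x => [|j IHj] x.
  by move=> _; exists (lie_gen (ab x)); apply: gr_class_gen.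
pose K : set F := [set y | exists a, gr_class j.+2 a y].
have sK : is_subgroup K.
  split=> [|y z]; first by exists 0; apply/gr_class0/lcs1.
  by move=> [a Ha] [b Hb]; exists (a - b); apply: gr_classB.
rewrite lcsS; move: x; apply: (subgroup_gen_min sK) => _ [y _ [z Hz <-]].
have [a Ha] := IHj _ Hz; exists (lie (lie_gen (ab y)) a).
by rewrite -add1n; apply: gr_class_lie => //; apply: gr_class_gen.
Qed.

Lemma lie_deg_0 a : lie_deg 0 a -> a = 0.
Proof.
move E: 0%N => j Ha; elim: Ha E => {j a} [v|j|j a b _ IHa _ IHb|i j a b _ IHa _ IHb] //.
  by move=> j0; rewrite IHa ?IHb ?subrr.
by move/esym/eqP; rewrite addn_eq0 => /andP[/eqP i0 _]; rewrite IHa ?lie0l.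
Qed.

(** Brackets go by [mu_comm], differences by [mu (x * y^-1) - 1 = (mu x - mu y) * mu y^-1], up to
    factors beginning with 1. One series can then test both the Lie element and the group element
    for vanishing. *)
Lemma gr_class_lead j a x : gr_class j a x -> ser_ord j.+1 (mu x - 1 - iota a).
Proof.
elim=> {j a x} [x|j x Hx|j a b x y gx Hx gy Hy|i j a b x y gx Hx gy Hy].
- move=> [|i [|//]] _; rewrite !coefB.
    by rewrite mu_nil (iota_homog (lie_deg_gen _)).
  by rewrite iota_gen_coef ab_coordE subr0 subrr.
- by rewrite iota0 subr0; apply: lcs_mu_ord.
- have Oy := lcs_mu_ord (lcsV (gr_class_lcs gy)).
  have -> : mu (x * y^-1)%g - 1 - iota (a - b) =
    (mu x - 1 - iota a - (mu y - 1 - iota b)) +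
    ((mu x - 1) - (mu y - 1)) * (mu y^-1%g - 1).
    rewrite iotaB muM [_ - 1 - (_ - 1)](_ : _ = mu x - mu y); last by zmod.
    by rewrite mulrBr mulr1 mulrBl muK; zmod.
  apply: ser_ordD; first exact: ser_ordB.
  rewrite -addn1; apply: ser_ordM; last exact: mu_ord1.
  by apply: ser_ordB; apply: lcs_mu_ord; apply: gr_class_lcs; eassumption.
- have Ox := lcs_mu_ord (gr_class_lcs gx); have Oy := lcs_mu_ord (gr_class_lcs gy).
  have OA := ser_homog_ord (iota_homog (gr_class_deg gx)).
  have OB := ser_homog_ord (iota_homog (gr_class_deg gy)).
  rewrite mu_comm iota_lie; move: (mu x - 1) (mu y - 1) (iota a) (iota b)
    Hx Hy Ox Oy OA OB.
  move=> p q A B Hp Hq Op Oq OA OB; set m := mu _.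
  have -> : (p * q - q * p) * m - (A * B - B * A) =
     (p * q - q * p) * (m - 1) + ((p - A) * q + A * (q - B))
       - ((q - B) * p + B * (p - A)).
    by rewrite mulrBr mulr1 !mulrBl !mulrBr; zmod.
  apply: ser_ordB.
    apply: ser_ordD.
      rewrite -addn1; apply: ser_ordM; last exact: mu_ord1.
      by apply: ser_ordB; [|rewrite addnC]; apply: ser_ordM.
    by apply: ser_ordD; [rewrite -addSn|rewrite -addnS]; apply: ser_ordM.
  by rewrite addnC; apply: ser_ordD; [rewrite -addSn|rewrite -addnS]; apply: ser_ordM.
Qed.

Fixpoint tlie t : L :=
  match t with Leaf i => lie_var i | Node t1 t2 => lie (tlie t1) (tlie t2) end.
Fixpoint tcomm t : F :=
  match t with Leaf i => free_gen i | Node t1 t2 => comm (tcomm t1) (tcomm t2) end.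
Definition tsize t := size (tword t).

Lemma tsizeN t1 t2 : tsize (Node t1 t2) = (tsize t1 + tsize t2)%N.
Proof. exact: size_cat. Qed.

Lemma tsize_gt0 t : (0 < tsize t)%N.
Proof. by rewrite /tsize lt0n size_eq0 tword0. Qed.

Lemma tree_class t : gr_class (tsize t) (tlie t) (tcomm t).
Proof.
elim: t => [i|t1 IH1 t2 IH2]; first exact: gr_class_gen.
by rewrite tsizeN; apply: gr_class_lie.
Qed.

(** With p and q the words of the subtrees, the product in the order q, p contributes no word below
    [q ++ p], and [p ++ q < q < q ++ p] because p and q are Lyndon. The leading coefficient is
    exactly 1, so that elimination works over the integers. *)
Lemma tlie_lead t : hall t -> iota (tlie t) (tword t) = 1 /\
  forall w, ltw w (tword t) -> iota (tlie t) w = 0.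
Proof.
elim: t => [i _|t1 IH1 t2 IH2 ht].
  rewrite /= iota_var /= eqxx; split=> // w; case: eqP => // ->.
  by rewrite ltw_irr.
have /hallP[h1 h2 lt _] := ht; have {IH1}[c1 z1] := IH1 h1; have {IH2}[c2 z2] := IH2 h2.
have H1 := iota_homog (gr_class_deg (tree_class t1)).
have H2 := iota_homog (gr_class_deg (tree_class t2)).
have H := iota_homog (gr_class_deg (tree_class (Node t1 t2))).
have prod_zero (f g : series n) u v w : ser_homog (size u) f -> ser_homog (size v) g ->
    (forall w, ltw w u -> f w = 0) -> (forall w, ltw w v -> g w = 0) ->
    size w = (size u + size v)%N -> ltw w (u ++ v) -> (f * g) w = 0.
  move=> Hf Hg zf zg sw; rewrite (coefM_lead (ser_homog_ord Hf) (ser_homog_ord Hg) sw).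
  rewrite -{1}(cat_take_drop (size u) w); have st : size (take (size u) w) = size u.
    by rewrite size_takel // sw leq_addr.
  have [->|ne] := eqVneq (take (size u) w) u.
    by rewrite ltw_cat2l => /zg ->; rewrite mulr0.
  by rewrite ltw_same_size // => /zf ->; rewrite mul0r.
have lt21 : ltw (tword t1 ++ tword t2) (tword t2 ++ tword t1).
  apply: ltw_trans (lyndon_catr (hall_lyndon h1) (hall_lyndon h2) lt) _.
  exact/ltw_prefix/tword0.
split=> [|w lw].
  rewrite /= iota_lie coefB (coefM_lead (ser_homog_ord H1) (ser_homog_ord H2));
    last exact: size_cat.
  rewrite take_size_cat // drop_size_cat // c1 c2 mulr1 (prod_zero _ _ _ _ _ H2 H1)
    ?subr0 //.
  by rewrite size_cat addnC.
have [sw|/eqP sw] := eqVneq (size w) (tsize (Node t1 t2)); last exact: H.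
rewrite /= iota_lie coefB (prod_zero _ _ _ _ _ H1 H2) // -?tsizeN //.
rewrite (prod_zero _ _ _ _ _ H2 H1) ?subr0 //; first by rewrite sw tsizeN addnC.
exact: ltw_trans lw lt21.
Qed.

End GradedClasses.

Section IntegerPowers.
Variable G : groupType.
Implicit Types (x : G) (c d : int).

Definition expgz x c : G := if c is Negz m then (x^-1) ^+ m.+1 else x ^+ `|c|%N.

Lemma expgz_succ x c : expgz x (c + 1)%R = expgz x c * x.
Proof.
case: c => [m|[|m]]; first by rewrite -PoszD addn1 /= expgSr.
  by rewrite /= mulVg.
have -> : (Negz m.+1 + 1 = Negz m)%R by rewrite !NegzE; lia.
by rewrite /= [in RHS]expgSr mulgVK.
Qed.

Lemma expgzD x c d : expgz x (c + d)%R = expgz x c * expgz x d.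
Proof.
have pos (m : nat) e : expgz x (e + m%:Z)%R = expgz x e * x ^+ m.
  elim: m => [|m IHm]; first by rewrite addr0 mulg1.
  by rewrite -addn1 PoszD addrA expgz_succ IHm addn1 expgSr mulgA.
case: d => m; first exact: pos.
have := pos m.+1 (c + Negz m)%R; rewrite {1}NegzE subrK => ->.
by rewrite [expgz x (Negz m)]/expgz expVgn mulgK.
Qed.

Lemma expgzN x c : expgz x (- c)%R = (expgz x c)^-1.
Proof.
apply: (mulgI (expgz x c)); rewrite mulgV -expgzD subrr; exact: expg0.
Qed.

End IntegerPowers.

(** * Hall trees span and separate the graded pieces *)

Section HallSpan.
Variable n : nat.
Local Notation F := (freeGroup n).
Local Notation V := (abelianization F).
Local Notation L := (freeLie V).
Local Open Scope ring_scope.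
Implicit Types (x y z : F) (a b c : L) (t : tree n) (Q : tree n -> Prop).

(* The Lie ring and the group are handled simultaneously: hall_span N Q a x says
   that the same integral combination of Hall trees with N leaves satisfying Q
   gives a in the free Lie ring and x modulo Gamma_(N+1) in the free group. *)
Inductive hall_span (N : nat) Q : L -> F -> Prop :=
| hspan0 x : 'G_(N.+1) x -> hall_span N Q 0 x
| hspanB a b x y : hall_span N Q a x -> hall_span N Q b y ->
    hall_span N Q (a - b) (x * y^-1)%g
| hspanT t : hall t -> tsize t = N -> Q t -> hall_span N Q (tlie t) (tcomm t).

Lemma hspan_class N Q a x : hall_span N Q a x -> gr_class N a x.
Proof.
elim=> {a x} [x Hx|a b x y _ Ha _ Hb|t _ <- _].
- exact: gr_class0.
- exact: gr_classB.
- exact: tree_class.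
Qed.

Lemma hspan_eq N Q a x y : hall_span N Q a x -> x =[N.+1]= y -> hall_span N Q a y.
Proof.
move=> gx xy; have := hspanB gx (hspan0 Q (lcsV (lcsJV y (lcs_eq_sym xy)))).
by rewrite subr0; congr (hall_span _ _ _ _); grp.
Qed.

Lemma hspanV N Q a x : hall_span N Q a x -> hall_span N Q (- a) x^-1%g.
Proof. by move=> /(hspanB (hspan0 Q (lcs1 _ N.+1))); rewrite sub0r mul1g. Qed.

Lemma hspanD N Q a b x y : hall_span N Q a x -> hall_span N Q b y ->
  hall_span N Q (a + b) (x * y)%g.
Proof. by move=> hx /hspanV /(hspanB hx); rewrite opprK invgK. Qed.

Lemma hspan_sub N Q Q' a x : (forall t, hall t -> tsize t = N -> Q t -> Q' t) ->
  hall_span N Q a x -> hall_span N Q' a x.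
Proof.
move=> QQ; elim=> {a x} [x Hx|a b x y _ Ha _ Hb|t ht st Qt].
- exact: hspan0.
- exact: hspanB.
- by apply: hspanT => //; apply: QQ.
Qed.

Lemma hspan_lieC N Q a b x y : hall_span N Q (lie a b) (comm x y) ->
  hall_span N Q (lie b a) (comm y x).
Proof. by move=> /hspanV; rewrite comm_inv -lie_anti. Qed.

Lemma hspan_liel i j Q Q' a b x y : (0 < i)%N -> hall_span i Q a x -> 'G_j y ->
    (forall t, hall t -> tsize t = i -> Q t ->
       hall_span (i + j) Q' (lie (tlie t) b) (comm (tcomm t) y)) ->
  hall_span (i + j) Q' (lie a b) (comm x y).
Proof.
move=> i0 hx Hy HT; elim: hx => {a x} [x Hx|a a' x x' hx IHx hx' IHx'|t ht st Qt].
- by rewrite lie0l; apply: hspan0; rewrite -addSn; apply: lcs_comm.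
- rewrite lieDl lieNl; apply: hspan_eq (hspanB IHx IHx') _; apply: lcs_eq_sym.
  apply: lcs_eq_sub (lcs_eq_commBl (gr_class_lcs (hspan_class hx))
    (gr_class_lcs (hspan_class hx')) Hy).
  by rewrite minnn; lia.
- exact: HT.
Qed.

Lemma hspan_lie i j Q Q' Q'' a b x y : (0 < i)%N -> (0 < j)%N ->
    hall_span i Q a x -> hall_span j Q' b y ->
    (forall t t', hall t -> tsize t = i -> Q t -> hall t' -> tsize t' = j -> Q' t' ->
       hall_span (i + j) Q'' (lie (tlie t) (tlie t')) (comm (tcomm t) (tcomm t'))) ->
  hall_span (i + j) Q'' (lie a b) (comm x y).
Proof.
move=> i0 j0 hx hy HT.
apply: (hspan_liel i0 hx (gr_class_lcs (hspan_class hy))) => t ht st Qt.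
apply: hspan_lieC; rewrite addnC; apply: (hspan_liel j0 hy).
  by rewrite -st; apply: gr_class_lcs (tree_class t).
by move=> t' ht' st' Qt'; apply: hspan_lieC; rewrite addnC; apply: HT.
Qed.

Definition lew (u v : seq 'I_n) := ~~ ltw v u.

Lemma lew_refl u : lew u u. Proof. by rewrite /lew ltw_irr. Qed.

Lemma lt_lew_trans u v w : ltw u v -> lew v w -> ltw u w.
Proof.
rewrite /lew; have [vw|-> //|->] := ltw_total v w => // uv _.
exact: ltw_trans uv vw.
Qed.

(* Lyndon's rewriting: if [t, t'] is not itself a Hall tree then t = [t1, t2] with
   t2 < t', and the Jacobi identity only produces brackets whose larger
   argument has decreased. *)
Lemma hall_bracket N v t t' : hall t -> hall t' -> (tsize t + tsize t')%N = N ->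
    (size v <= N)%N -> lew (tword t) v -> lew (tword t') v ->
  hall_span N (fun s => ltw (tword s) v)
    (lie (tlie t) (tlie t')) (comm (tcomm t) (tcomm t')).
Proof.
elim/ltn_ind: N v t t' => N IHN v.
have [r] := ubnP (word_rank N v); elim: r v => // r IHr v; rewrite ltnS => rv.
suff Hlt t t' : hall t -> hall t' -> (tsize t + tsize t')%N = N -> (size v <= N)%N ->
    ltw (tword t) (tword t') -> lew (tword t') v ->
    hall_span N (fun s => ltw (tword s) v)
      (lie (tlie t) (tlie t')) (comm (tcomm t) (tcomm t')).
  move=> t t' ht ht' sN vN tv t'v; have [lt|E|lt] := ltw_total (tword t) (tword t').
  - exact: Hlt.
  - rewrite (tword_inj ht ht' E) liexx; apply: hspan0.
    by rewrite (_ : comm _ _ = 1%g); [apply: lcs1|grp].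
  - by apply: hspan_lieC; apply: Hlt => //; rewrite addnC.
move=> ht ht' sN vN lt t'v.
have span_node : hall_le t (tword t') -> hall_span N (fun s => ltw (tword s) v)
    (lie (tlie t) (tlie t')) (comm (tcomm t) (tcomm t')).
  move=> le; have hN : hall (Node t t') by apply/hallP.
  apply: (hspanT (t := Node t t')) => //; first by rewrite tsizeN.
  exact: lt_lew_trans (lyndon_catr (hall_lyndon ht) (hall_lyndon ht') lt) t'v.
case: t ht sN lt span_node => [i|t1 t2] ht sN lt span_node; first exact: span_node.
have [lt2|le2] := boolP (ltw (tword t2) (tword t')); last exact: span_node.
have /hallP[h1 h2 lt12 _] := ht.
have lt1 : ltw (tword t1) (tword t').
  by apply: ltw_trans lt; rewrite /=; apply/ltw_prefix/tword0.
have s1 := tsize_gt0 t1; have s2 := tsize_gt0 t2; have s' := tsize_gt0 t'.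
rewrite tsizeN in sN.
(* Both arguments are below [tword t'], so the larger of their words is a bound of smaller rank than
   v, and the inner induction applies. The outer induction, on the degree N, gives [B1] and [B2]. *)
have below s u : hall s -> hall u -> (tsize s + tsize u)%N = N ->
    ltw (tword s) (tword t') -> ltw (tword u) (tword t') ->
    hall_span N (fun s => ltw (tword s) v)
      (lie (tlie s) (tlie u)) (comm (tcomm s) (tcomm u)).
  move=> hs hu su lts ltu.
  have ub w : ltw w (tword t') -> (size w <= N)%N -> lew (tword s) w ->
    lew (tword u) w ->
      hall_span N (fun s => ltw (tword s) v) (lie (tlie s) (tlie u))
        (comm (tcomm s) (tcomm u)).
    move=> ltw' sw ls lu; have ltwv : ltw w v := lt_lew_trans ltw' t'v.
    apply: hspan_sub (IHr w _ _ _ hs hu su sw ls lu).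
      by move=> t _ _ h; apply: ltw_trans ltwv.
    by apply: leq_trans rv; apply: ltw_rank.
  have [h|h|h] := ltw_total (tword s) (tword u).
  - apply: (ub (tword u)) => //; rewrite ?lew_refl //;
    last by rewrite /lew (ltw_asym h).
    by rewrite -su leq_addl.
  - by apply: (ub (tword u)) => //; rewrite -?h ?lew_refl // -su leq_addr.
  - apply: (ub (tword s)) => //; rewrite ?lew_refl //;
    last by rewrite /lew (ltw_asym h).
    by rewrite -su leq_addr.
have B1 : hall_span (tsize t1 + tsize t') (fun s => ltw (tword s) (tword t'))
   (lie (tlie t1) (tlie t')) (comm (tcomm t1) (tcomm t')).
  by apply: IHN => //; rewrite ?lew_refl // ?leq_addl // /lew ?(ltw_asym lt1) //;
    clear -sN s2; lia.
have B2 : hall_span (tsize t2 + tsize t') (fun s => ltw (tword s) (tword t'))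
   (lie (tlie t2) (tlie t')) (comm (tcomm t2) (tcomm t')).
  by apply: IHN => //; rewrite ?lew_refl // ?leq_addl // /lew ?(ltw_asym lt2) //;
    clear -sN s1; lia.
rewrite [tlie (Node _ _)]/= lie_jacobil.
have E1 : (tsize t1 + tsize t' + tsize t2)%N = N by rewrite addnAC.
have E2 : (tsize t1 + (tsize t2 + tsize t'))%N = N by rewrite addnA.
apply: (@hspan_eq _ _ _ (comm (comm (tcomm t1) (tcomm t')) (tcomm t2) *
   comm (tcomm t1) (comm (tcomm t2) (tcomm t')))%g).
  apply: hspanD.
    rewrite -E1; apply: (hspan_liel _ B1); first by rewrite addn_gt0 s1.
      exact: gr_class_lcs (tree_class t2).
    by move=> s hs ss lts; rewrite E1; apply: below => //; rewrite ss.
  rewrite -E2 addnC; apply/hspan_lieC/(hspan_liel _ B2); first by rewrite addn_gt0 s2.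
    exact: gr_class_lcs (tree_class t1).
  by move=> s hs ss lts; rewrite addnC E2; apply: below => //; rewrite ss addnC.
rewrite -sN; apply/lcs_eq_sym/lcs_eq_jacobi => //; exact: gr_class_lcs (tree_class _).
Qed.

Lemma hspan_gen x : hall_span 1 (fun=> True) (lie_gen (ab x)) x.
Proof.
have gen0 : lie_gen (0 : V) = 0 by apply: (addrI (lie_gen 0)); rewrite -lie_genD !addr0.
elim/free_gen_ind: x => [|i|x y Hx Hy|x Hx].
- by rewrite ab1 gen0; apply/hspan0/lcs1.
- exact: (hspanT (t := Leaf i)).
- by rewrite abM lie_genD; apply: hspanD.
- rewrite abV; have -> : lie_gen (- ab x) = - lie_gen (ab x).
    by apply/eqP; rewrite -addr_eq0 -lie_genD addNr gen0.
  exact: hspanV.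
Qed.

Lemma gr_class_span j a x : gr_class j a x -> hall_span j (fun=> True) a x.
Proof.
elim=> {j a x} [x|j x Hx|j a b x y _ Ha _ Hb|i j a b x y gx Hx gy Hy].
- exact: hspan_gen.
- exact: hspan0.
- exact: hspanB.
(* Index 0 is special: the degree 0 part is zero while Gamma_0 is the whole group, so x is arbitrary
   and only [comm x y] gains a step. *)
case: i gx Hx => [|i] gx Hx.
  rewrite (lie_deg_0 (gr_class_deg gx)) lie0l; apply: hspan0.
  by apply: lcs_comm1; apply: gr_class_lcs gy.
case: j gy Hy => [|j] gy Hy.
  rewrite (lie_deg_0 (gr_class_deg gy)) lie0r; apply: hspan0.
  by rewrite addn0 -comm_inv; apply/lcsV/lcs_comm1; apply: gr_class_lcs gx.
apply: (hspan_lie _ _ Hx Hy) => // t t' ht st _ ht' st' _.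
have [h|h|h] := ltw_total (tword t) (tword t').
- apply: hspan_sub (hall_bracket (v := tword t') ht ht' _ _ _ _) => //;
  rewrite ?lew_refl ?st ?st' //.
    by rewrite -/(tsize t') st' leq_addl.
  by rewrite /lew (ltw_asym h).
- apply: hspan_sub (hall_bracket (v := tword t') ht ht' _ _ _ _) => //;
  rewrite -?h ?lew_refl ?st ?st' //.
  by rewrite -/(tsize t) st leq_addr.
- apply: hspan_sub (hall_bracket (v := tword t) ht ht' _ _ _ _) => //;
  rewrite ?lew_refl ?st ?st' //.
    by rewrite -/(tsize t) st leq_addr.
  by rewrite /lew (ltw_asym h).
Qed.

(* Leading terms: the smallest word of a combination of Hall trees is the word of
   its smallest tree. *)
Lemma hspan_iota0 N Q a x : hall_span N Q a x -> iota a = 0 -> a = 0 /\ 'G_(N.+1) x.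
Proof.
move=> hx ia; pose B := (n.+1 ^ N)%N.
have rank_lt t : tsize t = N -> (word_rank N (tword t) < B)%N by move=> _;
  apply: word_rank_lt.
pose P r := hall_span N (fun t => r <= word_rank N (tword t))%N a x.
have {hx Q}P0 : P 0%N by apply: hspan_sub hx.
have PS r : P r -> P r.+1.
  move=> Pr; have [[t [ht st rt]]|nt] := pselect (exists t, [/\ hall t, tsize t =
    N & word_rank N (tword t) = r]); last first.
    apply: hspan_sub Pr => t ht st; rewrite leq_eqVlt => /orP[/eqP rt|//].
    by case: nt; exists t.
  (* c is the multiplicity of t, removed on both sides together. What remains involves only trees
     with larger words, so c is the coefficient of [iota a] at [tword t], hence 0. *)
  suff [c Hc] : exists c : int, hall_span N (fun t => r < word_rank N (tword t))%N
      (a - tlie t *~ c) (x * (expgz (tcomm t) c)^-1)%g.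
    suff c0 : c = 0 by move: Hc; rewrite c0 subr0 /= invg1 mulg1.
    have : iota (a - tlie t *~ c) (tword t) = 0.
      move: (a - _) (x * _)%g Hc => b y;
        elim=> {b y} [y Hy|a1 b x1 y _ Ha _ Hb|t' ht' st' rt'].
      - by rewrite iota0.
      - by rewrite iotaB coefB Ha Hb subrr.
      - apply: (proj2 (tlie_lead ht')); rewrite -rt in rt'.
        have [//|E|h] := ltw_total (tword t) (tword t'); first by rewrite E ltnn in rt'.
        by have := ltn_trans rt' (ltw_rank (N := N) _ h);
          rewrite ltnn -/(tsize t) st => /(_ (leqnn _)).
    have iotaz b : iota (b *~ c) = iota b *~ c.
      exact: raddfMz.
    by rewrite iotaB ia sub0r iotaz coefN coef_mulrz (proj1 (tlie_lead ht))
      intz => /eqP; rewrite oppr_eq0 => /eqP.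
  elim: Pr => {a x ia P P0} [x Hx|a b x y Ha [c Hc] Hb [d Hd]|t' ht' st' rt'].
  - by exists 0; rewrite subr0 /= invg1 mulg1; apply: hspan0.
  - exists (c - d); rewrite mulrzBr expgzD expgzN.
    have -> : a - b - (tlie t *~ c - tlie t *~ d)
      = a - tlie t *~ c - (b - tlie t *~ d) by zmod.
    apply: hspan_eq (hspanB Hc Hd) _; set u := expgz _ c; set v := expgz _ d.
    have uv : (u^-1 * v = v * u^-1)%g by rewrite -expgzN -!expgzD addrC.
    have -> : (x * u^-1 * (y * v^-1)^-1 = x * (u^-1 * v * y^-1))%g by grp.
    have -> : (x * y^-1 * (u * v^-1)^-1 = x * (y^-1 * (u^-1 * v)))%g by rewrite uv; grp.
    apply: lcs_eqM (lcs_eqxx _ _) _.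
    have Hu e : 'G_N (expgz (tcomm t) e).
      rewrite -st; have Ht := gr_class_lcs (tree_class t).
      have Hm y' m : 'G_(tsize t) y' -> 'G_(tsize t) (y' ^+ m)%g.
        move=> Hy; elim: m => [|m IHm]; first exact: lcs1.
        by rewrite expgS; apply: lcsM.
      by case: e => m; apply: Hm => //; apply: lcsV.
    apply: lcs_eq_sub (lcs_eqC (lcsM (lcsV (Hu c)) (Hu d))
      (lcsV (gr_class_lcs (hspan_class Hb)))).
    by have := tsize_gt0 t; lia.
  - have [rt''|] := eqVneq (word_rank N (tword t')) r.
      exists 1; have -> : t' = t.
        apply: tword_inj => //; have [h|//|h] := ltw_total (tword t') (tword t).
          by have := @ltw_rank _ N _ _ _ h;
            rewrite rt'' rt ltnn -/(tsize t) st => /(_ (leqnn _)).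
        by have := @ltw_rank _ N _ _ _ h;
          rewrite rt'' rt ltnn -/(tsize t') st' => /(_ (leqnn _)).
      by rewrite mulr1z subrr /= mulgV; apply/hspan0/lcs1.
    by move=> ne; exists 0; rewrite subr0 /= invg1 mulg1; apply: hspanT => //;
      rewrite ltn_neqAle eq_sym ne.
have PB : P B by elim: B {rank_lt} => // r; apply: PS.
have : hall_span N (fun=> False) a x.
  by apply: hspan_sub PB => t ht st; rewrite leqNgt rank_lt.
elim=> {a x ia P P0 PS PB} [x Hx|a b x y _ [-> Hx] _ [-> Hy]|//]; first by [].
by rewrite subrr; split=> //; apply: lcsM => //; apply: lcsV.
Qed.

(** Well-definedness in one direction: the Lie element determines x modulo the next term.
    [gr_class_lcs0] is the other direction. *)
Lemma gr_class0_lcs j x : gr_class j (0 : L) x -> 'G_j.+1 x.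
Proof. by move=> /gr_class_span /hspan_iota0 []; rewrite ?iota0. Qed.

Lemma gr_class_lcs0 j a x : gr_class j a x -> 'G_j.+1 x -> a = 0.
Proof.
move=> gx Hx; apply: (proj1 (hspan_iota0 (gr_class_span gx) _)).
apply: seriesP => w; have [sw|/eqP sw] := eqVneq (size w) j; last first.
  exact: iota_homog (gr_class_deg gx) _ sw.
have := gr_class_lead gx (w := w); rewrite coefB (lcs_mu_ord Hx) ?sw // sub0r.
by move=> /(_ (leqnn _))/eqP; rewrite oppr_eq0 => /eqP.
Qed.

Lemma gr_class_inj j a b x y :
  gr_class j a x -> gr_class j b y -> x =[j.+1]= y -> a = b.
Proof.
move=> gx gy xy; apply/eqP; rewrite -subr_eq0; apply/eqP.
exact: gr_class_lcs0 (gr_classB gx gy) xy.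
Qed.

Lemma iota_inj j a : lie_deg j a -> iota a = 0 -> a = 0.
Proof.
by move=> /lie_deg_class[x /gr_class_span /hspan_iota0 h] /h [].
Qed.

End HallSpan.

(** * The Johnson morphism *)

Section Johnson.
Variable n : nat.
Local Notation F := (freeGroup n).
Local Notation V := (abelianization F).
Local Notation L := (freeLie V).
Local Notation AutF := (autom F).
Implicit Types (x y z : F) (a b c : L) (s t : AutF) (d e : derivation L).

Lemma left_coset_lcs N x y : (left_coset x 'G_N = left_coset y 'G_N) <-> x =[N]= y.
Proof.
split=> [E|xy].
  have : left_coset x 'G_N x by exists 1; [apply: lcs1|rewrite mulg1].
  rewrite E => -[z Hz <-]; exact: lcsJ.
apply/seteqP; split=> _ [z Hz <-].
  exists (y^-1 * (x * y^-1) * y * z); last by grp.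
  by apply: lcsM => //; apply: lcsJV.
exists (x^-1 * (x * y^-1)^-1 * x * z); last by grp.
by apply: lcsM => //; apply/lcsJV/lcsV.
Qed.

Lemma andreadakisP k s : andreadakis n k s <-> forall x, s x =[k.+1]= x.
Proof. by split=> As x; apply/left_coset_lcs/As. Qed.

Lemma andreadakis_subgroup k : is_subgroup (andreadakis n k).
Proof.
split=> // s t As At x; have As' := As (t^-1 x); rewrite [LHS]As' -(At (t^-1 x)).
by rewrite -[t (t^-1 x)]/((t * t^-1) x) mulgV.
Qed.
Hint Resolve andreadakis_subgroup : core.

Lemma andreadakis_sub k m : (k <= m)%N -> andreadakis n m `<=` andreadakis n k.
Proof.
move=> km s /andreadakisP As; apply/andreadakisP => x.
exact: lcs_eq_sub (As x).
Qed.

Lemma IA_andreadakis : IA n = andreadakis n 1.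
Proof.
apply/seteqP; split=> [s Hs|s /andreadakisP Hs].
  by apply/andreadakisP => x; apply: (proj1 (abP _ _) (Hs x)).
by move=> x; apply/abP; apply: Hs.
Qed.

(** First order expansion of a commutator: both arguments are perturbed k steps deeper, and the term
    in x' and y' together lies 2k steps deeper. This is the Leibniz rule behind [andreadakis_lcs]
    and [johnson_criterion]. *)
Lemma comm_perturb i j k x x' y y' : (0 < i)%N -> (0 < j)%N -> (0 < k)%N ->
    'G_i x -> 'G_(i + k) x' -> 'G_j y -> 'G_(j + k) y' ->
  comm (x' * x) (y' * y) * (comm x y)^-1 =[(i + j + k).+1]= comm x' y * comm x y'.
Proof.
move=> i0 j0 k0 Hx Hx' Hy Hy'; set N := _.+1.
have Hy'j : 'G_j y' by apply: lcs_anti Hy'; apply: leq_addr.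
have Hx'i : 'G_i x' by apply: lcs_anti Hx'; apply: leq_addr.
have yy : y' * y =[j + k]= y by rewrite /lcs_eq mulgK.
rewrite -[X in _ =[_]= X](mulgK (comm x y)); apply: lcs_eqM (lcs_eqxx _ _).
apply: (@lcs_eq_trans _ _ (comm x' (y' * y) * comm x (y' * y))).
  apply: lcs_eq_sub (lcs_eq_commMl Hx' Hx (lcsM Hy'j Hy)).
  by rewrite /N; clear -i0; lia.
rewrite -[X in _ =[_]= X]mulgA; apply: lcs_eqM.
  apply: lcs_eq_sub (lcs_eq_commr yy Hx'); by rewrite /N; clear -k0; lia.
apply: (@lcs_eq_trans _ _ (comm x y * comm x y')).
  rewrite -comm_inv -[comm x y]comm_inv -[comm x y']comm_inv -invgM; apply: lcs_eqV.
  apply: lcs_eq_sub (lcs_eq_commMl Hy' Hy Hx); by rewrite /N; clear -j0; lia.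
apply: lcs_eq_sub (lcs_eqC (lcs_comm Hx Hy) (lcs_comm Hx Hy')).
by rewrite /N; clear -i0 j0; lia.
Qed.

Lemma aut_quotM s x y :
  s (x * y) * (x * y)^-1 = s x * x^-1 * (x * (s y * y^-1) * x^-1).
Proof. by rewrite automM; grp. Qed.

Lemma aut_quotV s x : s x^-1 * x^-1^-1 = x^-1 * (s x * x^-1)^-1 * x.
Proof. by rewrite (gmorphV (@automM _ s)); grp. Qed.

Lemma andreadakis_lcs k j s x : (0 < k)%N -> (0 < j)%N -> andreadakis n k s ->
  'G_j x -> 'G_(j + k) (s x * x^-1).
Proof.
move=> k0; case: j => // j _ /andreadakisP As; elim: j x => [|j IHj] x Hx;
  first exact: As.
pose K : set F := [set y | 'G_(j.+2 + k) (s y * y^-1)].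
have sK : is_subgroup K.
  split=> [|y z Ky Kz]; rewrite /K /=.
    by rewrite (gmorph1 (@automM _ s)) mulgV; apply: lcs1.
  by rewrite aut_quotM aut_quotV; apply: lcsM => //; apply/lcsJ/lcsJV/lcsV.
rewrite lcsS in Hx; move: x Hx; apply: (subgroup_gen_min sK) => _ [y _ [z Hz <-]].
rewrite /K /= (gmorph_comm (@automM _ s)).
rewrite -[s y](mulgVK y) -[s z](mulgVK z).
have Hy' : 'G_(1 + k) (s y * y^-1) by apply: As.
have := comm_perturb (isT : 0 < 1)%N (isT : 0 < j.+1)%N k0 (I : 'G_1 y)
  Hy' Hz (IHj _ Hz).
move/(lcs_eq_sub (leqnSn _))/lcs_eq_sym/lcs_eq_mem; apply.
apply: lcsM; first by rewrite addnAC; apply: lcs_comm.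
exact: (@lcs_comm _ 1 (j.+1 + k) y _ I (IHj _ Hz)).
Qed.

Lemma gr_classJ j a x y : gr_class j a x -> gr_class j a (y * x * y^-1).
Proof.
move=> gx; apply: (gr_class_eq gx); apply/lcs_eq_sym/lcs_eqJ; exact: gr_class_lcs gx.
Qed.

Lemma gr_classJV j a x y : gr_class j a x -> gr_class j a (y^-1 * x * y).
Proof. by move/(gr_classJ y^-1); rewrite invgK. Qed.

Lemma lie_gen0 : lie_gen 0%R = 0%R :> L.
Proof. by apply: (addrI (lie_gen 0%R)); rewrite -lie_genD !addr0. Qed.

Lemma lie_genN (v : V) : lie_gen (- v)%R = (- lie_gen v)%R :> L.
Proof. by apply/eqP; rewrite -addr_eq0 -lie_genD addNr lie_gen0. Qed.

Local Open Scope ring_scope.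

Lemma johnson_criterion k s d : (0 < k)%N -> andreadakis n k s -> der_deg k d ->
    (forall i, gr_class (1 + k) (d (lie_var i)) (s (free_gen i) * (free_gen i)^-1)%g) ->
  johnson_der k s d.
Proof.
move=> k0 As dd dX; split=> // j a x; elim=> {j a x}.
- elim/free_gen_ind => [|//|x y Hx Hy|x Hx].
  + rewrite ab1 lie_gen0 der0 (gmorph1 (@automM _ s)) mulgV.
    exact/gr_class0/lcs1.
  + rewrite aut_quotM abM lie_genD derD; apply: gr_classD => //.
    exact: gr_classJ.
  + rewrite aut_quotV abV lie_genN derN.
    exact/gr_classJV/gr_classV.
- move=> j x Hx; rewrite der0; apply: gr_class0; rewrite -addSn.
  exact: andreadakis_lcs.
- move=> j a b x y _ Hx _ Hy; rewrite derD derN aut_quotM aut_quotV.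
  by apply: gr_classD => //; apply/gr_classJ/gr_classJV/gr_classV.
- move=> i j a b x y gx Hx gy Hy.
  (* With a factor of degree 0 the bracket is 0, and [gr_class0_lcs] puts [comm x y] one step deeper
     than its index shows. *)
  have [ij0|ij0] := boolP ((0 < i) && (0 < j))%N; last first.
    have ab0 : lie a b = 0.
      move: ij0; rewrite negb_and -!leqNgt !leqn0 => /orP[] /eqP E.
        by rewrite (lie_deg_0 (a := a)) ?lie0l // -E; apply: gr_class_deg gx.
      by rewrite (lie_deg_0 (a := b)) ?lie0r // -E; apply: gr_class_deg gy.
    have := gr_class_lie gx gy; rewrite ab0 => /gr_class0_lcs Hc.
    by rewrite der0; apply: gr_class0; rewrite -addSn; apply: andreadakis_lcs.
  case/andP: ij0 => i0 j0; rewrite der_lie (gmorph_comm (@automM _ s)).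
  rewrite -{1}[s x](mulgVK x) -{1}[s y](mulgVK y).
  have := comm_perturb i0 j0 k0 (gr_class_lcs gx) (gr_class_lcs Hx)
    (gr_class_lcs gy) (gr_class_lcs Hy).
  move/lcs_eq_sym; apply: gr_class_eq; apply: gr_classD.
    by rewrite addnAC; apply: gr_class_lie.
  by rewrite -addnA; apply: gr_class_lie.
Qed.

Lemma der_deg_gen k d : (forall i, lie_deg k.+1 (d (lie_var i))) -> der_deg k d.
Proof.
move=> dX j a; elim=> {j a} [v|j|j a b _ Ha _ Hb|i j a b Da Ha Db Hb].
- have [x ->] := ab_surj v; elim/free_gen_ind: x => [|//|x y Hx Hy|x Hx].
  + by rewrite ab1 lie_gen0 der0; apply: lie_deg0.
  + rewrite abM lie_genD derD -[d (lie_gen (ab y))]opprK; apply: lie_degB => //.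
    by rewrite -sub0r; apply: lie_degB => //; apply: lie_deg0.
  + by rewrite abV lie_genN derN -sub0r; apply: lie_degB => //; apply: lie_deg0.
- by rewrite der0; apply: lie_deg0.
- by rewrite derD derN; apply: lie_degB.
- rewrite der_lie -[lie a (d b)]opprK; apply: lie_degB.
    by rewrite addnAC; apply: lie_deg_lie.
  by rewrite -lieNr -addnA; apply: lie_deg_lie => //; rewrite -sub0r;
    apply: lie_degB => //; apply: lie_deg0.
Qed.

Definition der_var (f : 'I_n -> L) : derivation L := freeLie_der (ab_extD f).

Lemma der_varE f i : der_var f (lie_var i) = f i.
Proof. by rewrite freeLie_der_gen ab_ext_gen. Qed.

Lemma der_var_eq d e : (forall i, d (lie_var i) = e (lie_var i)) -> d = e.
Proof.
move=> de; apply: der_gen_eq.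
have gD (d' : derivation L) : {morph (fun v => d' (lie_gen v)) : v w / v + w}.
  by move=> v w; rewrite lie_genD derD.
exact: (ab_hom_eq (gD d) (gD e)).
Qed.

Lemma johnson_exists k s : (0 < k)%N -> andreadakis n k s -> exists d,
  johnson_der k s d.
Proof.
move=> k0 As; have /choice[f Hf] i : exists a, gr_class (1 + k) a (s (free_gen i)
  * (free_gen i)^-1)%g.
  by apply: lcs_class => //; apply: andreadakis_lcs.
exists (der_var f); apply: johnson_criterion => // [|i]; last by rewrite der_varE.
by apply: der_deg_gen => i; rewrite der_varE; apply: gr_class_deg (Hf i).
Qed.

Lemma johnson_unique k s d e : johnson_der k s d -> johnson_der k s e -> d = e.
Proof.
move=> [_ Hd] [_ He]; apply: der_gen_eq => v; have [x ->] := ab_surj v.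
by apply: gr_class_inj (Hd _ _ _ (gr_class_gen x)) (He _ _ _ (gr_class_gen x))
  (lcs_eqxx _ _).
Qed.

Lemma johnson0 k s : (0 < k)%N -> andreadakis n k.+1 s -> johnson_der k s 0.
Proof.
move=> k0 As; apply: johnson_criterion => // [|j a _|i].
- exact: andreadakis_sub As.
- exact: lie_deg0.
- by apply: gr_class0; rewrite -addnS; apply: andreadakis_lcs.
Qed.

Lemma johnson0_andreadakis k s : johnson_der k s 0 -> andreadakis n k.+1 s.
Proof.
move=> [_ Hs]; apply/andreadakisP => x.
exact: gr_class0_lcs (Hs _ _ _ (gr_class_gen x)).
Qed.

Lemma der_degB k d e : der_deg k d -> der_deg k e -> der_deg k (d - e).
Proof. by move=> Hd He j a Ha; apply: lie_degB; [apply: Hd|apply: He]. Qed.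

Lemma der_deg0 k : der_deg k (0 : derivation L).
Proof. by move=> j a _; apply: lie_deg0. Qed.

Lemma der_degD k d e : der_deg k d -> der_deg k e -> der_deg k (d + e).
Proof.
move=> Hd He; rewrite -[e]opprK; apply: der_degB => //.
by rewrite -sub0r; apply: der_degB => //; apply: der_deg0.
Qed.

Lemma der_deg_lie i j d e : der_deg i d -> der_deg j e -> der_deg (i + j) (lie d e).
Proof.
move=> Hd He m a Ha; apply: lie_degB.
  by rewrite addnA addnAC; apply: Hd; apply: He.
by rewrite addnA; apply: He; apply: Hd.
Qed.

Lemma johnsonD k s t d e : (0 < k)%N -> andreadakis n k t ->
  johnson_der k s d -> johnson_der k t e -> johnson_der k (s * t)%g (d + e).
Proof.
move=> k0 At [dd Hd] [de He]; split; first exact: der_degD.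
move=> j a x gx; have gt := He _ _ _ gx.
have gtx : gr_class j a (t x).
  apply: gr_class_eq gx _; apply: lcs_eq_sym; apply: lcs_anti (gr_class_lcs gt).
  by rewrite -addn1 leq_add2l.
have := gr_classD (Hd _ _ _ gtx) gt; congr (gr_class _ _ _); by grp.
Qed.

Lemma johnsonV k s d : (0 < k)%N -> andreadakis n k s -> johnson_der k s d ->
  johnson_der k s^-1%g (- d).
Proof.
move=> k0 As Hd; have AsV := subgroupV (andreadakis_subgroup k) As.
have [e He] := johnson_exists k0 AsV.
have := johnsonD k0 AsV Hd He; rewrite mulgV => H1.
have H0 : johnson_der k 1%g (0 : derivation L).
  by apply: johnson0 => //; exact: (subgroup1 (andreadakis_subgroup _)).
by have /eqP := johnson_unique H1 H0; rewrite addr_eq0 => /eqP ->; rewrite opprK.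
Qed.

(** Evaluation at [t (s x)] instead of x removes the inverses: the commutator takes the value
    [s (t x)] there. The outer factors have the shape of the bracket of two derivations, and
    [comm h g] is deeper. *)
Lemma comm_quot s t x : let g := (s x * x^-1)%g in let h := (t x * x^-1)%g in
  (comm s t (t (s x)) * (t (s x))^-1 =
   s h * h^-1 * comm h g * (t g * g^-1)^-1)%g.
Proof.
move=> g h; have -> : comm s t (t (s x)) = s (t x).
  rewrite -[t (s x)]/((t * s) x)%g -[comm s t _]/((comm s t * (t * s)) x)%g.
  by rewrite (_ : comm s t * (t * s) = s * t)%g //; grp.
have Es : s x = (g * x)%g by rewrite /g mulgVK.
have Et : t x = (h * x)%g by rewrite /h mulgVK.
rewrite [in s (t x)]Et [in t (s x)]Es (@automM _ s h x) (@automM _ t g x) Es Et.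
move: (s h) (t g) => sh tg; clear Es Et; clearbody g h; by grp.
Qed.

Lemma andreadakis_comm i j s t : (0 < i)%N -> (0 < j)%N -> andreadakis n i s ->
  andreadakis n j t ->
  andreadakis n (i + j) (comm s t).
Proof.
move=> i0 j0 As At; apply/andreadakisP => y.
pose x := (s^-1 * t^-1)%g y; have -> : y = t (s x).
  rewrite /x -[RHS]/((t * s * (s^-1 * t^-1)) y)%g.
  by rewrite (_ : t * s * (s^-1 * t^-1) = 1)%g //; grp.
rewrite /lcs_eq comm_quot; set g := (s x * _)%g; set h := (t x * _)%g.
have Hg : 'G_(1 + i) g by apply: andreadakis_lcs.
have Hh : 'G_(1 + j) h by apply: andreadakis_lcs.
apply: lcsM; first apply: lcsM.
- by rewrite (_ : (i + j).+1 = (1 + j + i)%N); [apply: andreadakis_lcs | clear; lia].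
- by apply: lcs_anti (lcs_comm Hh Hg); clear; lia.
- by apply: lcsV; rewrite -addSn; apply: andreadakis_lcs.
Qed.

Lemma johnson_comm i j s t d e : (0 < i)%N -> (0 < j)%N ->
    andreadakis n i s -> andreadakis n j t ->
  johnson_der i s d -> johnson_der j t e -> johnson_der (i + j) (comm s t) (lie d e).
Proof.
move=> i0 j0 As At [dd Hd] [de He].
apply: johnson_criterion; rewrite ?addn_gt0 ?i0 //.
- exact: andreadakis_comm.
- exact: der_deg_lie.
move=> k; pose x := (s^-1 * t^-1)%g (free_gen k).
have Ex : free_gen k = t (s x).
  rewrite /x -[RHS]/((t * s * (s^-1 * t^-1)) (free_gen k))%g.
  by rewrite (_ : t * s * (s^-1 * t^-1) = 1)%g //; grp.
(* s and t act trivially on the abelianization, so x has the same class as the generator. *)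
have -> : lie_var k = lie_gen (ab x).
  congr lie_gen; apply/esym/abP.
  have: andreadakis n 1 (s^-1 * t^-1)%g.
    by apply: (subgroupM (andreadakis_subgroup 1));
      apply: (subgroupV (andreadakis_subgroup 1));
      [apply: andreadakis_sub As|apply: andreadakis_sub At].
  by move/andreadakisP; apply.
rewrite Ex comm_quot; set a := lie_gen _; set g := (s x * _)%g; set h := (t x * _)%g.
have Hg : gr_class (1 + i) (d a) g by apply: Hd; apply: gr_class_gen.
have Hh : gr_class (1 + j) (e a) h by apply: He; apply: gr_class_gen.
rewrite -[lie d e a]/(d (e a) - e (d a)); apply: gr_classD; last first.
  by apply: gr_classV; rewrite addnA; apply: He.
rewrite -[d (e a)]addr0; apply: gr_classD.
  by rewrite (addnC i) addnA; apply: Hd.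
apply: gr_class0; apply: lcs_anti (lcs_comm (gr_class_lcs Hh) (gr_class_lcs Hg)).
by clear; lia.
Qed.

(* The degree k part of the Lie ring generated in degree 1: right-normed brackets
   suffice, by the Jacobi identity. *)
Inductive igen : nat -> derivation L -> Prop :=
| igen1 d : der_deg 1 d -> igen 1 d
| igen0 k : igen k 0
| igenB k d e : igen k d -> igen k e -> igen k (d - e)
| igenL k d e : der_deg 1 d -> igen k.+1 e -> igen k.+2 (lie d e).

Lemma igenN k d : igen k d -> igen k (- d).
Proof. by move=> Hd; rewrite -sub0r; apply: igenB => //; apply: igen0. Qed.

Lemma igenD k d e : igen k d -> igen k e -> igen k (d + e).
Proof. by move=> Hd He; rewrite -[e]opprK; apply: igenB => //; apply: igenN. Qed.

Lemma igen_deg k d : igen k d -> der_deg k d.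
Proof.
elim=> {k d} [d //|k|k d e _ Hd _ He|k d e Hd _ He].
- exact: der_deg0.
- exact: der_degB.
- by rewrite -add1n; apply: der_deg_lie.
Qed.

Lemma igen_lie i j d e : igen i.+1 d -> igen j.+1 e -> igen (i.+1 + j.+1) (lie d e).
Proof.
move Ei: i.+1 => i' Hd; elim: Hd i j e Ei => {i' d}.
- by move=> d Hd i j e _ He; apply: igenL.
- by move=> k i j e _ _; rewrite lie0l; apply: igen0.
- move=> k d d' _ IHd _ IHd' i j e Ei He; rewrite lieDl lieNl.
  by apply: igenB; [apply: IHd Ei He | apply: IHd' Ei He].
move=> k d d' Hd Hd' IHd' i j e _ He; rewrite lie_jacobil; apply: igenD.
  rewrite lie_anti addSnnS; apply: igenN.
  exact: (IHd' k j.+1 (lie d e) erefl (igenL Hd He)).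
by rewrite addSn; apply: igenL Hd _; apply: (IHd' k).
Qed.

Lemma IA_subgroup : is_subgroup (IA n).
Proof. by rewrite IA_andreadakis. Qed.

Lemma lcs_IA_johnson k s : (0 < k)%N -> lcs (IA n) k s ->
  andreadakis n k s /\ exists2 d, igen k d & johnson_der k s d.
Proof.
case: k => // k _; elim: k s => [|k IHk] s.
  rewrite /lcs /= IA_andreadakis => As; split=> //.
  have [d Hd] := johnson_exists (isT : 0 < 1)%N As; exists d => //.
  by apply: igen1; case: Hd.
pose K : set AutF := [set s | andreadakis n k.+2 s /\ exists2 d, igen k.+2 d &
  johnson_der k.+2 s d].
have sK : is_subgroup K.
  split=> [|t u [At [d Id Hd]] [Au [e Ie He]]].
    split; first exact: (subgroup1 (andreadakis_subgroup _)).
    exists 0; first exact: igen0.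
    by apply: johnson0 => //; exact: (subgroup1 (andreadakis_subgroup _)).
  have AuV := subgroupV (andreadakis_subgroup _) Au.
  split; first exact: (subgroupM (andreadakis_subgroup _)).
  exists (d - e); first exact: igenB.
  by apply: johnsonD => //; apply: johnsonV.
rewrite lcsS; move: s; apply: (subgroup_gen_min sK) => _ [t Ht [u Hu <-]].
have [Au [e Ie He]] := IHk _ Hu; rewrite IA_andreadakis in Ht.
have [d Hd] := johnson_exists (isT : 0 < 1)%N Ht.
split; first by rewrite -add1n; apply: andreadakis_comm.
exists (lie d e); first by apply: igenL => //; case: Hd.
by rewrite -add1n; apply: johnson_comm.
Qed.

(** * Right-normed brackets and realization in degree 1 *)

Definition adw (u : seq 'I_n) (a : L) : L := foldr (fun i b => lie (lie_var i) b) a u.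

(** P restricts the acting letters and Q the innermost one: the reduction of derivations has to know
    that a given letter occurs once, in last place. *)
Inductive rspan (P Q : pred 'I_n) (m : nat) : L -> Prop :=
| rspan0 : rspan P Q m 0
| rspanB a b : rspan P Q m a -> rspan P Q m b -> rspan P Q m (a - b)
| rspanW u i : size u = m -> all P u -> Q i -> rspan P Q m (adw u (lie_var i)).

Lemma rspanN P Q m a : rspan P Q m a -> rspan P Q m (- a).
Proof. by move=> Ha; rewrite -sub0r; apply: rspanB => //; apply: rspan0. Qed.

Lemma rspanD P Q m a b : rspan P Q m a -> rspan P Q m b -> rspan P Q m (a + b).
Proof. by move=> Ha Hb; rewrite -[b]opprK; apply: rspanB => //; apply: rspanN. Qed.

Lemma rspan_var (P Q : pred 'I_n) m i a :
  P i -> rspan P Q m a -> rspan P Q m.+1 (lie (lie_var i) a).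
Proof.
move=> Pi; elim=> {a} [|a b _ Ha _ Hb|u j su Pu Pj].
- by rewrite lie0r; apply: rspan0.
- by rewrite lieDr lieNr; apply: rspanB.
- by apply: (rspanW (u := i :: u)) => //=; [rewrite su | rewrite Pi].
Qed.

(** By the Jacobi identity the letters of a come to act on b one at a time, so the innermost letter
    is that of b. The innermost letter of a becomes an acting letter, whence the inclusion of Q in
    P. *)
Lemma rspan_lie (P Q Q' : pred 'I_n) m k a b : (forall i, Q i -> P i) ->
  rspan P Q m a -> rspan P Q' k b -> rspan P Q' (m + k).+1 (lie a b).
Proof.
move=> QP Ha; elim: Ha k b => {a} [|a a' _ Ha _ Ha'|u j su Pu /QP Pj] k b Hb.
- by rewrite lie0l; apply: rspan0.
- by rewrite lieDl lieNl; apply: rspanB; [apply: Ha|apply: Ha'].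
elim: u m su Pu k b Hb => [|i u IHu] m /= su Pu k b Hb.
  by rewrite -su; apply: rspan_var.
case/andP: Pu => Pi Pu; case: m su => // m [su]; rewrite addSn.
rewrite lie_jacobil [lie (lie _ b) _]lie_anti addrC; apply: rspanB.
  by apply: rspan_var => //; apply: IHu.
by rewrite -addnS; apply: IHu => //; apply: rspan_var.
Qed.

Lemma rspan_deg P Q m a : rspan P Q m a -> lie_deg m.+1 a.
Proof.
elim=> {a} [|a b _ Ha _ Hb|u j <- _ _]; first exact: lie_deg0.
  exact: lie_degB.
elim: u => [|i u IHu]; first exact: lie_deg_gen.
by rewrite -add1n; apply: lie_deg_lie => //; apply: lie_deg_gen.
Qed.

Lemma deg_rspan m a :
  lie_deg m a -> if m is m'.+1 then rspan predT predT m' a else a = 0.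
Proof.
elim=> {m a} [v|[|m]|[|m] a b _ Ha _ Hb|i j a b _ Ha _ Hb].
- have [x ->] := ab_surj v; elim/free_gen_ind: x => [|i|x y Hx Hy|x Hx].
  + by rewrite ab1 lie_gen0; apply: rspan0.
  + exact: (rspanW (u := [::])).
  + by rewrite abM lie_genD; apply: rspanD.
  + by rewrite abV lie_genN; apply: rspanN.
- by [].
- exact: rspan0.
- by rewrite Ha Hb subrr.
- exact: rspanB.
- case: i j Ha Hb => [|i] [|j] Ha Hb /=.
  + by rewrite Ha lie0l.
  + by rewrite Ha lie0l; apply: rspan0.
  + by rewrite Hb lie0r; apply: rspan0.
  + by rewrite addnS; apply: rspan_lie Ha Hb.
Qed.

Definition der1 (i : 'I_n) (a : L) : derivation L := der_var (fun j => if j == i then a else 0).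

Lemma der1E i a j : der1 i a (lie_var j) = if j == i then a else 0.
Proof. exact: der_varE. Qed.

Lemma der1B i a b : der1 i (a - b) = der1 i a - der1 i b.
Proof.
apply: der_var_eq => j; rewrite -[RHS]/(der1 i a (lie_var j) - der1 i b (lie_var j)).
by rewrite !der1E; case: eqP => // _; rewrite subrr.
Qed.

Lemma der1_0 i : der1 i 0 = 0.
Proof. by rewrite -[X in der1 i X](subrr 0) der1B subrr. Qed.

Lemma der1N i a : der1 i (- a) = - der1 i a.
Proof. by rewrite -sub0r der1B der1_0 sub0r. Qed.

Lemma der_sumE (I : Type) (r : seq I) (P : pred I) (f : I -> derivation L) a :
  (\sum_(k <- r | P k) f k) a = \sum_(k <- r | P k) f k a.
Proof. exact: (big_morph (fun d : derivation L => d a) (fun _ _ => erefl) erefl). Qed.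

Lemma der1_sum d : d = \sum_i der1 i (d (lie_var i)).
Proof.
apply: der_var_eq => j; rewrite der_sumE (bigD1 j) // der1E eqxx big1 => [|i ij].
  by rewrite /= addr0.
by rewrite der1E eq_sym (negbTE ij).
Qed.

Lemma der1_deg k i a : lie_deg k.+1 a -> der_deg k (der1 i a).
Proof.
move=> Ha; apply: der_deg_gen => j; rewrite der1E.
by case: eqP => // _; apply: lie_deg0.
Qed.

(** The hypothesis says that p and q do not involve the generator i: they are fixed by every
    substitution that fixes the others. The inverse then multiplies by [p^-1] and [q^-1]. *)
Lemma transvection_aut i (p q : F) :
    (forall f, (forall j, j != i -> f j = free_gen j) -> free_ext f p =
      p /\ free_ext f q = q) ->
  exists s : AutF, forall j, s (free_gen j)
    = (if j == i then p * free_gen j * q else free_gen j)%g.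
Proof.
move=> pq; apply: (@free_aut_ex n
  (fun j => if j == i then p * free_gen j * q else free_gen j)%g
  (fun j => if j == i then p^-1 * free_gen j * q^-1 else free_gen j)%g) => j.
  set g := fun j => _; have [gp gq] : free_ext g p = p /\ free_ext g q = q.
    by apply: pq => k /negbTE ki; rewrite /g ki.
  case: eqP => [->|/eqP/negbTE ji]; last by rewrite free_ext_gen /g ji.
  by rewrite !free_extM gp gq free_ext_gen /g eqxx; grp.
set g := fun j => _; have [gp gq] : free_ext g p = p /\ free_ext g q = q.
  by apply: pq => k /negbTE ki; rewrite /g ki.
case: eqP => [->|/eqP/negbTE ji]; last by rewrite free_ext_gen /g ji.
by rewrite !free_extM !(gmorphV (free_extM g)) gp gq free_ext_gen /g eqxx; grp.
Qed.

Definition realized d := exists2 s, andreadakis n 1 s & johnson_der 1 s d.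

Lemma realizedB d e : realized d -> realized e -> realized (d - e).
Proof.
move=> [s As Hs] [t At Ht]; have AtV := subgroupV (andreadakis_subgroup _) At.
exists (s * t^-1)%g; first exact: (subgroupM (andreadakis_subgroup _)).
by apply: johnsonD => //; apply: johnsonV.
Qed.

Lemma realized0 : realized 0.
Proof.
have A1 := subgroup1 (andreadakis_subgroup 2).
by exists 1%g; [exact: (subgroup1 (andreadakis_subgroup _))|apply: johnson0].
Qed.

Lemma realized_sum (I : Type) (r : seq I) (f : I -> derivation L) :
  (forall i, realized (f i)) -> realized (\sum_(i <- r) f i).
Proof.
move=> Hf; elim: r => [|i r IHr]; first by rewrite big_nil; apply: realized0.
rewrite big_cons -[\sum_(_ <- _) _]opprK; apply: realizedB => //.
by rewrite -sub0r; apply: realizedB => //; apply: realized0.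
Qed.

Lemma realized_aut i a y (s : AutF) : gr_class 2 a y ->
    (forall j, s (free_gen j) = (if j == i then y * free_gen j else free_gen j)%g) ->
  realized (der1 i a).
Proof.
move=> gy Hs; have As : andreadakis n 1 s.
  apply/andreadakisP => x; rewrite /lcs_eq.
  elim/free_gen_ind: x => [|j|x z Hx Hz|x Hx].
  - by rewrite (gmorph1 (@automM _ s)) mulgV; apply: lcs1.
  - rewrite Hs; case: eqP => _; rewrite ?mulgK ?mulgV; last exact: lcs1.
    exact: gr_class_lcs gy.
  - by rewrite aut_quotM; apply: lcsM => //; apply: lcsJ.
  - by rewrite aut_quotV; apply/lcsJV/lcsV.
exists s => //; apply: johnson_criterion => // [|j].
  by apply: der1_deg; apply: gr_class_deg gy.
rewrite Hs der1E; case: eqP => _; rewrite ?mulgK ?mulgV //.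
exact/gr_class0/lcs1.
Qed.

(** The automorphisms are Magnus's generators of [IA n]: conjugation of one generator by another,
    and multiplication of one by a commutator of generators different from it. *)
Lemma realized_var i j k : realized (der1 i (lie (lie_var j) (lie_var k))).
Proof.
have gjk (l m : 'I_n) : gr_class 2 (lie (lie_var l) (lie_var m)) (comm (free_gen l)
  (free_gen m)).
  by rewrite -[2%N]addn1; apply: gr_class_lie; apply: gr_class_gen.
have conj_case l : l != i -> realized (der1 i (lie (lie_var l) (lie_var i))).
  move=> li; have [s Hs] : exists s : AutF, forall j, s (free_gen j) =
      (if j == i then free_gen l * free_gen j * (free_gen l)^-1 else free_gen j)%g.
    by apply: transvection_aut => f Hf;
      rewrite (gmorphV (free_extM f)) !free_ext_gen Hf.
  apply: (realized_aut (gjk l i) (s := s)) => m; rewrite Hs; case: eqP => // ->.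
  by grp.
have [->|ji] := eqVneq j i; have [->|ki] := eqVneq k i.
- by rewrite liexx der1_0; apply: realized0.
- rewrite lie_anti der1N -sub0r; apply: realizedB; [exact: realized0|exact: conj_case].
- exact: conj_case.
have [s Hs] : exists s : AutF, forall m, s (free_gen m) =
      (if m == i then comm (free_gen j) (free_gen k)
        * free_gen m * 1 else free_gen m)%g.
  apply: transvection_aut => f Hf; rewrite (gmorph1 (free_extM f)).
  by rewrite (gmorph_comm (free_extM f)) !free_ext_gen !Hf.
by apply: (realized_aut (gjk j k) (s := s)) => m; rewrite Hs mulg1.
Qed.

Lemma der_deg1_realized d : der_deg 1 d -> realized d.
Proof.
move=> dd; rewrite [d]der1_sum; apply: realized_sum => i.
have := deg_rspan (dd _ _ (lie_deg_gen (ab (free_gen i)))).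
elim=> [|a b _ Ha _ Hb|[|j [|//]] k //= _ _ _].
- by rewrite der1_0; apply: realized0.
- by rewrite der1B; apply: realizedB.
- exact: realized_var.
Qed.

Lemma igen_realized k d : (0 < k)%N -> igen k d ->
  exists2 s, lcs (IA n) k s & johnson_der k s d.
Proof.
move=> + Hd; elim: Hd => {k d} [d Hd _|k k0|k d e _ IHd _ IHe k0|k d e Hd _ IHe _].
- by have [s As Hs] := der_deg1_realized Hd; exists s;
  rewrite // /lcs /= IA_andreadakis.
- exists 1%g; first exact: (subgroup1 (lcs_subgroup _ IA_subgroup)).
  by apply: johnson0 => //; exact: (subgroup1 (andreadakis_subgroup _)).
- have [s Ls Hs] := IHd k0; have [t Lt Ht] := IHe k0.
  have sI := lcs_subgroup k IA_subgroup; have LtV := subgroupV sI Lt.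
  have [AtV _] := lcs_IA_johnson k0 LtV; have [At _] := lcs_IA_johnson k0 Lt.
  exists (s * t^-1)%g; first exact: (subgroupM sI).
  by apply: johnsonD => //; apply: johnsonV.
have [s As Hs] := der_deg1_realized Hd; have [t Lt Ht] := IHe isT.
have [At _] := lcs_IA_johnson (isT : 0 < k.+1)%N Lt.
exists (comm s t); last by rewrite -add1n; apply: johnson_comm.
by apply: mem_comm => //; rewrite IA_andreadakis.
Qed.

End Johnson.

(** * Derivations modulo the subring generated in degree 1 *)

Section Reduction.
Variable n : nat.
Local Notation F := (freeGroup n).
Local Notation V := (abelianization F).
Local Notation L := (freeLie V).
Local Open Scope ring_scope.
Implicit Types (a b : L) (d e f : derivation L) (i j m c : 'I_n) (u v w : seq 'I_n).

Local Notation "d ~[ k ] e" := (igen k (d - e)) (at level 70).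

Lemma igen_eq_sym k d e : d ~[k] e -> e ~[k] d.
Proof. by move/igenN; rewrite opprB. Qed.

Lemma igen_eq_trans k d e f : d ~[k] e -> e ~[k] f -> d ~[k] f.
Proof. by move=> de ef; have := igenD de ef; rewrite addrA subrK. Qed.

Lemma der1_var_neq i j a : j != i -> der1 i a (lie_var j) = 0.
Proof. by move=> ji; rewrite der1E (negbTE ji). Qed.

Lemma der1_var i a : der1 i a (lie_var i) = a.
Proof. by rewrite der1E eqxx. Qed.

Lemma der1_adw i a u b : i \notin u -> der1 i a (adw u b) = adw u (der1 i a b).
Proof.
elim: u => //= j u IHu; rewrite inE negb_or => /andP[ij iu].
by rewrite der_lie der1_var_neq 1?eq_sym // lie0l add0r IHu.
Qed.

Lemma der1_adw0 i a u j : i \notin u -> j != i -> der1 i a (adw u (lie_var j)) = 0.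
Proof.
move=> iu ji; rewrite der1_adw // der1_var_neq //.
by elim: u {iu} => //= c u ->; rewrite lie0r.
Qed.

Lemma adw_rcons u i a : adw (rcons u i) a = adw u (lie (lie_var i) a).
Proof. by rewrite /adw -cats1 foldr_cat. Qed.

Lemma lie_derE d e a : lie d e a = d (e a) - e (d a). Proof. by []. Qed.

Lemma der_subE d e a : (d - e) a = d a - e a. Proof. by []. Qed.

Lemma adw_deg u i : lie_deg (size u).+1 (adw u (lie_var i)).
Proof. exact: (@rspan_deg n predT predT _ _ (rspanW erefl (all_predT u) (isT :
  predT i))). Qed.

Lemma igen_lie_deg1 k d e : igen k.+1 d -> der_deg 1 e -> igen k.+2 (lie d e).
Proof. by move=> Hd He; rewrite lie_anti; apply/igenN/igenL. Qed.

(** Peel off the first letter c: if D sends X_i to the shorter bracket and E sends X_i to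
    [X_c, X_i], then [D, E] is the derivation sought, because E kills a bracket without X_i. *)
Lemma igen_der1_free i j u : (0 < size u)%N -> i \notin u -> j != i ->
  igen (size u) (der1 i (adw u (lie_var j))).
Proof.
elim: u => //= c [|b u] IHu _ iu ji.
  by apply: igen1; apply: der1_deg; apply: (adw_deg [:: c]).
move: iu; rewrite inE negb_or => /andP[ic iu].
have -> : der1 i (lie (lie_var c) (adw (b :: u) (lie_var j))) =
    lie (der1 i (adw (b :: u) (lie_var j))) (der1 i (lie (lie_var c) (lie_var i))).
  apply: der_var_eq => m; rewrite lie_derE; have [->|mi] := eqVneq m i.
    rewrite !der1_var der_lie der1_var der1_var_neq 1?eq_sym // lie0l add0r.
    by rewrite der1_adw0 // subr0.
  by rewrite !der1_var_neq // !der0 subrr.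
apply: igen_lie_deg1; first exact: IHu.
by apply: der1_deg; apply: (adw_deg [:: c]).
Qed.

(** The difference is the bracket of X_m |-> ad(u) X_i, in the subring because m is absent from its
    value, with X_i |-> [X_c, X_m]. As i may occur in u, this transfers any bracket ending in X_i to
    the new letter m. *)
Lemma igen_der1_swap i m c u : (0 < size u)%N -> m \notin c :: u -> m != i ->
  der1 i (adw (c :: u) (lie_var i)) ~[(size u).+1]
  der1 m (der1 i (lie (lie_var c) (lie_var m)) (adw u (lie_var i))).
Proof.
move=> u0; rewrite inE negb_or => /andP[mc mu] mi; have im : i != m by rewrite eq_sym.
have -> : der1 i (adw (c :: u) (lie_var i)) -
     der1 m (der1 i (lie (lie_var c) (lie_var m)) (adw u (lie_var i))) =
   lie (der1 m (adw u (lie_var i))) (der1 i (lie (lie_var c) (lie_var m))).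
  apply: der_var_eq => j; rewrite lie_derE der_subE; have [->|ji] := eqVneq j i.
    rewrite !der1_var !(der1_var_neq _ im) der0 !subr0 der_lie der1_var.
    by rewrite der1_var_neq 1?eq_sym // lie0l add0r.
  rewrite !(der1_var_neq _ ji) der0 !sub0r.
  have [->|jm] := eqVneq j m; first by rewrite !der1_var.
  by rewrite !(der1_var_neq _ jm) der0.
case: u u0 {mu} (igen_der1_free (u := u) u0 mu im) => // b u _ H.
apply: igen_lie_deg1 => //.
by apply: der1_deg; apply: (adw_deg [:: c]).
Qed.

(** The case of [igen_der1_swap] where i is absent: the substitution touches only the innermost
    letter, and the head of the word passes to its tail. *)
Lemma igen_der1_rot i m u : (1 < size u)%N -> i \notin u -> m \notin u -> m != i ->
  der1 i (adw u (lie_var i)) ~[size u] der1 m (adw (rot 1 u) (lie_var m)).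
Proof.
case: u => // c u u0; rewrite inE negb_or => /andP[ic iu] mu mi.
have := igen_der1_swap u0 mu mi; rewrite der1_adw // der1_var.
by rewrite rot1_cons adw_rcons.
Qed.

Lemma igen_der1_rot1 i m u : (1 < size u)%N -> i \notin u -> m \notin u -> m != i ->
  der1 i (adw u (lie_var i)) ~[size u] der1 i (adw (rot 1 u) (lie_var i)).
Proof.
(* The derivation d1 below lies in igen, although its first term alone does not; its
   bracket with X_i |-> [X_b, X_i] is the wanted difference. *)
case: u => // b u u0; rewrite !inE !negb_or => /andP[ib iu] /andP[mb mu] mi.
have im : i != m by rewrite eq_sym.
pose d1 := der1 i (adw u (lie_var i)) - der1 m (adw (rot 1 u) (lie_var m)).
have d1I : igen (size u) d1.
  case: u u0 iu mu @d1 => // c [|c' u] u0 iu mu; last exact: igen_der1_rot.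
  by apply: igenB; apply: igen1; apply: der1_deg; apply: (adw_deg [:: c]).
have d1E a : d1 a = der1 i (adw u (lie_var i)) a - der1 m (adw (rot 1 u) (lie_var m)) a.
  exact: der_subE.
clearbody d1; have -> : der1 i (adw (b :: u) (lie_var i)) -
    der1 i (adw (rot 1 (b :: u)) (lie_var i)) =
    lie d1 (der1 i (lie (lie_var b) (lie_var i))).
  apply: der_var_eq => j; rewrite lie_derE der_subE !d1E rot1_cons adw_rcons.
  have [->|ji] := eqVneq j i.
    rewrite !der1_var !(der1_var_neq _ im) subr0 !der_lie.
    rewrite !(der1_var_neq (j := b)) 1?eq_sym // !der1_var !(der1_var_neq _ im).
    by rewrite !lie0l lie0r !add0r subr0 der1_adw // der1_var.
  rewrite !(der1_var_neq _ ji) !der0 !sub0r.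
  have [->|jm] := eqVneq j m; last by rewrite !(der1_var_neq _ jm) oppr0 der0 subr0.
  by rewrite der1_var derN der1_adw0 ?mem_rot // !oppr0 addr0.
rewrite [size (b :: u)]/= in u0 *; case: (size u) u0 d1I => // k _ d1I;
  apply: igen_lie_deg1 => //.
by apply: der1_deg; apply: (adw_deg [:: b]).
Qed.

(** Each term of the Leibniz expansion replaces one X_i by [X_c, X_m], so it contains m exactly
    once; flipping a bracket where necessary brings this m to the innermost place. *)
Lemma der1_rspan m i c u : m != c -> m != i -> m \notin u ->
  rspan (predC1 m) (pred1 m) (size u).+1
    (der1 i (lie (lie_var c) (lie_var m)) (adw u (lie_var i))).
Proof.
move=> mc mi; elim: u => [_|b u IHu] /=.
  by rewrite der1_var; apply: (rspanW (u := [:: c])) => //=; rewrite eq_sym mc.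
rewrite inE negb_or => /andP[mb mu]; rewrite der_lie; apply: rspanD; last first.
  by apply: rspan_var (IHu mu); rewrite /= eq_sym.
have [->|bi] := eqVneq b i; last by rewrite der1_var_neq // lie0l; apply: rspan0.
rewrite der1_var lie_anti -[(size u).+1]addn1; apply: rspanN.
apply: (@rspan_lie _ _ (predC1 m)) => //.
  apply: rspanW => //=; last by rewrite eq_sym.
  by apply/allP => j ju /=; apply: contraNneq mu => <-.
by apply: (rspanW (u := [:: c])) => //=; rewrite eq_sym mc.
Qed.

Lemma adw_mem_rspan i u j : (i \in u) || (j == i) ->
  rspan predT (pred1 i) (size u) (adw u (lie_var j)).
Proof.
have [-> _|ji] := eqVneq j i; first by apply: rspanW; rewrite //= ?all_predT.
rewrite orbF; elim: u => //= c u IHu; rewrite inE.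
have [iu _|iu] := boolP (i \in u); first by apply: rspan_var => //; apply: IHu.
rewrite orbF => /eqP <-; rewrite lie_anti -[size u]addn0; apply: rspanN.
apply: (@rspan_lie _ _ predT) => //; first by apply: rspanW; rewrite ?all_predT.
exact: (@rspanW n predT (pred1 i) 0 [::] i erefl isT (eqxx i)).
Qed.

Section FixedDegree.
Variable k : nat.
Hypotheses (k1 : (1 < k)%N) (kn : (k + 2 <= n)%N).
Implicit Types (t : k.-tuple 'I_n).

Lemma fresh_letter (u : seq 'I_n) : (size u < n)%N -> exists i, i \notin u.
Proof.
move=> un; apply/existsP; apply: contraLR un => /existsPn un; rewrite -leqNgt.
apply: leq_trans (card_size u);
apply: (@leq_trans #|'I_n|); first by rewrite card_ord.
by apply/subset_leq_card/fintype.subsetP => i _; have := un i; rewrite negbK.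
Qed.

Definition fresh (u : seq 'I_n) : 'I_n :=
  if pselect (exists i, i \notin u) is left h then projT1 (cid h)
  else Ordinal (leq_trans (ltn_addl k (isT : 0 < 2)%N) kn).

Lemma freshP t : fresh t \notin t.
Proof.
rewrite /fresh; case: pselect => [h|[]]; first by case: (cid h).
by apply: fresh_letter; rewrite size_tuple; clear -kn; lia.
Qed.

Definition rot_tuple t : k.-tuple 'I_n := [tuple of rot 1 t].

Lemma rot_tuple_inj : injective rot_tuple.
Proof. by move=> t t' /(congr1 val) /= /rot_inj /val_inj. Qed.

(** One representative in each orbit of rotation, so that the fixed points of [necklace] index the
    cyclic words of length k. *)
Definition necklace t := froot rot_tuple t.

Definition necklace_der t := der1 (fresh t) (adw t (lie_var (fresh t))).

Lemma igen_necklace i t : i \notin t ->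
  der1 i (adw t (lie_var i)) ~[k] necklace_der (necklace t).
Proof.
have st t' : size t' = k by rewrite size_tuple.
have step j t' : j \notin t' ->
    der1 j (adw t' (lie_var j)) ~[k] der1 j (adw (rot_tuple t') (lie_var j)).
  (* Here [k + 2 <= n] matters: m must lie outside t' and differ from j. *)
  move=> jt; have [m] := @fresh_letter (j :: t') ltac:(rewrite /= st; clear -kn; lia).
  rewrite inE negb_or => /andP[mj mt].
  by have := @igen_der1_rot1 j m t'; rewrite st; apply.
have steps j t' r : j \notin t' ->
    der1 j (adw t' (lie_var j)) ~[k] der1 j (adw (iter r rot_tuple t') (lie_var j)).
  move=> jt; elim: r => [|r IHr]; first by rewrite subrr; apply: igen0.
  apply: igen_eq_trans IHr _; apply: step.
  by elim: r => //= r IHr; rewrite mem_rot.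
move=> it; apply: (igen_eq_trans (steps i t (findex rot_tuple t (necklace t)) it)).
rewrite iter_findex ?connect_root //; set t' := necklace t.
have it' : i \notin t'.
  rewrite /t' /necklace -(iter_findex (connect_root (frel rot_tuple) t)).
  by elim: (findex _ _ _) => //= r IHr; rewrite mem_rot.
rewrite /necklace_der; have [->|ji] := eqVneq (fresh t') i.
  by rewrite subrr; apply: igen0.
(* Passing from i to the fresh letter rotates the word once; [step] rotates it back. *)
apply: (igen_eq_trans _ (igen_eq_sym (step _ _ (freshP t')))).
by have := @igen_der1_rot i (fresh t') t'; rewrite st; apply => //; apply: freshP.
Qed.

Definition necklace_span d := exists z : k.-tuple 'I_n -> int,
  d ~[k] \sum_(t | necklace t == t) necklace_der t *~ z t.

Lemma necklace_spanB d e : necklace_span d -> necklace_span e -> necklace_span (d - e).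
Proof.
move=> [z Hz] [z' Hz']; exists (fun t => z t - z' t).
have := igenB Hz Hz'; congr igen.
rewrite [in RHS](eq_bigr (fun t => necklace_der t *~ z t - necklace_der t *~ z' t))
  => [|t _].
  by rewrite sumrB; zmod.
exact: mulrzBr.
Qed.

Lemma necklace_span_igen d : igen k d -> necklace_span d.
Proof. by move=> Hd; exists (fun=> 0); rewrite big1 ?subr0. Qed.

Lemma necklace_span_eq d e : d ~[k] e -> necklace_span e -> necklace_span d.
Proof. by move=> de [z Hz]; exists z; apply: igen_eq_trans de Hz. Qed.

Lemma necklace_span_free i u : size u = k -> i \notin u ->
  necklace_span (der1 i (adw u (lie_var i))).
Proof.
move=> su iu; have [t Et] : exists t : k.-tuple 'I_n, u = t.
  by exists (tcast su (in_tuple u)); rewrite val_tcast.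
rewrite Et in iu *; apply: necklace_span_eq (igen_necklace iu) _.
have nn : necklace (necklace t) = necklace t.
  exact: root_root (fconnect_sym rot_tuple_inj) t.
exists (fun t' => (t' == necklace t)%:Z).
rewrite (bigD1 (necklace t)) ?nn //= eqxx big1 ?addr0 => [|t' /andP[_ /negbTE ->]].
  by rewrite mulr1z subrr; apply: igen0.
exact: mulr0z.
Qed.

(** A bracket without X_i gives an element of the subring. Otherwise X_i is brought innermost,
    [igen_der1_swap] moves the derivation to a letter m absent so far, and [der1_rspan] leaves
    brackets with m innermost and nowhere else, to which [igen_necklace] applies. *)
Lemma necklace_span_der1 i a : lie_deg k.+1 a -> necklace_span (der1 i a).
Proof.
move=> /deg_rspan; elim=> {a} [|a b _ Ha _ Hb|u j su _ _].
- by rewrite der1_0; apply/necklace_span_igen/igen0.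
- by rewrite der1B; apply: necklace_spanB.
have [h|] := boolP ((i \in u) || (j == i)); last first.
  rewrite negb_or => /andP[iu ji]; apply: necklace_span_igen.
  by rewrite -su; apply: igen_der1_free => //; rewrite su; apply: ltnW.
have := adw_mem_rspan h; rewrite su; elim=> {u su h} [|a b _ Ha _ Hb|u l su _ /eqP ->].
- by rewrite der1_0; apply/necklace_span_igen/igen0.
- by rewrite der1B; apply: necklace_spanB.
have [m] := @fresh_letter (i :: u) ltac:(rewrite /= su; clear -kn; lia).
rewrite inE negb_or => /andP[mi mu].
case: u su mu => [|c u] /= su mu; first by move: k1; rewrite -su.
have u0 : (0 < size u)%N by rewrite -ltnS su.
have := igen_der1_swap u0 mu mi; rewrite su => /necklace_span_eq; apply.
move: mu; rewrite inE negb_or => /andP[mc mu].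
have := der1_rspan mc mi mu; rewrite su.
elim=> [|a b _ Ha _ Hb|w q sw /allP mw /eqP ->].
- by rewrite der1_0; apply/necklace_span_igen/igen0.
- by rewrite der1B; apply: necklace_spanB.
by apply: necklace_span_free => //; apply/negP => /mw; rewrite /= eqxx.
Qed.

Lemma der_deg_necklace d : der_deg k d -> necklace_span d.
Proof.
move=> dd; rewrite [d]der1_sum; elim/big_rec: _ => [|i e _ He].
  exact/necklace_span_igen/igen0.
have -> : der1 i (d (lie_var i)) + e = der1 i (d (lie_var i)) - (0 - e) by zmod.
apply: necklace_spanB.
  by apply: necklace_span_der1; apply: (dd 1%N); apply: lie_deg_gen.
by apply: necklace_spanB => //; apply/necklace_span_igen/igen0.
Qed.

(* The Morita-Satoh trace: contract with the last letter and project to cyclic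
   words. *)
Definition der_trace (u : seq 'I_n) d : int :=
  \sum_i \sum_(r < size u) iota (d (lie_var i)) (rcons (rot r u) i).

Lemma der_traceB u d e : der_trace u (d - e) = der_trace u d - der_trace u e.
Proof.
rewrite /der_trace -sumrB; apply: eq_bigr => i _; rewrite -sumrB.
by apply: eq_bigr => r _; rewrite der_subE iotaB coefB.
Qed.

HB.instance Definition _ u := GRing.isZmodMorphism.Build (derivation L)
  int (der_trace u) (der_traceB u).

Lemma der_traceMz u d (z : int) : der_trace u (d *~ z) = der_trace u d * z.
Proof. by rewrite -mulrzz -(raddfMz (der_trace u)). Qed.

(** In the expansion of the nested commutators, only the monomial with every factor kept on the left
    ends in the letter i. *)
Lemma iota_adw i u w : i \notin u ->
  iota (adw u (lie_var i)) (rcons w i) = (w == u)%:Z.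
Proof.
elim: u w => [|b u IHu] w.
  by case: w => [|c [|c' w]] _; rewrite iota_var /= eqseq_cons ?eqxx ?andbF.
rewrite inE negb_or => /andP[ib iu].
rewrite iota_lie iota_var coefB coefM_var (negbTE ib) mulr0 subr0 coef_varM.
case: w => [|c w] /=; first by rewrite (negbTE ib) mul0r.
by rewrite IHu // eqseq_cons; case: (c == b); rewrite ?mul0r ?mul1r.
Qed.

Lemma der_trace_necklace u t :
  der_trace u (necklace_der t) = \sum_(r < size u) (rot r u == t)%:Z.
Proof.
rewrite /der_trace (bigD1 (fresh t)) //= [X in _ + X]big1 ?addr0 => [|i it].
  by apply: eq_bigr => r _; rewrite der1_var iota_adw // freshP.
by rewrite big1 // => r _; rewrite der1_var_neq // iota0.
Qed.

(** Traces at necklaces form a diagonal system whose diagonal entries count the rotations fixing a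
    word, hence are positive, so all coefficients z vanish. Trace zero on the subring is a
    hypothesis, later supplied by automorphisms. *)
Lemma trace0_igen d : (forall u e, size u = k -> igen k e -> der_trace u e = 0) ->
  der_deg k d -> (forall u, size u = k -> der_trace u d = 0) -> igen k d.
Proof.
move=> tr_igen /der_deg_necklace[z Hz] trd.
suff z0 t : necklace t = t -> z t = 0.
  by move: Hz; rewrite big1 ?subr0 // => t /eqP /z0 ->.
move=> nt; have := tr_igen t _ (size_tuple t) Hz;
  rewrite der_traceB trd ?size_tuple // sub0r.
move/eqP; rewrite oppr_eq0 raddf_sum (bigD1 t)
  ?nt //= big1 => [|t' /andP[/eqP nt' t't]].
  rewrite addr0 der_traceMz der_trace_necklace mulf_eq0 => /orP[|/eqP //].
  have k0 : (0 < size t)%N by rewrite size_tuple; apply: ltnW.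
  rewrite (bigD1 (Ordinal k0)) //= rot0 eqxx Num.Theory.paddr_eq0 //.
  by apply: Num.Theory.sumr_ge0 => i _; case: eqP.
rewrite der_traceMz der_trace_necklace big1 ?mul0r // => r _; case: eqP => // E.
suff /(fingraph.rootP (fconnect_sym rot_tuple_inj)) E' : fconnect rot_tuple t' t.
  by case/eqP: t't; rewrite -nt' -[RHS]nt.
rewrite (fconnect_sym rot_tuple_inj).
have -> : t' = iter r rot_tuple t.
  apply: val_inj; rewrite /= -E; have := ltnW (ltn_ord r); move: (nat_of_ord r).
  elim=> [|m IHm] mk /=; first exact: rot0.
  by rewrite -IHm ?(ltnW mk) // -rotS.
exact: fconnect_iter.
Qed.

End FixedDegree.
End Reduction.

(** * Nielsen generators of Aut(F_n) *)

Section Nielsen.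
Variable n : nat.
Local Notation F := (freeGroup n).
Local Notation AutF := (autom F).
Implicit Types (a b c : letter n) (u v w p q r : seq (letter n)) (x y z : F) (s t :
  AutF).

Inductive nielsen : AutF -> Prop :=
| nielsen1 : nielsen 1
| nielsenM s t : nielsen s -> nielsen t -> nielsen (s * t)
| nielsenV s : nielsen s -> nielsen s^-1
| nielsen_trans s i j : i != j ->
    (forall m, s (free_gen m) = if m == i then free_gen i * free_gen j else free_gen m) ->
    nielsen s
| nielsen_sign s (e : 'I_n -> bool) :
    (forall m, s (free_gen m) = free_letter (m, e m)) -> nielsen s
| nielsen_perm s (f : 'I_n -> 'I_n) :
    (forall m, s (free_gen m) = free_gen (f m)) -> nielsen s.

Lemma aut1 x : (1%g : AutF) x = x. Proof. by []. Qed.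

Lemma autMM s t x : (s * t)%g x = s (t x). Proof. by []. Qed.

Lemma autKV s x : s (s^-1%g x) = x.
Proof. by rewrite -autMM mulgV. Qed.

Lemma autVK s x : s^-1%g (s x) = x.
Proof. by rewrite -autMM mulVg. Qed.

Lemma aut_inj s : injective s. Proof. exact: can_inj (autVK s). Qed.

Lemma sign_aut_ex (e : 'I_n -> bool) :
  exists2 s, nielsen s & forall m, s (free_gen m) = free_letter (m, e m).
Proof.
have K i : free_ext (fun m => free_letter (m, e m)) (free_letter (i, e i)) = free_gen i.
  rewrite free_ext_letter /letter_ext /= !free_letterE /=.
  by case: (e i); rewrite ?invgK.
by have [s Hs] := free_aut_ex K K; exists s => //; apply: nielsen_sign Hs.
Qed.

Lemma trans_aut_ex (i j : 'I_n) : i != j -> exists2 s, nielsen s &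
  forall m, s (free_gen m) = if m == i then free_gen i * free_gen j else free_gen m.
Proof.
move=> ij; have ji : (j == i) = false by rewrite eq_sym (negbTE ij).
have [s Hs] : exists s : AutF, forall m,
    s (free_gen m) = if m == i then free_gen i * free_gen j else free_gen m.
  apply: (@free_aut_ex _ _ (fun m => if m == i then free_gen i * (free_gen j)^-1 else free_gen m)) => m.
    case: eqP => [->|/eqP/negbTE mi]; last by rewrite free_ext_gen mi.
    by rewrite free_extM !free_ext_gen eqxx ji mulgVK.
  case: eqP => [->|/eqP/negbTE mi]; last by rewrite free_ext_gen mi.
  by rewrite free_extM (gmorphV (free_extM _)) !free_ext_gen eqxx ji mulgK.
by exists s => //; apply: nielsen_trans ij Hs.
Qed.

Lemma aut_letter_fix s a : s (free_gen a.1) = free_gen a.1 -> s (free_letter a)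
  = free_letter a.
Proof.
move=> sa; rewrite !free_letterE; case: a.2 => //.
by rewrite (gmorphV (@automM _ s)) sa.
Qed.

(** All sign patterns come from one transvection: its inverse handles an inverse letter b, and
    conjugation by a sign change an inverse letter a. *)
Lemma elementary_ex a b : a.1 != b.1 -> exists s, [/\ nielsen s,
  s (free_letter a) = free_letter a * free_letter b &
  forall m, m != a.1 -> s (free_gen m) = free_gen m].
Proof.
have base i b' : i != b'.1 -> exists s, [/\ nielsen s,
    s (free_gen i) = free_gen i * free_letter b' &
    forall m, m != i -> s (free_gen m) = free_gen m].
  case: b' => j [] /= ij; have [s Ns Hs] := trans_aut_ex ij; last first.
    by exists s; split=> // [|m /negbTE mi]; rewrite Hs ?eqxx ?mi.
  have Hs' m : m != i -> s (free_gen m) = free_gen m by move=> /negbTE mi;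
    rewrite Hs mi.
  exists s^-1; split=> [||m mi]; first exact: nielsenV.
    apply: (@aut_inj s); rewrite autKV automM Hs eqxx aut_letter_fix /=.
      by rewrite free_letterE /= mulgK.
    by apply: Hs'; rewrite eq_sym.
  by apply: (@aut_inj s); rewrite autKV Hs'.
case: a => i [] /= ij; last exact: base.
have [s [Ns si Hs]] := base i b ij.
have [t Nt Ht] := sign_aut_ex (pred1 i).
have tb m : m != i -> t (free_gen m) = free_gen m by move=> /negbTE mi;
  rewrite Ht /= mi.
have ti : t (free_gen i) = free_letter (i, true) by rewrite Ht /= eqxx.
have tVi : t (free_letter (i, true)) = free_gen i.
  by rewrite free_letterE /= (gmorphV (@automM _ t)) ti free_letterE /= invgK.
exists (t * s * t); split=> [||m mi]; first by do !apply: nielsenM.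
  rewrite !autMM tVi si automM ti; congr (_ * _); apply: aut_letter_fix.
  by apply: tb; rewrite eq_sym.
by rewrite !autMM tb // Hs // tb.
Qed.

Lemma word_inv_cat u v : word_inv (u ++ v) = word_inv v ++ word_inv u.
Proof. by rewrite /word_inv map_cat rev_cat. Qed.

Lemma size_word_inv u : size (word_inv u) = size u.
Proof. by rewrite /word_inv size_rev size_map. Qed.

Lemma word_mul_cat u v : reduced (u ++ v) -> word_mul u v = u ++ v.
Proof.
elim: u => //= a u IHu rauv; rewrite IHu; last exact: reduced_behead rauv.
case E : (u ++ v) rauv => [|b w] //= /andP[/negbTE -> //].
Qed.

Lemma cancellation u v : reduced u -> reduced v -> exists p r q,
  [/\ u = p ++ r, v = word_inv r ++ q & word_mul u v = p ++ q].
Proof.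
move=> + rv; elim: u => [|a u IHu] ru; first by exists [::], [::], v.
have [p [r [q [Eu Ev E]]]] := IHu (reduced_behead ru).
rewrite /= -/(word_mul u v) E; case: p Eu E => [|b p] Eu E; last first.
  exists (a :: b :: p), r, q; rewrite Eu; split=> //=.
  by move: ru; rewrite Eu /= => /andP[/negbTE ->].
case: q Ev E => [|b q] Ev E; first by exists [:: a], r, [::]; rewrite Eu.
rewrite /=; case: eqP => [Eb|_]; last by exists [:: a], r, (b :: q); rewrite Eu.
exists [::], (a :: r), q; split=> //; first by rewrite Eu.
by rewrite Ev /word_inv /= rev_cons cat_rcons Eb.
Qed.

Lemma letter_inv_neq a : letter_inv a != a.
Proof. by case: a => i []; rewrite /letter_inv xpair_eqE /= eqxx. Qed.

(** If half of u cancelled against u itself, then in odd length the middle letter would be its own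
    inverse, and in even length the two middle letters would be mutually inverse, against
    reducedness. *)
Lemma self_cancellation u p r q : reduced u -> u != [::] ->
  u = p ++ r -> u = word_inv r ++ q -> (size r + size r < size u)%N.
Proof.
move=> ru u0 Ep Eq; rewrite ltnNge; apply/negP => sr.
have a0 : letter n by case: u u0 {ru Ep Eq sr}.
have nthE i : (i < size r)%N -> nth a0 u i = letter_inv (nth a0 u (size u - i.+1)).
  move=> ir; rewrite {1}Eq nth_cat size_word_inv ir /word_inv nth_rev ?size_map //.
  rewrite (nth_map a0); last by lia.
  rewrite Ep nth_cat size_cat ifF; last by apply/negbTE; rewrite -leqNgt; lia.
  by congr (letter_inv (nth _ _ _)); lia.
have su : size u = (odd (size u) + (size u)./2.*2)%N by rewrite odd_double_half.
have u1 : (0 < size u)%N by rewrite lt0n size_eq0.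
move: su; set h := (size u)./2; case: odd => su.
  have /eqP := nthE h ltac:(lia); rewrite (_ : size u - h.+1 = h)%N; last by lia.
  by rewrite eq_sym (negbTE (letter_inv_neq _)).
case: h su => [|h] su; first by lia.
have := nthE h ltac:(lia); rewrite (_ : size u - h.+1 = h.+1)%N; last by lia.
move=> E; have /(sortedP a0)/(_ h) : sorted (fun a b => b != letter_inv a)
  u by exact: ru.
by rewrite E letter_invK eqxx => H; have /H : (h.+1 < size u)%N by lia.
Qed.

(* Letters are digits between 1 and 2n, so that words of equal length are ordered
   by these numerals. *)
Definition letter_code a : nat := (2 * a.1 + a.2).+1.
Definition word_num w : nat :=
  foldl (fun m a => m * (2 * n).+2 + letter_code a)%N 0%N w.

Lemma letter_code_inj : injective letter_code.
Proof.
move=> [i b] [j c]; rewrite /letter_code /= => E.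
by congr (_, _); [apply: val_inj => /=|]; move: E; case: b; case: c => /=; lia.
Qed.

Lemma word_num_rcons w a : word_num (rcons w a) = (word_num w * (2 * n).+2 +
  letter_code a)%N.
Proof. by rewrite /word_num -cats1 foldl_cat. Qed.

Lemma word_num_cat u w :
  word_num (u ++ w) = (word_num u * (2 * n).+2 ^ size w + word_num w)%N.
Proof.
elim/last_ind: w => [|w a IHw]; first by rewrite cats0 muln1 addn0.
rewrite -rcons_cat !word_num_rcons IHw size_rcons expnSr; lia.
Qed.

Lemma word_num_inj u w : size u = size w -> word_num u = word_num w -> u = w.
Proof.
elim/last_ind: u w => [|u a IHu] w; first by case: w.
case/lastP: w => [|w b]; rewrite !size_rcons // => -[suw].
rewrite !word_num_rcons => E.
have code_lt d : (letter_code d < (2 * n).+2)%N.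
  by rewrite /letter_code; have := ltn_ord d.1; case: d.2 => /=; lia.
have Ec : letter_code a = letter_code b.
  by have := congr1 (modn^~ (2 * n).+2) E; rewrite !modnMDl !modn_small.
by rewrite (letter_code_inj Ec) (IHu w) //; move: E; rewrite Ec; nia.
Qed.

(** With [sym_num], Nielsen's tie-break between bases of equal length: initial halves of a word and
    of its inverse, measured as numerals. *)
Definition half_num w : nat := word_num (take (size w)./2 w).
Definition sym_num w : nat := (half_num w + half_num (word_inv w))%N.

Lemma sym_num_inv w : sym_num (word_inv w) = sym_num w.
Proof. by rewrite /sym_num word_invK addnC. Qed.

(** A prefix of at most half the length affects only the initial half of the word: that of the
    inverse is read entirely in q. *)
Lemma sym_num_prefix u v q : size u = size v -> (size u <= size q)%N ->
  (sym_num (u ++ q) <= sym_num (v ++ q))%N -> (word_num u <= word_num v)%N.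
Proof.
move=> suv uq; rewrite /sym_num /half_num !size_word_inv !size_cat !word_inv_cat -suv.
set h := (_./2); have hh : (size u <= h <= size q)%N by rewrite /h; lia.
rewrite !take_cat !size_word_inv suv ltnNge -suv.
case/andP: hh => h1 h2; rewrite h1 /=.
have -> : (if h < size q then take h (word_inv q)
  else word_inv q ++ take (h - size q) (word_inv u)) =
   take h (word_inv q).
  by case: ltnP => // qh; rewrite (_ : h = size q)
    ?subnn ?take0 ?cats0 ?take_oversize ?size_word_inv //; apply/eqP;
    rewrite eqn_leq h2.
have -> : (if h < size q then take h (word_inv q)
  else word_inv q ++ take (h - size q) (word_inv v)) =
   take h (word_inv q).
  by case: ltnP => // qh; rewrite (_ : h = size q)
    ?subnn ?take0 ?cats0 ?take_oversize ?size_word_inv //; apply/eqP;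
    rewrite eqn_leq h2.
rewrite leq_add2r !word_num_cat leq_add2r leq_pmul2r // expn_gt0 //.
Qed.

(** * Nielsen-reduced automorphisms do not shorten words *)

Section ReducedBasis.
Variable s : AutF.
Local Notation img a := (word (s (free_letter a))).

Hypothesis size_min : forall a b, a.1 != b.1 ->
  (size (img a) <= size (word_mul (img a) (img b)))%N.
Hypothesis num_min : forall a b, a.1 != b.1 ->
  size (word_mul (img a) (img b)) = size (img a) ->
  (sym_num (img a) <= sym_num (word_mul (img a) (img b)))%N.

Lemma img_neq0 a : img a != [::].
Proof.
apply/eqP => E; have : s (free_letter a) = s 1.
  by rewrite (gmorph1 (@automM _ s)); apply: val_inj.
by move/aut_inj/(congr1 (@word n)).
Qed.

Lemma img_inv a : img (letter_inv a) = word_inv (img a).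
Proof. by rewrite free_letter_inv (gmorphV (@automM _ s)). Qed.

Definition cancels a b p r q :=
  [/\ img a = p ++ r, img b = word_inv r ++ q & word_mul (img a) (img b) = p ++ q].

Lemma cancels_inv a b p r q : cancels a b p r q ->
  cancels (letter_inv b) (letter_inv a) (word_inv q) r (word_inv p).
Proof.
move=> [Ea Eb E]; split.
- by rewrite img_inv Eb word_inv_cat word_invK.
- by rewrite img_inv Ea word_inv_cat.
rewrite -word_inv_cat -E !free_letter_inv !(gmorphV (@automM _ s)).
rewrite -[LHS]/(word ((s (free_letter b))^-1 * (s (free_letter a))^-1)).
by rewrite -invgM.
Qed.

Lemma same_index a b : a.1 = b.1 -> b != letter_inv a -> a = b.
Proof. by case: a b => i [] [j []] /= ->; rewrite /letter_inv ?eqxx. Qed.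

Lemma cancel_half a b p r q : b != letter_inv a -> cancels a b p r q ->
  (size r + size r <= size (img a))%N /\ (size r + size r <= size (img b))%N.
Proof.
move=> ba H; have [E|ne] := eqVneq a.1 b.1.
  have Eab := same_index E ba; case: H => Ea Eb _; rewrite -Eab in Eb *.
  by have := self_cancellation (word_reduced _) (img_neq0 a) Ea Eb; lia.
have size_ineq c d p' r' q' : c.1 != d.1 -> cancels c d p' r' q' ->
    (size r' + size r' <= size (img d))%N.
  move=> cd [Ec Ed E]; have := size_min cd;
    rewrite E Ec Ed !size_cat size_word_inv; lia.
split; last exact: size_ineq ne H.
have := size_ineq (letter_inv b) (letter_inv a) _ _ _ _ (cancels_inv H).
by rewrite img_inv size_word_inv; apply; rewrite /= eq_sym.
Qed.

(** If the cancellations on both sides used up the image of b, each would take exactly half, leaving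
    [word_inv r1 ++ r2]. The tie-break [num_min], applied on each side, gives opposite inequalities,
    so r1 = r2, which [self_cancellation] excludes. *)
Lemma cancel_triple a b c p1 r1 q1 p2 r2 q2 : b != letter_inv a -> c != letter_inv b ->
  cancels a b p1 r1 q1 -> cancels b c p2 r2 q2 ->
  (size r1 + size r2 < size (img b))%N.
Proof.
move=> ba cb H1 H2; have [_ h1] := cancel_half ba H1; have [h2 _] := cancel_half cb H2.
rewrite ltnNge; apply/negP => h.
have [Ea Eb E1] := H1; have [Eb' Ec E2] := H2.
have s1 : (size r1 + size r1)%N = size (img b) by lia.
have s2 : (size r2 + size r2)%N = size (img b) by lia.
have ab : a.1 != b.1.
  apply/eqP => E; have Eab := same_index E ba; rewrite Eab in Ea.
  by have := self_cancellation (word_reduced _) (img_neq0 b) Ea Eb; lia.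
have bc : b.1 != c.1.
  apply/eqP => E; have Ebc := same_index E cb; rewrite -Ebc in Ec.
  by have := self_cancellation (word_reduced _) (img_neq0 b) Eb' Ec; lia.
have sb2 := congr1 size Eb'; rewrite size_cat in sb2.
have Ep2 : p2 = word_inv r1 /\ q1 = r2.
  have /eqP : word_inv r1 ++ q1 = p2 ++ r2 by rewrite -Eb -Eb'.
  have ss : size (word_inv r1) = size p2 by rewrite size_word_inv; lia.
  by rewrite (eqseq_cat _ _ ss) => /andP[/eqP -> /eqP ->].
have num_le d e p r q : d.1 != e.1 -> cancels d e p r q -> size p = size r ->
    (size r <= size q)%N -> (word_num (word_inv r) <= word_num p)%N.
  move=> de Hde spr rq; apply: (sym_num_prefix (q := q)); rewrite ?size_word_inv //.
  have [_ Ee Ede] := Hde; have [_ _ Ed] := cancels_inv Hde.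
  have := @num_min (letter_inv e) (letter_inv d).
  rewrite Ed img_inv -word_inv_cat !sym_num_inv !size_word_inv Ee !size_cat size_word_inv spr.
  by apply; rewrite // eq_sym.
have sc := congr1 size Ec; rewrite size_cat size_word_inv in sc.
have [h3 _] := cancel_half ba H1; have [_ h4] := cancel_half cb H2.
have le1 := num_le _ _ _ _ _ bc H2 ltac:(lia) ltac:(lia).
have sa := congr1 size Ea; rewrite size_cat in sa.
have sq1 : size q1 = size r1 by rewrite (proj2 Ep2); lia.
have := num_le (letter_inv b) (letter_inv a) _ _ _ _ (cancels_inv H1).
rewrite !size_word_inv eq_sym => /(_ ab sq1 ltac:(lia)).
case: Ep2 => Ep2 Eq1; rewrite Eq1 => le2.
have E12 : word_inv r1 = word_inv r2.
  apply: word_num_inj; first by rewrite !size_word_inv; lia.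
  by apply/eqP; rewrite eqn_leq le2 -Ep2.
rewrite Ep2 E12 in Eb'.
by have := self_cancellation (word_reduced _) (img_neq0 b) Eb' Eb'; lia.
Qed.

Definition letters_prod (u : seq (letter n)) : F :=
  foldr (fun a x => free_letter a * x) 1 u.

Lemma letters_prod_word x : letters_prod (word x) = x.
Proof.
case: x => u ru /=; elim: u ru => [|a u IHu] ru; first exact: val_inj.
by rewrite /= (IHu (reduced_behead ru)) -free_cons.
Qed.

Lemma letters_prod_rcons u a : letters_prod (rcons u a)
  = letters_prod u * free_letter a.
Proof. by elim: u => [|b u IHu] /=; rewrite ?mul1g ?mulg1 // IHu mulgA. Qed.

Lemma reduced_cat3 u v w : v != [::] -> reduced (u ++ v) -> reduced (v ++ w) ->
  reduced (u ++ v ++ w).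
Proof.
case: v => // a v _; case: u => [//|b u]; rewrite /reduced /= !cat_path /= !cat_path.
by case/and3P => -> -> -> ->.
Qed.

Lemma reduced_catl u v : reduced (u ++ v) -> reduced u.
Proof. by case: u => //= a u; rewrite /reduced /= cat_path => /andP[]. Qed.

Lemma reduced_catr u v : reduced (u ++ v) -> reduced v.
Proof. by elim: u => //= a u IHu /reduced_behead. Qed.

Lemma word_mul_cancel u r q : reduced (u ++ r) -> reduced (word_inv r ++ q) ->
  reduced (u ++ q) -> word_mul (u ++ r) (word_inv r ++ q) = u ++ q.
Proof.
move=> rur rrq ruq; have rr := reduced_catr rur; have rq := reduced_catr ruq.
rewrite -(word_mul_cat rur) -(word_mul_cat rrq) -(word_mul_cat ruq).
have ru := reduced_catl rur.
rewrite -word_mulA ?reduced_mul ?reduced_inv // (word_mulA rr) ?reduced_inv //.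
by rewrite -{1}(word_invK r) word_mulV ?reduced_inv.
Qed.

(** Invariant of Nielsen's argument: v is what survives of the image of the last letter, and the
    final clause, from [cancel_half] and then [cancel_triple], says that no next letter cancels all
    of v. So each letter leaves at least one letter behind. *)
Lemma size_img_rcons u a : reduced (rcons u a) -> exists w v p,
  [/\ word (s (letters_prod (rcons u a))) = w ++ v, (size u <= size w)%N,
      v != [::], img a = p ++ v &
      forall c p2 r2 q2, c != letter_inv a -> cancels a c p2 r2 q2 ->
        (size p + size r2 < size (img a))%N].
Proof.
elim/last_ind: u a => [|u b IHu] a.
  move=> _; exists [::], (img a), [::]; rewrite /= mulg1; split=> //;
    first exact: img_neq0.
  move=> c p2 r2 q2 ca H; have [h _] := cancel_half ca H.
  have arith (x y : nat) : (x + x <= y -> 0 < y -> x < y)%N by clear; lia.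
  by apply: arith h _; rewrite lt0n size_eq0 img_neq0.
move=> rba; have rb : reduced (rcons u b) by move: rba; rewrite -cats1 => /reduced_catl.
have ab : a != letter_inv b.
  by move: rba; rewrite -!cats1 -catA => /reduced_catr /= /andP[].
have [w [t [p [Ew uw t0 Eb Hb]]]] := IHu b rb.
have [p2 [r2 [q2 [Eb2 Ea2 E2]]]] := cancellation (word_reduced (s (free_letter b)))
  (word_reduced (s (free_letter a))).
have H2 : cancels b a p2 r2 q2 by [].
have lt := Hb _ _ _ _ ab H2; have [_ half2] := cancel_half ab H2.
have sb := congr1 size Eb; have sb2 := congr1 size Eb2; rewrite size_cat in sb;
  rewrite size_cat in sb2.
have [t1 Et1 Ep2] : exists2 t1, t = t1 ++ r2 & p2 = p ++ t1.
  have /cat_eq_cases[[v _ Er]|[v Ep Et]] : p ++ t = p2 ++ r2 by rewrite -Eb -Eb2.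
    by exfalso; move: lt; rewrite sb Er size_cat; clear; lia.
  by exists v.
have t10 : t1 != [::].
  by apply/eqP => t1nil; move: lt; rewrite sb Et1 t1nil ltnn.
exists (w ++ t1), q2, (word_inv r2); split=> //.
- rewrite letters_prod_rcons automM -[LHS]/(word_mul (word (s (letters_prod (rcons u b)))) (img a)).
  have rwt := word_reduced (s (letters_prod (rcons u b))).
  rewrite Ew Ea2 Et1 catA; rewrite Ew Et1 in rwt.
  apply: word_mul_cancel; first by rewrite -catA.
    by rewrite -Ea2; apply: word_reduced.
  rewrite -catA; apply: reduced_cat3 => //; first by move: rwt;
    rewrite catA => /reduced_catl.
  have := word_reduced (s (free_letter b) * s (free_letter a)).
  by rewrite /= E2 Ep2 -catA => /reduced_catr.
- by rewrite size_cat size_rcons -addn1; apply: leq_add uw _; rewrite lt0n size_eq0.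
- apply/eqP => q20; have sa := congr1 size Ea2; move: half2 (img_neq0 a).
  rewrite -size_eq0 sa q20 cats0 size_word_inv -[X in (_ <= X)%N]addn0 leq_add2l.
  by rewrite leqn0 => ->.
- move=> c p3 r3 q3 ca H3; rewrite size_word_inv; exact: cancel_triple ab ca H2 H3.
Qed.

Lemma size_img x : (size (word x) <= size (word (s x)))%N.
Proof.
have := letters_prod_word x; have := word_reduced x; move: (word x) => u ru Ex.
rewrite -Ex; case/lastP: u ru {Ex} => [//|u a] ru.
have [w [t [p [-> uw t0 _ _]]]] := size_img_rcons ru.
by rewrite size_rcons size_cat -addn1; apply: leq_add uw _; rewrite lt0n size_eq0.
Qed.

End ReducedBasis.

Lemma signed_perm_nielsen s :
  (forall i, exists a, s (free_gen i) = free_letter a) -> nielsen s.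
Proof.
move=> /choice[f Hf].
have [t Nt Ht] := sign_aut_ex (fun i => (f i).2).
have tK : t * t = 1.
  apply: free_aut_eq => i; rewrite autMM Ht free_letterE /=.
  by case E : (f i).2; rewrite ?(gmorphV (@automM _ t)) Ht E // free_letterE /= invgK.
suff : nielsen (s * t) by move=> /nielsenM /(_ Nt); rewrite -mulgA tK mulg1.
apply: (nielsen_perm (f := fun i => (f i).1)) => i; rewrite autMM Ht free_letterE /=.
case E : (f i).2; rewrite ?(gmorphV (@automM _ s)) Hf free_letterE E //.
exact: invgK.
Qed.

(** Lexicographic descent on the total length, then the total [sym_num], of the images of the
    generators. When no elementary move lowers this pair, s shortens no word; applied to preimages
    of generators, this makes [s^-1] a signed permutation. *)
Theorem aut_nielsen s : nielsen s.
Proof.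
pose len s := (\sum_i size (word (s (free_gen i))))%N.
pose num s := (\sum_i sym_num (word (s (free_gen i))))%N.
have [m] := ubnP (len s); elim: m s => // m IHm s; rewrite ltnS => sm.
have [k] := ubnP (num s); elim: k s sm => // k IHk s sm; rewrite ltnS => sk.
have img_sum (h : seq (letter n) -> nat) a b t : a.1 != b.1 ->
    (forall w, h (word_inv w) = h w) ->
    t (free_letter a) = free_letter a * free_letter b ->
    (forall i, i != a.1 -> t (free_gen i) = free_gen i) ->
    (\sum_i h (word ((s * t)%g (free_gen i))) + h (word (s (free_letter a))) =
     \sum_i h (word (s (free_gen i))) + h (word_mul (word (s (free_letter a)))
       (word (s (free_letter b)))))%N.
  move=> ab hV ta ti; rewrite (bigD1 a.1) // [in RHS](bigD1 a.1) //.
  have -> : (\sum_(i | i != a.1) h (word ((s * t)%g (free_gen i)))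
    = \sum_(i | i != a.1) h (word (s (free_gen i))))%N.
    by apply: eq_bigr => i ia; rewrite autMM ti.
  have hV' x : h (word x^-1) = h (word x) by rewrite /= hV.
  have hl (t' : AutF) : h (word (t' (free_letter a))) = h (word (t' (free_gen a.1))).
    by rewrite free_letterE; case: a.2 => //; rewrite (gmorphV (@automM _ t')) hV'.
  rewrite -!hl autMM ta automM.

  rewrite -[word_mul _ _]/(word (s (free_letter a) * s (free_letter b))%g).
  by rewrite addnAC [in RHS]addnC addnA.
have conclude t : nielsen t -> nielsen (s * t) -> nielsen s.
  by move=> /nielsenV Nt /nielsenM /(_ Nt); rewrite mulgK.
have [[a [b [ab lt]]]|nolt] := pselect (exists a b, a.1 != b.1 /\
    (size (word_mul (word (s (free_letter a))) (word (s (free_letter b))))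
      < size (word (s (free_letter a))))%N).
  have [t [Nt ta ti]] := elementary_ex ab; apply: (conclude t Nt); apply: IHm.
  by have := img_sum size a b t ab (@size_word_inv) ta ti; rewrite -!/(len _);
    move: lt sm; clear; lia.
have [[a [b [ab eq lt]]]|nonum] := pselect (exists a b, [/\ a.1 != b.1,
    size (word_mul (word (s (free_letter a))) (word (s (free_letter b))))
      = size (word (s (free_letter a))) &
    (sym_num (word_mul (word (s (free_letter a))) (word (s (free_letter b))))
      < sym_num (word (s (free_letter a))))%N]).
  have [t [Nt ta ti]] := elementary_ex ab; apply: (conclude t Nt); apply: IHk.
    by have := img_sum size a b t ab (@size_word_inv) ta ti; rewrite -!/(len _);
      move: eq sm; clear; lia.
  by have := img_sum sym_num a b t ab (@sym_num_inv) ta ti; rewrite -!/(num _);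
    move: lt sk; clear; lia.
have size_s : forall x, (size (word x) <= size (word (s x)))%N.
  apply: size_img => [a b ab|a b ab E].
    by rewrite leqNgt; apply/negP => lt; apply: nolt; exists a, b.
  by rewrite leqNgt; apply/negP => lt; apply: nonum; exists a, b.
have : nielsen s^-1.
  apply: signed_perm_nielsen => i; have := size_s (s^-1 (free_gen i)).
  rewrite autKV /=; case E : (word _) => [|a [|//]] _.
    have : s^-1 (free_gen i) = s^-1 1.
      by rewrite (gmorph1 (@automM _ s^-1)); apply: val_inj.
    by move/aut_inj/(congr1 (@word n)).
  by exists a; apply: val_inj.
by move/nielsenV; rewrite invgK.
Qed.

End Nielsen.

(** * Fox Jacobians and logarithmic derivatives *)

Section DualNumbers.
Variable B : pzRingType.
Local Open Scope ring_scope.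

(** Elements a + b eps with eps^2 = 0. A derivation D of B amounts to the ring morphism a |-> a +
    D(a) eps, so differentiating a Jacobian means computing it over [dual B]. *)
Record dual := Dual { dual_re : B; dual_eps : B }.

HB.instance Definition _ := gen_eqMixin dual.
HB.instance Definition _ := gen_choiceMixin dual.

Implicit Types x y z : dual.

Lemma dualP x y : dual_re x = dual_re y -> dual_eps x = dual_eps y -> x = y.
Proof. by case: x y => [a b] [c d] /= -> ->. Qed.

Definition dual_zero := Dual 0 0.
Definition dual_one := Dual 1 0.
Definition dual_opp x := Dual (- dual_re x) (- dual_eps x).
Definition dual_add x y := Dual (dual_re x + dual_re y) (dual_eps x + dual_eps y).
Definition dual_mul x y := Dual (dual_re x * dual_re y)
  (dual_re x * dual_eps y + dual_eps x * dual_re y).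

Lemma dual_addA : associative dual_add.
Proof. by move=> x y z; apply: dualP; rewrite /= addrA. Qed.
Lemma dual_addC : commutative dual_add.
Proof. by move=> x y; apply: dualP; rewrite /= addrC. Qed.
Lemma dual_add0 : left_id dual_zero dual_add.
Proof. by move=> x; apply: dualP; rewrite /= add0r. Qed.
Lemma dual_addN : left_inverse dual_zero dual_opp dual_add.
Proof. by move=> x; apply: dualP; rewrite /= addNr. Qed.

HB.instance Definition _ := GRing.isZmodule.Build dual
  dual_addA dual_addC dual_add0 dual_addN.

Lemma dual_mulA : associative dual_mul.
Proof.
by move=> x y z; apply: dualP; rewrite /= ?mulrDr ?mulrDl !mulrA ?addrA.
Qed.
Lemma dual_mul1 : left_id dual_one dual_mul.
Proof. by move=> x; apply: dualP; rewrite /= ?mul0r !mul1r ?addr0. Qed.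
Lemma dual_1mul : right_id dual_one dual_mul.
Proof. by move=> x; apply: dualP; rewrite /= ?mulr0 !mulr1 ?add0r. Qed.
Lemma dual_mulDl : left_distributive dual_mul dual_add.
Proof. by move=> x y z; apply: dualP; rewrite /= !mulrDl // addrACA. Qed.
Lemma dual_mulDr : right_distributive dual_mul dual_add.
Proof. by move=> x y z; apply: dualP; rewrite /= !mulrDr // addrACA. Qed.

HB.instance Definition _ := GRing.Zmodule_isPzRing.Build dual
  dual_mulA dual_mul1 dual_1mul dual_mulDl dual_mulDr.

Lemma dual_reB : {morph dual_re : x y / x - y}. Proof. by []. Qed.
Lemma dual_epsB : {morph dual_eps : x y / x - y}. Proof. by []. Qed.
HB.instance Definition _ := GRing.isZmodMorphism.Build dual B dual_re dual_reB.
HB.instance Definition _ := GRing.isZmodMorphism.Build dual B dual_eps dual_epsB.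

Lemma dual_reM x y : dual_re (x * y) = dual_re x * dual_re y. Proof. by []. Qed.
Lemma dual_epsM x y :
  dual_eps (x * y) = dual_re x * dual_eps y + dual_eps x * dual_re y.
Proof. by []. Qed.

End DualNumbers.

Section Jacobian.
Variables (n : nat) (B : pzRingType).
Local Notation F := (freeGroup n).
Local Notation AutF := (autom F).
Local Open Scope ring_scope.
Implicit Types (r : F -> unit_pair B) (s t : AutF) (i j k : 'I_n).

(** Fox derivative with respect to the generator j, evaluated through r. The representation is a
    parameter because the chain rule replaces it by [r \o s]. *)
Definition fox r j : F -> B := cross_ext r (fun i => (i == j)%:R).

Lemma fox_gen r i j : fox r j (free_gen i) = (i == j)%:R.
Proof. exact: cross_ext_gen. Qed.

Definition jacobian r s : 'M[B]_n := \matrix_(i, j) fox r j (s (free_gen i)).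

Section Theory.
Variable r : F -> unit_pair B.
Hypothesis rM : {morph r : x y / (x * y)%g}.

Lemma foxM j : crossed r (fox r j).
Proof. exact: cross_extM. Qed.

Lemma comp_morph s : {morph (fun x => r (s x)) : x y / (x * y)%g}.
Proof. by move=> x y; rewrite automM rM. Qed.

End Theory.

Lemma fox_comp r s j x : {morph r : x y / (x * y)%g} ->
  fox r j (s x) = \sum_k fox (r \o s) k x * fox r j (s (free_gen k)).
Proof.
move=> rM; have rsM := comp_morph rM s; move: x.
apply: (crossed_eq rsM).
- by move=> x y; rewrite automM (foxM rM).
- move=> x y; rewrite mulr_sumr -big_split; apply: eq_bigr => k _.
  by rewrite (foxM rsM) mulrDl mulrA.
move=> i; rewrite (bigD1 i) //= fox_gen eqxx mul1r big1 ?addr0 // => k ki.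
by rewrite fox_gen eq_sym (negbTE ki) mul0r.
Qed.

Lemma jacobianM r s t : {morph r : x y / (x * y)%g} ->
  jacobian r (s * t)%g = jacobian (r \o s) t *m jacobian r s.
Proof.
move=> rM; apply/matrixP => i j; rewrite !mxE autMM fox_comp //.
by apply: eq_bigr => k _; rewrite !mxE.
Qed.

Lemma jacobian1 r : jacobian r 1%g = 1%:M.
Proof. by apply/matrixP => i j; rewrite !mxE aut1 fox_gen. Qed.

Lemma jacobian_inv r s : {morph r : x y / (x * y)%g} ->
  jacobian (r \o s) s^-1%g *m jacobian r s = 1%:M /\
  jacobian r s *m jacobian (r \o s) s^-1%g = 1%:M.
Proof.
move=> rM; rewrite -jacobianM // mulgV jacobian1; split=> //.
have rsM := comp_morph rM s.
have {1}-> : r = (r \o s) \o s^-1%g.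
  by apply/funext => x; rewrite -[RHS]/(r (s (s^-1%g x))) autKV.
by rewrite -jacobianM // mulVg jacobian1.
Qed.

End Jacobian.

Section LogarithmicTrace.
Variables (n : nat) (A : pzRingType) (chi : A -> int).
Local Notation F := (freeGroup n).
Local Notation AutF := (autom F).
Local Open Scope ring_scope.
Hypotheses (chiB : {morph chi : a b / a - b})
           (chiM : forall a b, chi (a * b) = chi (b * a)).

HB.instance Definition _ := GRing.isZmodMorphism.Build A int chi chiB.

Implicit Types (X Y : 'M[dual A]_n) (r : F -> unit_pair (dual A)) (s t : AutF).

Local Notation re := (map_mx (@dual_re A)).
Local Notation eps := (map_mx (@dual_eps A)).

Lemma mxtr_mulC (M N : 'M[A]_n) : chi (\tr (M *m N)) = chi (\tr (N *m M)).
Proof.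
rewrite /mxtrace !raddf_sum.
under eq_bigr do rewrite mxE raddf_sum.
under [RHS]eq_bigr do rewrite mxE raddf_sum.
by rewrite exchange_big; apply: eq_bigr => i _; apply: eq_bigr => j _; apply: chiM.
Qed.

Lemma re_mulmx X Y : re (X *m Y) = re X *m re Y.
Proof.
apply/matrixP => i j; rewrite !mxE raddf_sum; apply: eq_bigr => k _.
by rewrite !mxE.
Qed.

Lemma eps_mulmx X Y : eps (X *m Y) = re X *m eps Y + eps X *m re Y.
Proof.
apply/matrixP => i j; rewrite !mxE raddf_sum -big_split; apply: eq_bigr => k _.
by rewrite !mxE.
Qed.

Lemma re1 : re (1%:M : 'M[dual A]_n) = 1%:M.
Proof. by apply/matrixP => i j; rewrite !mxE; case: eqP. Qed.

(* dlog X' X is chi (tr (X^-1 dX)) when X' is the inverse of X. *)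
Definition dlog (X' X : 'M[dual A]_n) : int := chi (\tr (re X' *m eps X)).

Lemma dlogM X X' Y Y' : Y' *m Y = 1%:M -> X *m X' = 1%:M -> X' *m X = 1%:M ->
  Y *m Y' = 1%:M ->
  dlog (Y' *m X') (X *m Y) = dlog X' X + dlog Y' Y.
Proof.
move=> Y'Y XX' X'X YY'; rewrite /dlog eps_mulmx re_mulmx mulmxDr mxtraceD raddfD addrC /=.
congr (_ + _).
  rewrite mxtr_mulC !mulmxA -[eps X *m _ *m _]mulmxA -re_mulmx YY' re1 mulmx1.
  exact: mxtr_mulC.
by rewrite mulmxA -[re Y' *m _ *m _]mulmxA -re_mulmx X'X re1 mulmx1.
Qed.

Lemma mx_inv_unique (X X' X'' : 'M[dual A]_n) :
  X' *m X = 1%:M -> X *m X'' = 1%:M -> X' = X''.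
Proof. by move=> h1 h2; rewrite -[X']mulmx1 -h2 mulmxA h1 mul1mx. Qed.

Definition udlog (u : unit_pair (dual A)) : int :=
  chi (dual_re (uinv u) * dual_eps (uval u)).

Lemma udlogM u v : udlog (u * v)%g = udlog u + udlog v.
Proof.
have K w : dual_re (uval w) * dual_re (uinv w) = 1 :> A by rewrite -dual_reM uvalK.
have VK w : dual_re (uinv w) * dual_re (uval w) = 1 :> A by rewrite -dual_reM uinvK.
rewrite /udlog uvalM dual_epsM (_ : dual_re (uinv (u * v)%g) =
  dual_re (uinv v) * dual_re (uinv u)) // mulrDr raddfD addrC /=; congr (_ + _).
  by rewrite chiM !mulrA -[_ * _ * dual_re (uinv v)]mulrA K mulr1 chiM.
by rewrite !mulrA -[_ * _ * dual_re (uval u)]mulrA VK mulr1.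
Qed.

Lemma udlog1 : udlog 1%g = 0.
Proof. by rewrite /udlog /= mulr0 raddf0. Qed.

Lemma udlogV u : udlog u^-1%g = - udlog u.
Proof. by apply/eqP; rewrite -addr_eq0 -udlogM mulVg udlog1. Qed.

(** g encodes a combination of logarithmic derivatives of generators. Asking for all r at once makes
    the property stable under composition, which twists r by s, and under inversion. *)
Definition tame s g := forall r, {morph r : x y / (x * y)%g} ->
  dlog (jacobian (r \o s) s^-1%g) (jacobian r s) = udlog (r g).

Lemma tame_intro s g : (forall r, {morph r : x y / (x * y)%g} -> exists X',
    X' *m jacobian r s = 1%:M /\ dlog X' (jacobian r s) = udlog (r g)) -> tame s g.
Proof.
move=> H r rM; have [X' [X'J <-]] := H r rM; have [_ J'J] := jacobian_inv s rM.
by rewrite (mx_inv_unique X'J J'J).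
Qed.

Lemma tameM s t g h : tame s g -> tame t h -> tame (s * t)%g (s h * g)%g.
Proof.
move=> Hs Ht; apply: tame_intro => r rM; have rsM := comp_morph rM s.
have [sV Vs] := jacobian_inv s rM; have [tV Vt] := jacobian_inv t rsM.
exists (jacobian (r \o s) s^-1%g *m jacobian (r \o s \o t) t^-1%g).
rewrite jacobianM //; split.
  by rewrite -mulmxA [X in _ *m X]mulmxA tV mul1mx.
by rewrite dlogM // Hs // Ht // rM udlogM.
Qed.

Lemma tame1 : tame 1%g 1%g.
Proof.
apply: tame_intro => r rM; exists 1%:M; rewrite jacobian1 mul1mx; split=> //.
rewrite (gmorph1 rM) udlog1 /dlog (_ : eps _ = 0) ?mulmx0 ?mxtrace0 ?raddf0 //.
by apply/matrixP => i j; rewrite !mxE; case: eqP.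
Qed.

Lemma dlog11 : dlog 1%:M 1%:M = 0.
Proof.
rewrite /dlog (_ : eps _ = 0) ?mulmx0 ?mxtrace0 ?raddf0 //.
by apply/matrixP => i j; rewrite !mxE; case: eqP.
Qed.

Lemma tameV s g : tame s g -> tame s^-1%g (s^-1%g g)^-1%g.
Proof.
move=> Hs r rM; set t := s^-1%g; have rtM := comp_morph rM t; have := Hs _ rtM.
have Er : (r \o t) \o s = r by apply/funext => x;
  rewrite -[LHS]/(r (s^-1%g (s x))) autVK.
have [tV Vt] := jacobian_inv t rM; have [sV Vs] := jacobian_inv s rtM.
rewrite Er in sV Vs *; rewrite (gmorphV rM) udlogV => <-.
apply/eqP; rewrite -addr_eq0 addrC; apply/eqP; rewrite -dlogM //.
have E : jacobian (r \o t) s *m jacobian r t = 1%:M.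
  by rewrite -jacobianM // mulVg jacobian1.
have E' : jacobian (r \o t) t^-1%g *m jacobian r s^-1%g = 1%:M.
  by rewrite -[LHS]mulmx1 -E -mulmxA [X in _ *m X]mulmxA sV mul1mx tV E.
by rewrite E E' dlog11.
Qed.

Lemma tame_trans s i j : i != j ->
    (forall m, s (free_gen m) = if m == i then (free_gen i * free_gen j)%g else free_gen m) ->
  tame s 1%g.
Proof.
move=> ij Hs; apply: tame_intro => r rM; rewrite (gmorph1 rM) udlog1.
pose N : 'M[dual A]_n := \matrix_(a, b) (if (a == i) && (b == j)
  then uval (r (free_gen i)) else 0).
have J : jacobian r s = 1%:M + N.
  apply/matrixP => a b; rewrite !mxE Hs; case: eqP => [->|_] /=; last first.
    by rewrite fox_gen addr0; case: eqP.
  rewrite (foxM rM) !fox_gen [b == j]eq_sym; case: (i == b); case: (j == b);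
    rewrite ?mulr1 ?mulr0 ?addr0 //.
have NN : N *m N = 0.
  apply/matrixP => a b; rewrite !mxE big1 // => k _; rewrite !mxE.
  have [->|] := eqVneq k j; last by rewrite andbF mul0r.
  by rewrite [j == i]eq_sym (negbTE ij) mulr0.
exists (1%:M - N); rewrite J; split.
  by rewrite mulmxDr mulmxBl !mulmxBl !mulmx1 mul1mx NN subr0 subrK.
rewrite /dlog /mxtrace raddf_sum big1 // => a _; rewrite mxE raddf_sum big1 // => b _.
have nat_eps (c : bool) : dual_eps (c%:R : dual A) = 0 by case: c.
rewrite !mxE; have [/andP[/eqP -> /eqP ->]|_] := boolP ((b == i) && (a == j)).
  by rewrite [j == i]eq_sym (negbTE ij) /= subr0 mul0r raddf0.
by rewrite addr0 nat_eps mulr0 raddf0.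
Qed.

Lemma tame_perm s (f : 'I_n -> 'I_n) :
  (forall m, s (free_gen m) = free_gen (f m)) -> tame s 1%g.
Proof.
move=> Hs r rM; rewrite (gmorph1 rM) udlog1 /dlog (_ : eps _ = 0)
  ?mulmx0 ?mxtrace0 ?raddf0 //.
by apply/matrixP => i j; rewrite !mxE Hs fox_gen; case: eqP.
Qed.

Lemma udlog_prod r (I : Type) (l : seq I) (h : I -> F) : {morph r : x y / (x * y)%g} ->
  udlog (r (foldr (fun i x => h i * x) 1 l)%g) = \sum_(i <- l) udlog (r (h i)).
Proof.
move=> rM; elim: l => [|i l IHl] /=; first by rewrite big_nil (gmorph1 rM) udlog1.
by rewrite big_cons rM udlogM IHl.
Qed.

(** The Nielsen generators with a nontrivial contribution: reversing x_m puts -x_m^-1 on the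
    diagonal, which has the logarithmic derivative of x_m^-1. *)
Lemma tame_sign s (e : 'I_n -> bool) :
  (forall m, s (free_gen m) = free_letter (m, e m)) ->
  tame s (foldr (fun m x => (if e m then (free_gen m)^-1 else 1) * x) 1 (enum 'I_n))%g.
Proof.
move=> Hs; apply: tame_intro => r rM; rewrite udlog_prod //.
pose D : 'M[dual A]_n := \matrix_(i, j) (if i == j then (if e i then - uinv (r (free_gen i)) else 1) else 0).
pose D' : 'M[dual A]_n := \matrix_(i, j)
  (if i == j then (if e i then - uval (r (free_gen i)) else 1) else 0).
have J : jacobian r s = D.
  apply/matrixP => i j; rewrite !mxE Hs free_letterE /=; case: (e i).
    rewrite (crossedV rM (foxM rM _)) fox_gen; case: eqP => _ /=;
      first by rewrite mulr1.
    by rewrite mulr0 oppr0.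
  by rewrite fox_gen; case: eqP.
exists D'; rewrite J; split.
  apply/matrixP => i j; rewrite !mxE (bigD1 i) //= big1 => [|k ki]; last first.
    by rewrite !mxE eq_sym (negbTE ki) mul0r.
  rewrite !mxE eqxx addr0; case: eqP => [_|_]; last by rewrite mulr0.
  by case: (e i); rewrite ?mulr1 // mulrNN uvalK.
rewrite /dlog /mxtrace raddf_sum big_enum; apply: eq_bigr => i _.
rewrite mxE (bigD1 i) //= big1 => [|k ki]; last first.
  by rewrite !mxE eq_sym (negbTE ki) mul0r.
rewrite !mxE eqxx addr0; case: (e i) => /=;
  last by rewrite mulr0 raddf0 (gmorph1 rM) udlog1.
by rewrite (gmorphV rM) /udlog /= mulrNN.
Qed.

End LogarithmicTrace.

(** * Vanishing of the trace *)

Section TraceVanishing.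
Variable n : nat.
Local Notation F := (freeGroup n).
Local Notation L := (freeLie (abelianization F)).
Local Notation AutF := (autom F).
Local Notation S := (series n).
Local Open Scope ring_scope.
Implicit Types (s t : AutF) (i j : 'I_n) (u w : seq 'I_n).

(** One g serves for every trace chi, so words of length 1 can determine its exponent sums before
    words of length k are considered. *)
Lemma aut_tame s : exists g, forall chi : S -> int, {morph chi : a b / a - b} ->
  (forall a b, chi (a * b) = chi (b * a)) -> tame chi s g.
Proof.
elim: (aut_nielsen s) => {s} [|s t _ [g Hg] _ [h Hh]|s _ [g Hg]|s i j ij Hs|s e Hs|s f Hs].
- by exists 1%g => chi chiB chiM; apply: tame1.
- by exists (s h * g)%g => chi chiB chiM; apply: tameM => //; [apply: Hg|apply: Hh].
- by exists (s^-1%g g)^-1%g => chi chiB chiM; apply: tameV => //; apply: Hg.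
- by exists 1%g => chi chiB chiM; apply: tame_trans ij Hs.
- by eexists => chi chiB chiM; apply: tame_sign Hs.
- by exists 1%g => chi chiB chiM; apply: tame_perm Hs.
Qed.

Definition euler_dual (a : S) : dual S := Dual a (euler a).

Lemma euler_dualB : {morph euler_dual : a b / a - b}.
Proof.
move=> a b; apply: dualP => //=; apply: seriesP => w.
by rewrite /= mulrBr.
Qed.

Lemma euler_dualM : monoid_morphism euler_dual.
Proof.
split=> [|a b]; apply: dualP => //=; [exact: euler1|exact: eulerM].
Qed.

HB.instance Definition _ := GRing.isZmodMorphism.Build S (dual S)
  euler_dual euler_dualB.
HB.instance Definition _ := GRing.isMonoidMorphism.Build S (dual S)
  euler_dual euler_dualM.

Lemma fox_euler_dual (r : F -> unit_pair S) j x : {morph r : x y / (x * y)%g} ->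
  fox (unit_map euler_dual \o r) j x = euler_dual (fox r j x).
Proof.
move=> rM; have rdM : {morph unit_map euler_dual \o r : x y / (x * y)%g}.
  by move=> y z; rewrite /= rM unit_mapM.
move: x; apply: (crossed_eq rdM).
- exact: foxM rdM j.
- by move=> x y; rewrite (foxM rM) rmorphD rmorphM.
by move=> i; rewrite !fox_gen rmorph_nat.
Qed.

Definition magnus_dual : F -> unit_pair (dual S) :=
  unit_map euler_dual \o @magnus n.

Lemma magnus_dualM : {morph magnus_dual : x y / (x * y)%g}.
Proof. by move=> x y; rewrite /magnus_dual /= magnusM unit_mapM. Qed.

(** Fundamental formula of Fox calculus: [mu x - 1] and the sum are crossed morphisms that agree on
    generators. *)
Lemma mu_fox x : mu x = 1 + \sum_j fox (@magnus n) j x * ser_var j.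
Proof.
apply/eqP; rewrite addrC -subr_eq; apply/eqP; move: x.
apply: (crossed_eq (@magnusM n)).
- by move=> x y; rewrite muM mulrBr mulr1 -!/(mu x); zmod.
- move=> x y; rewrite mulr_sumr -big_split; apply: eq_bigr => j _.
  by rewrite (foxM (@magnusM n)) mulrDl mulrA.
move=> i; rewrite mu_gen addrAC subrr add0r (bigD1 i) //= fox_gen eqxx mul1r.
by rewrite big1 ?addr0 // => j ji; rewrite fox_gen eq_sym (negbTE ji) mul0r.
Qed.

Lemma fox_coef x j w : fox (@magnus n) j x w = mu x (rcons w j).
Proof.
rewrite mu_fox coefD coef1 -size_eq0 size_rcons add0r coef_sum (bigD1 j) //.
rewrite coefM_var eqxx mulr1 big1 => [|i ij]; first by rewrite /= addr0.
by rewrite coefM_var eq_sym (negbTE ij) mulr0.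
Qed.

Lemma hom_expsum (h : F -> int) x : (forall x y, h (x * y)%g = h x + h y) ->
  (forall i, expsum i x = 0) -> h x = 0.
Proof.
move=> hM; have h1 : h 1%g = 0 by apply: (addrI (h 1%g)); rewrite -hM mulg1 addr0.
have hV y : h y^-1%g = - h y by apply/eqP; rewrite -addr_eq0 -hM mulVg h1.
suff -> : h x = \sum_i h (free_gen i) * expsum i x.
  by move=> x0; rewrite big1 // => i _; rewrite x0 mulr0.
elim/free_gen_ind: x => [|j|x y Ex Ey|x Ex].
- by rewrite h1 big1 // => i _; rewrite expsum1 mulr0.
- rewrite (bigD1 j) //= expsum_gen eqxx mulr1 big1 ?addr0 // => i ij.
  by rewrite expsum_gen (negbTE ij) mulr0.
- by rewrite hM Ex Ey -big_split; apply: eq_bigr => i _; rewrite expsumM mulrDr.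
- by rewrite hV Ex -sumrN; apply: eq_bigr => i _; rewrite expsumV mulrN.
Qed.

Section Automorphism.
Variables (k : nat) (s : AutF) (d : derivation L).
Hypotheses (k1 : (1 < k)%N) (Hd : johnson_der k s d).

(** By [fox_coef] these are the coefficients of the Jacobian: dropping the last letter turns the
    leading term of degree k + 1 of [s x * x^-1] into a term of degree k. *)
Lemma jacobian_coef i j w : (size w <= k)%N -> mu (s (free_gen i)) (rcons w j) =
  ((i == j) && (w == [::]))%:Z + (size w == k)%:Z * iota (d (lie_var i)) (rcons w j).
Proof.
move=> wk; set x := free_gen i; pose y := (s x * x^-1)%g.
have gy : gr_class (1 + k) (d (lie_var i)) y by case: Hd => _; apply;
  apply: gr_class_gen.
have Oy := lcs_mu_ord (gr_class_lcs gy).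
have -> : s x = (y * x)%g by rewrite /y mulgVK.
rewrite muM mu_gen mulrDr mulr1 coefD coefM_var addrC; congr (_ + _).
  have [->|w0] := eqVneq w [::]; first by rewrite mu_nil mul1r andbT eq_sym.
  have := Oy w; rewrite coefB coef1 (negbTE w0) subr0 andbF => -> //.
have yE v : v != [::] -> mu y v = (mu y - 1) v.
  by move=> v0; rewrite coefB coef1 (negbTE v0) subr0.
have r0 : rcons w j != [::] by case: (w).
have [wk'|wk'] := eqVneq (size w) k; last first.
  by rewrite mul0r yE // Oy // size_rcons add1n ltnS ltn_neqAle wk'.
have := gr_class_lead gy (w := rcons w j).
rewrite coefB -yE // size_rcons add1n ltnS wk' => /(_ (leqnn _))/eqP.
by rewrite subr_eq0 mul1r => /eqP.
Qed.

Lemma johnson_trace0 u : size u = k -> der_trace u d = 0.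
Proof.
move=> su; have [g Hg] := aut_tame s.
pose J := jacobian (@magnus n) s; pose J' := jacobian (@magnus n \o s) s^-1%g.
have J'J : J' *m J = 1%:M by case: (jacobian_inv s (@magnusM n)).
have JE i j w : J i j w = mu (s (free_gen i)) (rcons w j) by rewrite mxE fox_coef.
have tr_eq v : ser_trace v (\tr (J' *m map_mx (@euler n) J)) =
    udlog (ser_trace v) (magnus_dual g).
  have chiB : {morph ser_trace v : a b / a - b}.
    by move=> a b; rewrite /ser_trace -sumrB; apply: eq_bigr => r _; rewrite coefB.
  rewrite -(Hg _ chiB (ser_traceM v) _ magnus_dualM) /dlog.
  congr (ser_trace v (\tr (_ *m _))); apply/matrixP => i j; rewrite !mxE.
    by rewrite (fox_euler_dual j _ (comp_morph (@magnusM n) s)).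
  by rewrite (fox_euler_dual j _ (@magnusM n)).
clearbody J J'; have eulerO i j : ser_ord k (euler (J i j)).
  move=> w wk; rewrite -[euler _ w]/((size w)%:Z * J i j w).
  rewrite JE jacobian_coef ?(ltnW wk) // (ltn_eqF wk) mul0r addr0.
  by case: w wk => [|a w] wk; rewrite ?andbF ?mul0r ?mulr0.
have euler_lead i j w : size w = k ->
    euler (J i j) w = k%:Z * iota (d (lie_var i)) (rcons w j).
  move=> wk; rewrite -[euler _ w]/((size w)%:Z * J i j w) JE jacobian_coef ?wk //.
  rewrite eqxx mul1r; case: w wk => [|a w] wk; last by rewrite andbF add0r.
  by move: k1; rewrite -wk.
have O0 (f : S) : ser_ord 0 f by [].
have tr_coef w : (size w <= k)%N -> (\tr (J' *m map_mx (@euler n) J)) w =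
    \sum_a \sum_b J' a b [::] * euler (J b a) w.
  move=> wk; rewrite /mxtrace coef_sum; apply: eq_bigr => a _.
  rewrite mxE coef_sum; apply: eq_bigr => b _; rewrite mxE.
  have [wk'|wk'] := eqVneq (size w) k.
    by rewrite (coefM_lead (O0 _) (eulerO b a)) ?take0 ?drop0.
  have lt : (size w < k)%N by rewrite ltn_neqAle wk'.
  by rewrite (ser_ordM (O0 _) (eulerO b a)) // eulerO // mulr0.
have J0 a b : J a b [::] = (a == b)%:Z.
  rewrite JE jacobian_coef // andbT (_ : (size [::] == k) = false) ?mul0r ?addr0 //.
  by apply/negbTE; rewrite eq_sym -lt0n ltnW.
(* Only the constant term of the inverse Jacobian matters, since the Euler derivative of J starts in
   degree k. *)
have J'0 a b : J' a b [::] = (a == b)%:Z.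
  transitivity ((J' *m J) a b [::]); last by rewrite J'J mxE; case: eqP.
  rewrite mxE coef_sum (bigD1 b) // big1 => [|c cb].
    by rewrite coefM_nil J0 eqxx mulr1 /= addr0.
  by rewrite coefM_nil J0 (negbTE cb) mulr0.
(* On the one-letter word i, of length 1 < k, the left side of [tr_eq] vanishes and the right side
   is the exponent sum of i in g. *)
have g0 i : expsum i g = 0.
  have tr1 f : ser_trace [:: i] f = f [:: i] by rewrite /ser_trace big_ord1 rot0.
  have := tr_eq [:: i]; rewrite /udlog !tr1 tr_coef; last exact: ltnW.
  rewrite big1 => [|a _]; last by rewrite big1 // => b _; rewrite eulerO ?mulr0.
  rewrite -[_ * _]/(uinv (magnus g) * euler (mu g)) -muV coefM big_ord_recl big_ord1 /=.
  by rewrite !mu_nil mul0r mulr0 addr0 !mul1r => /esym.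
have : ser_trace u (\tr (J' *m map_mx (@euler n) J)) = k%:Z * der_trace u d.
  rewrite /ser_trace /der_trace exchange_big mulr_sumr; apply: eq_bigr => r _.
  rewrite tr_coef ?size_rot ?su // mulr_sumr; apply: eq_bigr => a _.
  rewrite (bigD1 a) // big1 => [|b ba]; last by rewrite J'0 eq_sym (negbTE ba) mul0r.
  by rewrite J'0 eqxx mul1r euler_lead ?size_rot //= addr0.
(* As a function of the group element, the right side is a homomorphism to the integers, so it
   vanishes at g; k is then cancelled in the integers. *)
rewrite tr_eq (@hom_expsum (fun x => udlog (ser_trace u) (magnus_dual x)))
  // => [/esym/eqP|x y].
  by rewrite mulf_eq0 => /orP[|/eqP //]; move: k1; case: (k).
rewrite magnus_dualM udlogM //; last exact: ser_traceM.
by move=> a b; rewrite /ser_trace -sumrB; apply: eq_bigr => r _; rewrite coefB.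
Qed.

End Automorphism.
End TraceVanishing.

(** * The stable range *)

Section Conclusion.
Variable n : nat.
Local Notation F := (freeGroup n).
Local Notation V := (abelianization F).
Local Notation L := (freeLie V).
Local Notation AutF := (autom F).
Local Open Scope ring_scope.
Implicit Types (d e : derivation L) (s t : AutF).

Lemma left_coset_eq (G : groupType) (H : set G) (x y : G) : is_subgroup H ->
  left_coset x H = left_coset y H <-> H (x^-1 * y)%g.
Proof.
move=> sH; split=> [E|Hxy].
  have : left_coset y H y by exists 1%g; [apply: subgroup1|rewrite mulg1].
  by rewrite -E => -[z Hz <-]; rewrite mulKg.
apply/seteqP; split=> _ [z Hz <-].
  exists ((x^-1 * y)^-1 * z)%g; last by grp.
  by apply: subgroupM => //; apply: subgroupV.
exists (x^-1 * y * z)%g; last by grp.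
exact: subgroupM.
Qed.

Lemma lie_subring_gen_subring (A : set (derivation L)) :
  is_lie_subring (lie_subring_gen A).
Proof.
split=> [B [] [] //|x y Ax Ay B sB|x y Ax Ay B sB].
  by case: (sB) => -[_ BB _] _; apply: BB; [apply: Ax | apply: Ay].
by case: (sB) => -[_ _ BL] _; apply: BL; [apply: Ax | apply: Ay].
Qed.

Lemma igen_subring k d : igen k d -> lie_subring_gen (der_deg 1) d.
Proof.
have [S0 SB SL] := lie_subring_gen_subring (der_deg 1).
elim=> {k d} [d Hd|k|k d e _ Hd _ He|k d e Hd _ He] //.
- by move=> B [_ sAB]; apply: sAB.
- exact: SB.
- by apply: SL => // B [_ sAB]; apply: sAB.
Qed.

(** The generated subring ignores degrees, so its elements are first written as sums of homogeneous
    pieces; [igen_sum_component] isolates one piece by the length of the words in its values. *)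
Inductive igen_sum : derivation L -> Prop :=
| igen_sum_igen k d : igen k.+1 d -> igen_sum d
| igen_sumB d e : igen_sum d -> igen_sum e -> igen_sum (d - e).

Lemma igen_sum_subring : is_lie_subring igen_sum.
Proof.
have S0 : igen_sum 0 by apply: (@igen_sum_igen 0); apply: igen0.
have SD d e : igen_sum d -> igen_sum e -> igen_sum (d + e).
  move=> Hd He; rewrite -[e]opprK; apply: igen_sumB => //.
  by rewrite -sub0r; apply: igen_sumB.
split=> // [|d e Hd]; first exact: igen_sumB.
elim: Hd e => {d} [k d Hd|d d' _ Hd _ Hd'] e He; last first.
  by rewrite lieDl lieNl; apply: igen_sumB; [apply: Hd|apply: Hd'].
elim: He => {e} [j e He|e e' _ He _ He'].
  have := igen_lie Hd He; rewrite addnS; exact: igen_sum_igen.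
by rewrite lieDr lieNr; apply: igen_sumB.
Qed.

Lemma igen_sum_component k d : igen_sum d -> exists2 e, igen k.+1 e &
  forall i w, size w = k.+2 -> iota ((d - e) (lie_var i)) w = 0.
Proof.
elim=> {d} [j d Hd|d d' _ [e He E] _ [e' He' E']]; last first.
  exists (e - e'); first exact: igenB.
  move=> i w sw; have -> : d - d' - (e - e') = d - e - (d' - e') by zmod.
  by rewrite der_subE iotaB coefB E ?E' // subrr.
have [Ejk|jk] := eqVneq j k.
  by exists d => [|i w _]; [rewrite -Ejk|rewrite subrr iota0].
exists 0 => [|i w sw]; first exact: igen0.
rewrite subr0; apply: (iota_homog (igen_deg Hd (lie_deg_gen _))).
by rewrite sw add1n => -[kj]; rewrite kj eqxx in jk.
Qed.

Lemma der_gen1P k d : (0 < k)%N -> der_gen1 V k d <-> igen k d.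
Proof.
case: k => // k _; split=> [[Sd dd]|Id]; last first.
  by split; [apply: igen_subring Id | apply: igen_deg].
have /(@igen_sum_component k)[e Ie E] : igen_sum d.
  apply: Sd; split; first exact: igen_sum_subring.
  by move=> e He; apply: (@igen_sum_igen 0); apply: igen1.
suff -> : d = e by [].
apply/eqP; rewrite -subr_eq0; apply/eqP/der_var_eq => i.
have D : lie_deg k.+2 ((d - e) (lie_var i)).
  exact: der_degB dd (igen_deg Ie) _ _ (lie_deg_gen _).
apply: (iota_inj D); apply: seriesP => w.
have [sw|/eqP sw] := eqVneq (size w) k.+2; first by rewrite E.
exact: iota_homog D w sw.
Qed.

Section Stable.
Variable k : nat.
Hypotheses (hk : (1 <= k)%N) (hkn : (k + 2 <= n)%N).

(** For k > 1, [trace0_igen] asks for trace zero on the subring and on d. Both follow from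
    [johnson_trace0], the first because [igen_realized] makes elements of the subring Johnson
    images. *)
Lemma johnson_igen s d : andreadakis n k s -> johnson_der k s d -> igen k d.
Proof.
move=> As Hd; have [k1|k1] := ltnP 1 k; last first.
  have E : k = 1%N by apply/eqP; rewrite eqn_leq k1.
  by case: Hd => dd _; rewrite E in dd *; apply: igen1.
apply: (trace0_igen k1 hkn) => [u e su Ie||u su].
- have [t Lt Ht] := igen_realized hk Ie;
  exact: (johnson_trace0 k1 Ht su).
- by case: Hd.
- exact: (johnson_trace0 k1 Hd su).
Qed.

Local Notation N := (andreadakis n k.+1).

Lemma johnson_coset s t d e : andreadakis n k s -> andreadakis n k t ->
  johnson_der k s d -> johnson_der k t e ->
  left_coset s N = left_coset t N <-> d = e.
Proof.
move=> As At Hd He; rewrite left_coset_eq; last exact: andreadakis_subgroup.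
have Hst := johnsonD hk At (johnsonV hk As Hd) He.
split=> [Nst|de]; last first.
  by apply: johnson0_andreadakis; move: Hst; rewrite de addNr.
have := johnson_unique Hst (johnson0 hk Nst) => /eqP.
by rewrite addrC subr_eq0 => /eqP.
Qed.

Lemma lcs_IA_subset j : (0 < j)%N -> lcs (IA n) j `<=` andreadakis n j.
Proof. by move=> j0 s /(lcs_IA_johnson j0) []. Qed.

Lemma set_mulg_coset s t : andreadakis n k t ->
  set_mulg (left_coset s N) (left_coset t N) = left_coset (s * t)%g N.
Proof.
move=> At; have sN := andreadakis_subgroup n k.+1.
have AtV := subgroupV (andreadakis_subgroup n k) At.
apply/seteqP; split=> [_ [_ [x Nx <-] [_ [y Ny <-] <-]]|_ [x Nx <-]].
  (* Normality: [comm t^-1 x * x] is [t^-1 * x * t], kept in N by the commutator rule of the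
     filtration. *)
  exists (comm t^-1 x * x * y)%g; last by grp.
  apply: (subgroupM sN) => //; apply: (subgroupM sN) => //.
  apply: andreadakis_sub (andreadakis_comm hk _ AtV Nx) => //.
  by rewrite leq_addl.
exists (s * 1)%g; first by exists 1%g => //; apply: (subgroup1 sN).
by exists (t * x)%g; [exists x | rewrite mulg1 mulgA].
Qed.

(** Turns the relation [johnson_der], which depends only on the coset by [johnson_coset], into a
    function, with value 0 on sets that are not cosets. *)
Definition johnson_map (C : set AutF) : derivation L :=
  xget 0 [set d | exists s, [/\ andreadakis n k s, left_coset s N = C &
    johnson_der k s d]].

Lemma johnson_mapP s : andreadakis n k s ->
  johnson_der k s (johnson_map (left_coset s N)).
Proof.
move=> As; have [d Hd] := johnson_exists hk As; rewrite /johnson_map.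
case: xgetP => [e _ [t [At E He]]|/(_ d) []]; last by exists s.
by rewrite (proj1 (johnson_coset At As He Hd) E).
Qed.

End Stable.
End Conclusion.

Theorem theorem2p38 (k n : nat) (hk : (1 <= k)%N) (hkn : (k + 2 <= n)%N) :
  set_surj
    (cosets (lcs (IA n) k) (lcs (IA n) k.+1))
    (cosets (andreadakis n k) (andreadakis n k.+1))
    (coset_incl (andreadakis n k.+1)) /\
  exists tau : set (autom (freeGroup n)) ->
               derivation (freeLie (abelianization (freeGroup n))),
    [/\ forall s, andreadakis n k s ->
          johnson_der k s (tau (left_coset s (andreadakis n k.+1))),
        forall C D,
          cosets (andreadakis n k) (andreadakis n k.+1) C ->
          cosets (andreadakis n k) (andreadakis n k.+1) D ->
          tau (set_mulg C D) = (tau C + tau D)%R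
      & set_bij (cosets (andreadakis n k) (andreadakis n k.+1))
          (der_gen1 (abelianization (freeGroup n)) k) tau].
Proof.
split.
  (* The Johnson derivation of s is also that of some t in the lower central series of [IA n], and
     equal derivations mean equal cosets. *)
  move=> _ [s As <-]; have [d Hd] := johnson_exists hk As.
  have [t Lt Ht] := igen_realized hk (johnson_igen hk hkn As Hd).
  have At := lcs_IA_subset hk Lt.
  exists (left_coset t (lcs (IA n) k.+1)); first by exists t.
  rewrite coset_inclE.
  - exact/(johnson_coset hk At As Ht Hd).
  - exact/lcs_subgroup/IA_subgroup.
  - exact: andreadakis_subgroup.
  - exact: lcs_IA_subset.
exists (johnson_map k); split; first exact: johnson_mapP.
  move=> _ _ [s As <-] [t At <-]; rewrite set_mulg_coset //.
  have Ast := subgroupM (andreadakis_subgroup n k) As At.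
  by apply: johnson_unique (johnson_mapP hk Ast) (johnsonD hk At _ _);
    apply: johnson_mapP.
split=> [_ [s As <-]|_ _ /set_mem[s As <-] /set_mem[t At <-] E|d /(der_gen1P _ hk) Id].
- exact/(der_gen1P _ hk)/(johnson_igen hk hkn As)/johnson_mapP.
- exact/(johnson_coset hk As At (johnson_mapP hk As) (johnson_mapP hk At)).
have [s Ls Hs] := igen_realized hk Id; have As := lcs_IA_subset hk Ls.
exists (left_coset s (andreadakis n k.+1)); first by exists s.
exact: johnson_unique (johnson_mapP hk As) Hs.
Qed.
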